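(* Let $n\ge2$, let $W=(w_1,\dots,w_N)$ be a weight vector and $N_W=1/\sum_{i=1}^Nw_i^2$. Let $q=2\ell-1+\varepsilon$ with $\ell\ge1$ and $\varepsilon\in\{0,1\}$, and let $s\in I_q=[t_{\ell-1+\varepsilon}^{1,1-\varepsilon},t_\ell^{1,\varepsilon}]$ be such that $N_q:=L_q(n,s)\ge N$. Let the potential $h$ satisfy $h^{(q)}\ge0$ on $[-1,s]$. Then $$\mathcal{U}^h(s,W)\ \le\ -\lambda^{*}f_0\left(1-\frac{N_q}{N_W}\right)+(g_T)_0-\frac{g_T(1)}{N_W},$$ where $f_0$ is the zeroth Gegenbauer coefficient of the Levenshtein polynomial $f_q^{(n,s)}$, $g_T$ is the Hermite interpolating polynomial to $h$ at the multiset of nodes $T$, and $\lambda^{*}$ is the constant, all defined in the context.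
   Context: **Energy.** $\mathbb{S}^{n-1}$ is the unit sphere in $\mathbb{R}^n$. A weight vector is $W=(w_1,\dots,w_N)$ with all $w_i>0$ and $\sum_i w_i=1$. A potential is a continuous extended-real-valued $h:[-1,1]\to\mathbb{R}\cup\{+\infty\}$, finite on $[-1,1)$. For an $N$-tuple $C=(x_1,\dots,x_N)$ of distinct points of $\mathbb{S}^{n-1}$, $E_h(C,W)=\sum_{i\ne j}w_iw_jh(x_i\cdot x_j)$ and $s(C)=\max_{i\ne j}x_i\cdot x_j$. For $s\in[-1,1)$, $\mathcal{U}^h(s,W)=\sup\{E_h(C,W): |C|=N,\ s(C)=s\}$, with $\sup\emptyset=-\infty$. **Gegenbauer polynomials.** $d\mu_n(t)=\gamma_n(1-t^2)^{(n-3)/2}dt$ is the probability measure on $[-1,1]$ with $\gamma_n=\Gamma(n/2)/(\sqrt{\pi}\,\Gamma((n-1)/2))$; $P_i^{(n)}$ is the degree $i$ orthogonal polynomial for $\mu_n$ with $P_i^{(n)}(1)=1$. Any real polynomial is expanded as $f=\sum_i f_iP_i^{(n)}$, and $f_i$, $(g_T)_i$ denote Gegenbauer coefficients. **Levenshtein parameters.** For $a,b\in\{0,1\}$ let $t_\ell^{a,b}$ be the largest zero of the Jacobi polynomial $P_\ell^{(a+(n-3)/2,\,b+(n-3)/2)}$, $\ell\ge1$, with $t_0^{1,1}=-1$. The Levenshtein function is, for $q=2\ell-1+\varepsilon$, $$L_q(n,s)=\binom{\ell+n-3+\varepsilon}{n-2}\left[\frac{2\ell+n-3+2\varepsilon}{n-1}-\frac{(1+s)^{\varepsilon}\left(P_{\ell-1+\varepsilon}^{(n)}(s)-P_{\ell+\varepsilon}^{(n)}(s)\right)}{(1-s)\left(\varepsilon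 P_\ell^{(n)}(s)+P_{\ell+\varepsilon}^{(n)}(s)\right)}\right],\quad s\in I_q.$$ The Levenshtein polynomial $f_q^{(n,s)}(t)=\sum_{i=0}^qf_iP_i^{(n)}(t)$ is the monic multiple of $(1+t)^{\varepsilon}(t-s)K_{\ell-1}(t,s)^2$, where $K_{\ell-1}$ is the reproducing kernel of the space of polynomials of degree at most $\ell-1$ in $L^2((1-t)(1+t)^{\varepsilon}d\mu_n)$. It is known that $L_q(n,s)=f_q^{(n,s)}(1)/f_0$ and $f_i>0$ for $i=1,\dots,q$. Its distinct roots are $\alpha_0^{(n,s)}<\dots<\alpha_{\ell-1+\varepsilon}^{(n,s)}=s$, with $\alpha_0^{(n,s)}=-1$ when $\varepsilon=1$. **Multiset $T$.** If $q=2\ell-1$, $T$ contains each of $\alpha_0^{(n,s)},\dots,\alpha_{\ell-2}^{(n,s)}$ twice and $\alpha_{\ell-1}^{(n,s)}=s$ once. If $q=2\ell$, $T$ contains $\alpha_0^{(n,s)}=-1$ once, each of $\alpha_1^{(n,s)},\dots,\alpha_{\ell-1}^{(n,s)}$ twice, and $\alpha_\ell^{(n,s)}=s$ once. Thus $|T|=q$ with multiplicity. The polynomial $g_T=\sum_{i=0}^{q-1}(g_T)_iP_i^{(n)}$ is the unique polynomial of degree at most $q-1$ agreeing with $h$ at simple nodes of $T$ and agreeing with $h$ in value and first derivative at double nodes of $T$. **Constant $\lambda^*$.** Let $I(g_T)=\{i\in\{1,\dots,q-1\}:(g_T)_i>0\}$. Then $\lambda^{*}=\max\{(g_T)_i/f_i: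 i\in I(g_T)\}$, and $\lambda^*=0$ if $I(g_T)=\emptyset$. *)

(* Defs.v *)
From HB Require Import structures.
From mathcomp Require Import all_boot all_order all_algebra.
From mathcomp Require Import polyrcf.
From mathcomp Require Import all_classical all_reals all_analysis.

Set Implicit Arguments.
Unset Strict Implicit.
Unset Printing Implicit Defensive.

Import Order.TTheory GRing.Theory Num.Theory.
Import numFieldNormedType.Exports.

Local Open Scope classical_set_scope.
Local Open Scope ring_scope.

Section Energy.
Context {R : realType}.
Implicit Types (h : R -> \bar R) (n N : nat) (s : R).

Definition dot n (x y : 'rV[R]_n) : R := \sum_(i < n) x 0 i * y 0 i.

Definition sphere n : set 'rV[R]_n := [set x | dot x x = 1].

Definition weight_vector N (W : 'I_N -> R) : Prop :=
  (forall i, 0 < W i) /\ \sum_(i < N) W i = 1.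

(* Only the values of h on [-1, 1] are meaningful. *)
Definition potential h : Prop :=
  [/\ {within `[-1, 1], continuous h},
      forall t, t \in `[-1, 1] -> h t != -oo%E &
      forall t, t \in `[-1, 1[ -> h t \is a fin_num].

Definition spherical_code n N (C : 'I_N -> 'rV[R]_n) : Prop :=
  (forall i, sphere (C i)) /\ injective C.

Definition energy h n N (W : 'I_N -> R) (C : 'I_N -> 'rV[R]_n) : \bar R :=
  (\sum_(i < N) \sum_(j < N | i != j)
     (W i * W j)%:E * h (dot (C i) (C j)))%E.

(* For N = 1 the maximum is over the empty set and equals -oo, so that no
   one-point code satisfies s(C) = s for a real s. *)
Definition max_dot n N (C : 'I_N -> 'rV[R]_n) : \bar R :=
  \big[maxe/-oo%E]_(i < N) \big[maxe/-oo%E]_(j < N | i != j)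
     (dot (C i) (C j))%:E.

Definition sup_energy h n N (W : 'I_N -> R) s : \bar R :=
  ereal_sup [set energy h W C |
             C in [set C : 'I_N -> 'rV[R]_n | spherical_code C /\ max_dot C = s%:E]].

Definition NW N (W : 'I_N -> R) : R := 1 / \sum_(i < N) W i ^+ 2.

End Energy.

Section OrthogonalPolynomials.
Context {R : realType}.
Implicit Types (w : R -> R) (p r : {poly R}) (n k l : nat) (a b c s : R).

Definition ipw w p r : R :=
  \int[lebesgue_measure]_(t in `[-1, 1]) (w t * p.[t] * r.[t]).

Definition is_orthopoly w k c p : Prop :=
  [/\ size p = k.+1, p.[1] = c &
      forall r, (size r <= k)%N -> ipw w p r = 0].

(* The degree k orthogonal polynomial for the weight w on [-1, 1], with value
   c at 1; it exists and is unique when w is integrable, positive on ]-1, 1[,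
   and c != 0. *)
Definition orthopoly w k c : {poly R} := xget 0 [set p | is_orthopoly w k c p].

Definition Gamma a : R :=
  \int[lebesgue_measure]_(t in `[0, +oo[) (t `^ (a - 1) * expR (- t)).

Definition gamma_const n : R :=
  Gamma (n%:R / 2) / (Num.sqrt pi * Gamma ((n%:R - 1) / 2)).

Definition mu_density n (t : R) : R :=
  gamma_const n * (1 - t ^+ 2) `^ ((n%:R - 3) / 2).

Definition gegenbauer n k : {poly R} := orthopoly (mu_density n) k 1.

(* The finite sequence of coefficients of p in the basis (P_i^(n))_i is stored
   as the coefficient list of a polynomial. *)
Definition gegenbauer_coefs n p : {poly R} :=
  xget 0 [set c : {poly R} | p = \sum_(i < size c) c`_i *: gegenbauer n i].

Definition gcoef n p k : R := (gegenbauer_coefs n p)`_k.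

(* Standard normalisation: the value at 1 is the generalised binomial
   coefficient (k + a choose k). *)
Definition jacobi a b k : {poly R} :=
  orthopoly (fun t => (1 - t) `^ a * (1 + t) `^ b) k
            (\prod_(1 <= i < k.+1) ((a + i%:R) / i%:R)).

(* t_l^{a,b}; only t_0^{1,1} is needed among the l = 0 cases. *)
Definition jacobi_max_zero n (a b : bool) l : R :=
  if l is 0%N then -1
  else last 0 (rootsR (jacobi (a%:R + (n%:R - 3) / 2)
                              (b%:R + (n%:R - 3) / 2) l)).

End OrthogonalPolynomials.

Section Levenshtein.
Context {R : realType}.
Implicit Types (n l : nat) (eps : bool) (s : R) (p g : {poly R}).

Definition lev_deg l eps : nat := (2 * l - 1 + eps)%N.

Definition lev_interval n l eps : set R :=
  `[jacobi_max_zero n true (~~ eps) (l - 1 + eps),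
    jacobi_max_zero n true eps l].

(* L_q(n, s) for q = 2 l - 1 + eps. *)
Definition lev_fun n l eps s : R :=
  let P := fun k => (gegenbauer n k).[s] in
  'C(l + n + eps - 3, n - 2)%:R *
  ((2 * l%:R + n%:R - 3 + 2 * eps%:R) / (n%:R - 1) -
   ((1 + s) ^+ eps * (P (l - 1 + eps)%N - P (l + eps)%N)) /
   ((1 - s) * (eps%:R * P l + P (l + eps)%N))).

Definition lev_weight n eps (t : R) : R :=
  (1 - t) * (1 + t) ^+ eps * mu_density n t.

(* K_{l-1}(., s): the reproducing kernel at s of the polynomials of degree at
   most l - 1 in L^2((1 - t) (1 + t)^eps dmu_n). *)
Definition lev_kernel n l eps s : {poly R} :=
  xget 0 [set K : {poly R} | (size K <= l)%N /\
    forall p, (size p <= l)%N -> ipw (lev_weight n eps) p K = p.[s]].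

Definition lev_poly n l eps s : {poly R} :=
  let F := ('X + 1) ^+ eps * ('X - s%:P) * lev_kernel n l eps s ^+ 2 in
  (lead_coef F)^-1 *: F.

(* [rootsR] lists the distinct real roots in increasing order. *)
Definition lev_node n l eps s (i : nat) : R :=
  (rootsR (lev_poly n l eps s))`_i.

Definition multiset_T n l eps s : seq R :=
  let alpha := lev_node n l eps s in
  nseq eps (alpha 0%N)
  ++ flatten [seq nseq 2 (alpha i) | i <- iota eps (l - 1)]
  ++ [:: alpha (l - 1 + eps)%N].

End Levenshtein.

Section Hermite.
Context {R : realType}.
Implicit Types (f : R -> R) (h : R -> \bar R) (t s : R) (g : {poly R}).

(* Derivatives of a function on [-1, 1[: two-sided inside the interval,
   one-sided at -1. *)
Definition diff_quotient f t : R -> R := fun u => (f u - f t) / (u - t).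

Definition hderiv f t : R :=
  lim (diff_quotient f t @ within `[-1, 1[ t^').

Definition hderivn k f : R -> R := iter k hderiv f.

Fixpoint hderivable k f t : Prop :=
  if k is k'.+1 then
    (\forall u \near within `[-1, 1[ (nbhs t), hderivable k' f u) /\
    cvg (diff_quotient (hderivn k' f) t @ within `[-1, 1[ t^')
  else True.

Definition deriv_ge0 k h s : Prop :=
  forall t, t \in `[-1, s] ->
    hderivable k (fine \o h) t /\ 0 <= hderivn k (fine \o h) t.

Definition is_hermite h (T : seq R) g : Prop :=
  (size g <= size T)%N /\
  forall t, t \in T ->
    g.[t] = fine (h t) /\
    (count_mem t T = 2%N -> g^`().[t] = hderiv (fine \o h) t).

Definition hermite h (T : seq R) : {poly R} := xget 0 [set g | is_hermite h T g].

(* The maximum of (g_T)_i / f_i over I(g_T), and 0 if I(g_T) is empty. *)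
Definition lambda_star n q (g f : {poly R}) : R :=
  let r := [seq gcoef n g i / gcoef n f i | i <- iota 1 (q - 1) & 0 < gcoef n g i]
  in \big[Num.max/head 0 r]_(x <- r) x.

End Hermite.

(* Main.v *)
(* Put G = g_T - lambda^* f.  By the error formula for Hermite interpolation (via
   Rolle), h - g_T is on [-1, s] a nonnegative multiple of the nodal polynomial of
   T, which is <= 0 there; as f <= 0 on [-1, s] too, h <= G on the inner products of
   any code with s(C) = s.  The choice of lambda^* and f_i > 0 make every
   Gegenbauer coefficient of G of positive degree nonpositive, so Schoenberg's
   inequality gives E_h(C, W) <= G_0 - G(1) / N_W, and f(1) = L_q(n, s) f_0 turns
   this into the stated bound.

   The properties of f are proved from the single integral identity
   L((1 - t^2) p') = (n - 1) L(t p): the Levenshtein polynomial is a positive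
   multiple of (1 + t)^eps psi K, where psi = (t - s) K is a nonnegative combination
   of two consecutive adjacent polynomials.  Both factors are positive definite and
   products of Gegenbauer polynomials have nonnegative Gegenbauer coefficients. *)
Require Import Defs.
From HB Require Import structures.
From mathcomp Require Import all_boot all_order all_algebra.
From mathcomp Require Import polyrcf.
From mathcomp Require mpoly.
From mathcomp Require Import all_classical all_reals all_analysis.
From mathcomp Require Import measurable_realfun.
From mathcomp Require Import ring lra zify.
Set Implicit Arguments.
Unset Strict Implicit.
Unset Printing Implicit Defensive.
Import Order.TTheory GRing.Theory Num.Theory.
Import numFieldNormedType.Exports.
Local Open Scope ring_scope.

(** * Gauss quadrature for positive functionals *)

(** Orthogonal polynomials are handled through abstract positive functionals over a real closed
    field; integrals appear only when the functionals are instantiated. Three weights interact: the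
    measure of the sphere and its products with 1 - t and 1 - t^2. The location of s in
    [lev_interval] is a statement about zeros for two different weights, and no interlacing theorem
    is invoked: each such fact comes from testing one polynomial, small in degree and of known sign
    at the nodes, in the Gauss formula of the neighbouring weight. Since s may be the left endpoint
    of its interval, K may vanish at -1 when eps = 0, and b in the decomposition of psi may be 0;
    strict positivity of the f_i therefore has to come from the top term alone. Schoenberg's
    inequality is obtained as nonnegativity of a Gram matrix: the harmonic polynomials |y|^k
    P_k(x.y/|y|) have Fischer products proportional to P_k(x.x'). Nonnegativity of product
    coefficients comes from a discrete wave equation. For n = 2 the weight is unbounded at both
    ends, which dictates the integration lemmas on open intervals. *)

Section Nodes.
Variable R : rcfType.
Implicit Types (p q : {poly R}) (zs : seq R).

Definition nodal zs : {poly R} := \prod_(z <- zs) ('X - z%:P).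

Lemma nodal_cons z zs : nodal (z :: zs) = ('X - z%:P) * nodal zs.
Proof. by rewrite /nodal big_cons. Qed.

Lemma nodal_cat zs ys : nodal (zs ++ ys) = nodal zs * nodal ys.
Proof. by rewrite /nodal big_cat. Qed.

Lemma nodal_monic zs : nodal zs \is monic.
Proof. exact: monic_prod_XsubC. Qed.

Lemma nodal_neq0 zs : nodal zs != 0.
Proof. exact: monic_neq0 (nodal_monic _). Qed.

Lemma size_nodal zs : size (nodal zs) = (size zs).+1.
Proof. exact: size_prod_XsubC. Qed.

Lemma root_nodal zs x : root (nodal zs) x = (x \in zs).
Proof. exact: root_prod_XsubC. Qed.

Lemma nodal_eval0 zs x : x \in zs -> (nodal zs).[x] = 0.
Proof. by rewrite -root_nodal => /rootP. Qed.

Lemma nodal_eval_neq0 zs x : x \notin zs -> (nodal zs).[x] != 0.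
Proof. by rewrite -root_nodal. Qed.

Lemma nodal_perm zs ys : perm_eq zs ys -> nodal zs = nodal ys.
Proof. exact: perm_big. Qed.

Lemma nodal_rem z zs : z \in zs -> nodal zs = ('X - z%:P) * nodal (rem z zs).
Proof. by move=> /perm_to_rem/nodal_perm->; rewrite nodal_cons. Qed.

Lemma nodal_dvd p zs : uniq zs -> {in zs, forall z, root p z} ->
  exists q, p = q * nodal zs.
Proof.
move=> uzs rzs; apply: uniq_roots_prod_XsubC; first exact/allP.
by rewrite uniq_rootsE.
Qed.

Lemma nodal_eq p zs : uniq zs -> {in zs, forall z, root p z} ->
  size p = (size zs).+1 -> p = lead_coef p *: nodal zs.
Proof.
move=> uzs rzs sp; apply: all_roots_prod_XsubC => //; first exact/allP.
by rewrite uniq_rootsE.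
Qed.

Lemma nodal_gt0 zs x : {in zs, forall z, z < x} -> 0 < (nodal zs).[x].
Proof.
move=> zx; rewrite /nodal horner_prod big_seq prodr_gt0 // => z /zx.
by rewrite hornerXsubC subr_gt0.
Qed.

Lemma noroot_sign p (a b : R) : a < b -> {in `]a, b[, forall x, ~~ root p x} ->
  (forall x, a < x < b -> 0 <= p.[x]) \/ (forall x, a < x < b -> p.[x] <= 0).
Proof.
move=> ab nr; pose m := (a + b) / 2.
have mab : a < m < b by rewrite /m; lra.
have key x : a < x < b -> 0 <= p.[m] * p.[x].
  move=> xab; rewrite leNgt; apply/negP => neg.
  case: (leP m x) => mx.
    have [y yI ry] := poly_ivtoo mx neg.
    have /nr/negP/(_ ry)// : y \in `]a, b[.
    by move: yI; rewrite !in_itv /= => ?; lra.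
  rewrite mulrC in neg; have [y yI ry] := poly_ivtoo (ltW mx) neg.
  have /nr/negP/(_ ry)// : y \in `]a, b[.
  by move: yI; rewrite !in_itv /= => ?; lra.
have pm0 : p.[m] != 0 by apply: nr; rewrite in_itv.
case: (ltgtP 0 p.[m]) pm0 => // pm _; [left|right] => x /key.
  by rewrite pmulr_rge0.
by rewrite nmulr_rge0.
Qed.

(** Dividing out a root z toggles the membership of z in the list, so exactly the roots of odd
    multiplicity remain. Once no root is left in the interval, [noroot_sign] applies. *)
Lemma sign_changes p (a b : R) : p != 0 -> a < b -> exists zs,
  [/\ uniq zs, {in zs, forall z, (a < z < b) && root p z} &
   (forall x, a < x < b -> 0 <= (p * nodal zs).[x]) \/
   (forall x, a < x < b -> (p * nodal zs).[x] <= 0)].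
Proof.
move=> + ab; have [n] := ubnP (size p); elim: n => // n IH in p *.
rewrite ltnS => sp p0.
case E : (roots p a b) => [|z rs]; last first.
  have : z \in roots p a b by rewrite E mem_head.
  rewrite in_roots => /and3P[rz zab _]; rewrite in_itv /= in zab.
  have [q pq] := factor_theorem _ _ rz.
  have q0 : q != 0 by apply: contraNneq p0 => q0; rewrite pq q0 mul0r.
  have sq : (size q < n)%N.
    by apply: leq_trans sp; rewrite pq size_Mmonic ?monicXsubC// size_XsubC addn2.
  have [zs [uzs rzs sgn]] := IH q sq q0.
  have [zin|znin] := boolP (z \in zs).
    exists (rem z zs); split; first exact: rem_uniq.
      by move=> y /mem_rem/rzs; rewrite pq rootM => /andP[-> ->].
    by rewrite pq -mulrA -nodal_rem.
  exists (z :: zs); split; first by rewrite /= znin.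
    move=> y; rewrite inE => /predU1P[->|/rzs]; first by rewrite zab rz.
    by rewrite pq rootM => /andP[-> ->].
  rewrite nodal_cons pq.
  have e x : (q * ('X - z%:P) * (('X - z%:P) * nodal zs)).[x] =
     (x - z) ^+ 2 * (q * nodal zs).[x] by rewrite !hornerM hornerXsubC; ring.
  by case: sgn => sgn; [left|right] => x /sgn H; rewrite e;
    [apply: mulr_ge0|apply: mulr_ge0_le0] => //; exact: sqr_ge0.
exists [::]; split => //; rewrite /nodal big_nil mulr1.
apply: noroot_sign => // x xab; apply/negP => rx.
have : x \in roots p a b by rewrite in_roots rx xab.
by rewrite E.
Qed.

End Nodes.

Section PositiveFunctional.
Variable R : rcfType.
Implicit Types (p q r Q : {poly R}) (zs : seq R).

(** Models integration against a weight that is positive on ]-1, 1[; strictness for nonzero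
    polynomials is what makes the associated form definite. *)
Definition posfun (M : {poly R} -> R) : Prop :=
  (forall a p q, M (a *: p + q) = a * M p + M q) /\
  (forall p, p != 0 -> (forall x, -1 < x < 1 -> 0 <= p.[x]) -> 0 < M p).

Variables (M : {poly R} -> R) (HM : posfun M).

Lemma pf0 : M 0 = 0.
Proof. by have /eqP := HM.1 1 0 0; rewrite scale1r addr0 mul1r -subr_eq0 opprD addrA subrr add0r oppr_eq0 => /eqP. Qed.

Lemma pfD p q : M (p + q) = M p + M q.
Proof. by have := HM.1 1 p q; rewrite scale1r mul1r. Qed.

Lemma pfZ a p : M (a *: p) = a * M p.
Proof. by have := HM.1 a p 0; rewrite pf0 !addr0. Qed.

Lemma pfN p : M (- p) = - M p.
Proof. by rewrite -scaleN1r pfZ mulN1r. Qed.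

Lemma pfB p q : M (p - q) = M p - M q.
Proof. by rewrite pfD pfN. Qed.

Lemma pf_sum (I : Type) (s : seq I) (P : pred I) (F : I -> {poly R}) :
  M (\sum_(i <- s | P i) F i) = \sum_(i <- s | P i) M (F i).
Proof. exact: (big_morph M pfD pf0). Qed.

Lemma pfMC a p : M (a%:P * p) = a * M p.
Proof. by rewrite mul_polyC pfZ. Qed.

Lemma pf_sqr_gt0 p : p != 0 -> 0 < M (p ^+ 2).
Proof.
move=> p0; apply: HM.2; first by rewrite expf_neq0.
by move=> x _; rewrite horner_exp sqr_ge0.
Qed.

Lemma pf1_gt0 : 0 < M 1.
Proof. by rewrite -(expr1n _ 2) pf_sqr_gt0 ?oner_neq0. Qed.

Definition isop k Q : Prop :=
  size Q = k.+1 /\ forall r, (size r <= k)%N -> M (Q * r) = 0.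

Lemma isop_neq0 k Q : isop k Q -> Q != 0.
Proof. by case=> sQ _; rewrite -size_poly_gt0 sQ. Qed.

(** Multiplied by the nodal polynomial of its sign changes, [Q] has constant sign, so [M] does not
    vanish there; fewer than k sign changes would contradict orthogonality. *)
Lemma isop_roots k Q : isop k Q -> exists zs,
  [/\ uniq zs, size zs = k, {in zs, forall z, -1 < z < 1} &
      Q = lead_coef Q *: nodal zs].
Proof.
move=> HQ; have Q0 := isop_neq0 HQ; case: HQ => sQ oQ.
have [|zs [uzs rzs sgn]] := @sign_changes R Q (-1) 1 Q0; first by lra.
have rzs' : {in zs, forall z, root Q z} by move=> z /rzs/andP[].
have QN0 : Q * nodal zs != 0 by rewrite mulf_neq0 ?nodal_neq0.
have MN0 : M (Q * nodal zs) != 0.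
  case: sgn => sgn; first by rewrite gt_eqF// (HM.2 _ QN0).
  rewrite -oppr_eq0 -pfN gt_eqF// HM.2 ?oppr_eq0// => x /sgn.
  by rewrite hornerN oppr_ge0.
have lek : (k <= size zs)%N.
  rewrite leqNgt; apply: contra MN0 => lt; apply/eqP/oQ.
  by rewrite size_nodal.
have gek : (size zs <= k)%N.
  have := max_poly_roots Q0 (introT allP rzs') uzs.
  by rewrite sQ ltnS.
have szs : size zs = k by apply/eqP; rewrite eqn_leq gek.
exists zs; split => //; first by move=> z /rzs/andP[].
by apply: nodal_eq => //; rewrite sQ szs.
Qed.

(* Gauss quadrature: the weight of z is the value of M at the Lagrange
   interpolant l_z, and l_z ^+ 2 - l_z is divisible by Q. *)
Lemma gauss_quadrature k Q zs : isop k Q -> uniq zs -> size zs = k ->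
  Q = lead_coef Q *: nodal zs ->
  exists w : R -> R, {in zs, forall z, 0 < w z} /\
    forall p, (size p <= k + k)%N -> M p = \sum_(z <- zs) w z * p.[z].
Proof.
move=> HQ uzs szs Qzs; have Q0 := isop_neq0 HQ; case: HQ => sQ oQ.
pose N z := nodal (rem z zs); pose l z := (N z).[z]^-1 *: N z.
have Nz z : z \in zs -> (N z).[z] != 0.
  by move=> zin; apply: nodal_eval_neq0; rewrite mem_rem_uniqF.
have lz z : z \in zs -> (l z).[z] = 1.
  by move=> zin; rewrite hornerZ mulVf ?Nz.
have ly z y : z \in zs -> y \in zs -> y != z -> (l z).[y] = 0.
  move=> zin yin yz; rewrite hornerZ [X in _ * X]nodal_eval0 ?mulr0//.
  by rewrite mem_rem_uniq// !inE yz.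
have sl z : z \in zs -> (size (l z) <= k)%N.
  move=> zin; apply: leq_trans (size_scale_leq _ _) _.
  by rewrite size_nodal size_rem// szs prednK// -szs; case: (zs) zin.
have quad p : (size p <= k + k)%N -> M p = \sum_(z <- zs) M (l z) * p.[z].
  (* [d] is the error of Lagrange interpolation; vanishing at all nodes, it is [Q] times a cofactor
     of degree below k, whence [M d = 0]. *)
  move=> sp; pose d := p - \sum_(z <- zs) p.[z] *: l z.
  have rd : {in zs, forall z, root d z}.
    move=> z zin; apply/rootP; rewrite hornerD hornerN horner_sum.
    rewrite (bigD1_seq z)//= hornerZ lz// mulr1 big_seq_cond big1 ?addr0 ?subrr//.
    by move=> y /andP[yin yz]; rewrite hornerZ ly ?mulr0// eq_sym.
  have [q dq] := nodal_dvd uzs rd.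
  have sd : (size d <= k + k)%N.
    apply: leq_trans (size_polyD _ _) _; rewrite geq_max sp size_polyN /=.
    apply: leq_trans (size_sum _ _ _) _; apply/bigmax_leqP_seq => z zin _.
    apply: leq_trans (size_scale_leq _ _) _.
    by apply: leq_trans (sl _ zin) _; rewrite leq_addr.
  have Md : M d = 0.
    have [->|d0] := eqVneq d 0; first by rewrite pf0.
    have q0 : q != 0 by apply: contraNneq d0 => q0; rewrite dq q0 mul0r.
    have sq : (size q <= k)%N.
      move: sd; rewrite dq size_Mmonic ?nodal_monic// size_nodal szs addnS /=.
      by rewrite leq_add2r.
    have := oQ q sq; rewrite Qzs -scalerAl pfZ => /eqP.
    by rewrite mulf_eq0 lead_coef_eq0 (negPf Q0) /= mulrC -dq => /eqP.
  move: Md; rewrite pfB pf_sum => /eqP; rewrite subr_eq0 => /eqP->.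
  by apply: eq_bigr => z _; rewrite pfZ mulrC.
exists (fun z => M (l z)); split => // z zin.
have k0 : (0 < k)%N by rewrite -szs; case: (zs) zin.
have sl2 : (size (l z ^+ 2) <= k + k)%N.
  apply: leq_trans (size_polyMleq _ _) _.
  by have := sl _ zin; lia.
suff -> : M (l z) = M (l z ^+ 2).
  apply: pf_sqr_gt0; apply/eqP => l0; have := lz _ zin.
  by rewrite l0 horner0 => /esym/eqP; rewrite oner_eq0.
rewrite [RHS]quad// (bigD1_seq z)//= horner_exp lz// expr1n mulr1.
rewrite big_seq_cond big1 ?addr0// => y /andP[yin yz].
by rewrite horner_exp ly// expr0n mulr0.
Qed.

End PositiveFunctional.

(** * Gegenbauer polynomials *)

Lemma eq_from_diff (V : zmodType) (a b c d : V) : a = b -> c - d = a - b -> c = d.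
Proof. by move=> -> /eqP; rewrite subrr subr_eq0 => /eqP. Qed.

Section Basis.
Variables (R : fieldType) (Q : nat -> {poly R}).
Hypothesis sQ : forall i, size (Q i) = i.+1.

Lemma graded_basis k (p : {poly R}) : (size p <= k)%N ->
  exists a : nat -> R, p = \sum_(i < k) a i *: Q i.
Proof.
elim: k p => [|k IH] p sp.
  by exists (fun=> 0); rewrite big_ord0; apply/eqP; rewrite -size_poly_eq0 -leqn0.
pose b := p`_k / (Q k)`_k.
have Qk : (Q k)`_k != 0.
  have -> : (Q k)`_k = lead_coef (Q k) by rewrite lead_coefE sQ.
  by rewrite lead_coef_eq0 -size_poly_gt0 sQ.
have [|a pa] := IH (p - b *: Q k).
  apply/leq_sizeP => j; rewrite leq_eqVlt => /predU1P[<-|kj].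
    by rewrite coefB coefZ /b divfK ?subrr.
  by rewrite coefB coefZ !nth_default ?mulr0 ?subrr ?sQ// (leq_trans sp).
exists (fun i => if i == k then b else a i).
rewrite big_ord_recr /= eqxx -[LHS](subrK (b *: Q k)) pa; congr (_ + _).
by apply: eq_bigr => i _; rewrite ltn_eqF.
Qed.

End Basis.

Section Gegenbauer.
Variables (R : rcfType) (m : nat).
Implicit Types (p q r : {poly R}) (i j k l : nat).

(** Two consecutive polynomials are carried to make the recurrence structural. Degree 1 has to be
    seeded: for m = 0 (Chebyshev) the recurrence at k = 0 reads 0 = 0. *)
Fixpoint geg_pair k : {poly R} * {poly R} :=
  if k is k'.+1 then
    let: (p, q) := geg_pair k' in
    (q, (k + m)%:R^-1 *: ((2 * k + m)%:R * 'X * q - k%:R * p))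
  else (1, 'X).

(* The Gegenbauer polynomial of degree k in dimension n = m + 2. *)
Definition geg k : {poly R} := (geg_pair k).1.

Local Notation P := geg.

Lemma geg0 : P 0 = 1. Proof. by []. Qed.
Lemma geg1 : P 1 = 'X. Proof. by []. Qed.

Lemma gegSS k : P k.+2 =
  (k.+1 + m)%:R^-1 *: ((2 * k.+1 + m)%:R * 'X * P k.+1 - k.+1%:R * P k).
Proof. by rewrite /geg /=; case: (geg_pair k). Qed.

Lemma natp_neq0 k : k.+1%:R != 0 :> {poly R}.
Proof. by rewrite -polyC_natr polyC_eq0 pnatr_eq0. Qed.

Lemma geg_rec k : (k + m)%:R * P k.+1 =
  (2 * k + m)%:R * 'X * P k - k%:R * P k.-1.
Proof.
case: k => [|k]; first by rewrite geg0 geg1 mul0r subr0 mulr1.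
rewrite gegSS [X in X%:R * _]addSn -polyC_natr mul_polyC scalerA.
by rewrite divff ?scale1r// pnatr_eq0.
Qed.

Lemma geg_ind (T : nat -> Prop) : T 0%N -> T 1%N ->
  (forall k, T k -> T k.+1 -> T k.+2) -> forall k, T k.
Proof.
move=> T0 T1 TS k; suff : T k /\ T k.+1 by case.
by elim: k => [//|k [? ?]]; split => //; exact: TS.
Qed.

(** Differentiating the recurrence and multiplying by 1 - X^2 leaves only derivatives known from the
    two preceding indices. *)
Lemma geg_der1 k : (1 - 'X ^+ 2) * (P k)^`() = k%:R * (P k.-1 - 'X * P k).
Proof.
elim/geg_ind: k => [||k IH IH1].
- by rewrite geg0 -(polyC1 R) derivC mulr0 mul0r.
- by rewrite geg1 derivX /= geg0; ring.
have der2 : (1 - 'X ^+ 2) * (P k)^`() = (k + m)%:R * ('X * P k - P k.+1).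
  rewrite IH [RHS]mulrBr geg_rec !natrD; ring.
apply: (mulfI (natp_neq0 (k + m))); rewrite -addSn.
have rec := geg_rec k.+1.
have := congr1 (fun p => (1 - 'X ^+ 2) * p^`()) rec.
rewrite -!polyC_natr !poly.derivE mulr1 !polyC_natr.
move: der2 IH1 rec => /=.
set d := (P k)^`(); set d1 := (P k.+1)^`(); set d2 := (P k.+2)^`() => e0 e1 rec e2.
rewrite mulrCA e2.
have -> : (1 - 'X ^+ 2) * ((2 * k.+1 + m)%:R * P k.+1 + (2 * k.+1 + m)%:R * 'X * d1 - k.+1%:R * d) =
  (2 * k.+1 + m)%:R * (1 - 'X ^+ 2) * P k.+1 + (2 * k.+1 + m)%:R * 'X * ((1 - 'X ^+ 2) * d1)
  - k.+1%:R * ((1 - 'X ^+ 2) * d) by ring.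
rewrite e0 e1.
have -> : (k.+1 + m)%:R * (k.+2%:R * (P k.+1 - 'X * P k.+2)) =
  k.+2%:R * ((k.+1 + m)%:R * P k.+1 - 'X * ((k.+1 + m)%:R * P k.+2)) :> {poly R} by ring.
rewrite rec; ring.
Qed.

Lemma geg_der2 k : (1 - 'X ^+ 2) * (P k)^`() = (k + m)%:R * ('X * P k - P k.+1).
Proof. by rewrite geg_der1 [RHS]mulrBr geg_rec !natrD; ring. Qed.

Lemma oneBX2_neq0 : (1 - 'X ^+ 2 : {poly R}) != 0.
Proof.
apply/eqP => /(congr1 (fun p => p.[0])); rewrite !hornerE => /eqP.
by rewrite expr0n subr0 oner_eq0.
Qed.

(** [geg_der1] is differentiated and multiplied once more by 1 - X^2, so that [geg_der1] and
    [geg_der2] eliminate all first derivatives of both indices. *)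
Lemma geg_ode k : (1 - 'X ^+ 2) * (P k)^`()^`() =
  (m.+1)%:R * 'X * (P k)^`() - (k * (k + m))%:R * P k.
Proof.
case: k => [|k].
  by rewrite geg0 -(polyC1 R) derivC -(polyC0 R) derivC !mulr0 mul0r subr0.
have d1 := geg_der1 k.+1; have d2 := geg_der2 k.
have := congr1 deriv d1; rewrite -!polyC_natr !poly.derivE /= !polyC_natr.
move: d1 d2 => /=; set e1 := (P k.+1)^`(); set e0 := (P k)^`(); set e2 := e1^`().
move=> d1 d2 de.
apply: (mulfI oneBX2_neq0).
have -> : (1 - 'X ^+ 2) * ((1 - 'X ^+ 2) * e2) =
   k.+1%:R * ((1 - 'X ^+ 2) * e0 - (1 - 'X ^+ 2) * P k.+1 - 'X * ((1 - 'X ^+ 2) * e1))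
   + 2%:R * 'X * ((1 - 'X ^+ 2) * e1).
  have {}de : (1 - 'X ^+ 2) * e2 = k.+1%:R * (e0 - P k.+1 - 'X * e1) + 2%:R * 'X * e1.
    by move: de; set z := (1 - 'X ^+ 2) * e2 => de; rewrite -[LHS](addKr ((0 - 'X^1 *+ 2) * e1)) de; ring.
  by rewrite de; ring.
have -> : (1 - 'X ^+ 2) * (m.+1%:R * 'X * e1 - (k.+1 * (k.+1 + m))%:R * P k.+1) =
  m.+1%:R * 'X * ((1 - 'X ^+ 2) * e1) - (1 - 'X ^+ 2) * (k.+1 * (k.+1 + m))%:R * P k.+1.
  by ring.
rewrite d1 d2; ring.
Qed.

Lemma geg_size_lead k : size (P k) = k.+1 /\ 0 < lead_coef (P k).
Proof.
elim/geg_ind: k => [||k [s0 l0] [s1 l1]].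
- by rewrite geg0 size_poly1 lead_coef1 ltr01.
- by rewrite geg1 size_polyX lead_coefX ltr01.
have cX : 0 < (2 * k.+1 + m)%:R :> R by rewrite ltr0n; lia.
have sX : size ((2 * k.+1 + m)%:R * 'X * P k.+1 : {poly R}) = k.+3.
  rewrite -polyC_natr -mulrA mul_polyC size_scale ?gt_eqF// mulrC size_mulX ?s1//.
  by rewrite -size_poly_gt0 s1.
have lX : 0 < lead_coef ((2 * k.+1 + m)%:R * 'X * P k.+1 : {poly R}).
  by rewrite -polyC_natr -mulrA mul_polyC lead_coefZ mulr_gt0// lead_coefM lead_coefX mul1r.
have sP : (size (- (k.+1%:R * P k))%R < size ((2 * k.+1 + m)%:R * 'X * P k.+1 : {poly R})%R)%N.
  rewrite sX size_polyN -polyC_natr mul_polyC; apply: leq_ltn_trans (size_scale_leq _ _) _.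
  by rewrite s0.
have ck : (k.+1 + m)%:R^-1 != 0 :> R by rewrite invr_eq0 pnatr_eq0; lia.
rewrite gegSS size_scale// lead_coefZ; split; first by rewrite size_polyDl.
by rewrite mulr_gt0 ?lead_coefDl// invr_gt0 ltr0n; lia.
Qed.

Lemma size_geg k : size (P k) = k.+1. Proof. by case: (geg_size_lead k). Qed.
Lemma lead_geg_gt0 k : 0 < lead_coef (P k). Proof. by case: (geg_size_lead k). Qed.
Lemma geg_neq0 k : P k != 0. Proof. by rewrite -size_poly_gt0 size_geg. Qed.

Lemma geg_rec_eval k x : (k + m)%:R * (P k.+1).[x] =
  (2 * k + m)%:R * x * (P k).[x] - k%:R * (P k.-1).[x].
Proof.
have := congr1 (fun p => p.[x]) (geg_rec k); rewrite /= -!polyC_natr.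
by rewrite hornerCM hornerD hornerN -mulrA !hornerCM hornerM hornerX mulrA.
Qed.

Lemma geg_at1 k : (P k).[1] = 1.
Proof.
elim/geg_ind: k => [||k e0 e1]; rewrite ?geg0 ?geg1 ?hornerE//.
have /= := geg_rec_eval k.+1 1; rewrite e0 e1 => e.
apply: (@mulfI _ (k.+1 + m)%:R); first by rewrite pnatr_eq0.
by rewrite e !natrD natrM; ring.
Qed.

Lemma geg_atN1 k : (P k).[-1] = (-1) ^+ k.
Proof.
elim/geg_ind: k => [||k e0 e1]; rewrite ?geg0 ?geg1 ?hornerE//.
have /= := geg_rec_eval k.+1 (-1); rewrite e0 e1 => e.
apply: (@mulfI _ (k.+1 + m)%:R); first by rewrite pnatr_eq0.
by rewrite e !natrD natrM !exprS; ring.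
Qed.

Lemma geg_no_common_root k x : (P k).[x] = 0 -> (P k.+1).[x] = 0 -> False.
Proof.
elim: k => [|k IH]; first by rewrite geg0 hornerC => /eqP; rewrite oner_eq0.
move=> e1 e2; apply: IH => //; have /= := geg_rec_eval k.+1 x.
rewrite e1 e2 !mulr0 sub0r => /esym/eqP; rewrite oppr_eq0 mulf_eq0 pnatr_eq0 /=.
by move=> /eqP.
Qed.

(* The recurrence of the P_k in self-adjoint form is
   r_k t P_k = c_k P_{k+1} + c_{k-1} P_{k-1}, where r_k is the dimension of the
   space of harmonic polynomials of degree k in n variables. *)
Definition gc k : R := 'C(k + m, m)%:R.
Definition gcp k : R := if k is k'.+1 then gc k' else 0.
Definition gr k : R := gc k + gcp k.

Lemma gc_gt0 k : 0 < gc k.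
Proof. by rewrite ltr0n bin_gt0 leq_addl. Qed.

Lemma gcp_ge0 k : 0 <= gcp k.
Proof. by case: k => //= k; rewrite ltW ?gc_gt0. Qed.

Lemma gr_gt0 k : 0 < gr k.
Proof. by rewrite ltr_wpDr ?gc_gt0 ?gcp_ge0. Qed.

Lemma gc0 : gc 0 = 1. Proof. by rewrite /gc add0n binn. Qed.
Lemma gr0 : gr 0 = 1. Proof. by rewrite /gr /= gc0 addr0. Qed.

Lemma gcS k : k.+1%:R * gc k.+1 = (k.+1 + m)%:R * gc k.
Proof.
rewrite /gc -!natrM; congr _%:R.
have e a : 'C(a + m, m) = 'C(a + m, a) by rewrite -bin_sub ?leq_addl// addnK.
by rewrite !e -mul_bin_diag.
Qed.

Lemma grS k : k.+1%:R * gr k.+1 = (2 * k.+1 + m)%:R * gc k.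
Proof. by rewrite mulrDr gcS /= !natrD natrM; ring. Qed.

Lemma geg_rec3 k :
  (gr k)%:P * 'X * P k = (gc k)%:P * P k.+1 + (gcp k)%:P * P k.-1.
Proof.
case: k => [|k]; first by rewrite gr0 gc0 geg0 geg1 mul0r addr0 mul1r mulr1.
apply: (mulfI (natp_neq0 k)).
have := geg_rec k.+1; rewrite /= => e.
have g1 : k.+1%:R * (gr k.+1)%:P = (2 * k.+1 + m)%:R * (gc k)%:P :> {poly R}.
  by rewrite -!polyC_natr -!polyCM grS.
have g2 : k.+1%:R * (gc k.+1)%:P = (k.+1 + m)%:R * (gc k)%:P :> {poly R}.
  by rewrite -!polyC_natr -!polyCM gcS.
rewrite mulrDr !mulrA g1 g2.
have -> : (k.+1 + m)%:R * (gc k)%:P * P k.+2 = (gc k)%:P * ((k.+1 + m)%:R * P k.+2).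
  by ring.
by rewrite e; ring.
Qed.

(* By Christoffel-Darboux, gA k is the degree k orthogonal polynomial for the
   weight (1 - t) dmu_n; its terms with index of the parity of k give gE k, the
   one for the weight (1 - t^2) dmu_n. *)
Definition gA k : {poly R} := \sum_(i < k.+1) (gr i)%:P * P i.

Lemma gA_CD k : (1 - 'X) * gA k = (gc k)%:P * (P k - P k.+1).
Proof.
elim: k => [|k IH].
  by rewrite /gA big_ord1 gr0 gc0 geg0 geg1 !mul1r mulr1.
rewrite /gA big_ord_recr /= mulrDr IH; have := geg_rec3 k.+1.
rewrite /= => e.
have -> : (1 - 'X) * ((gr k.+1)%:P * P k.+1) =
  (gr k.+1)%:P * P k.+1 - (gr k.+1)%:P * 'X * P k.+1 by ring.
by rewrite e /gr /= polyCD; ring.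
Qed.

(** This closed form is the origin of the first fraction in the Levenshtein function. *)
Lemma gA_at1 k : m.+1%:R * (gA k).[1] = (2 * k + m.+1)%:R * gc k.
Proof.
have e j : (gA j).[1] = \sum_(i < j.+1) gr i.
  rewrite horner_sum; apply: eq_bigr => i _.
  by rewrite hornerCM geg_at1 mulr1.
rewrite e; elim: k => [|k IH]; first by rewrite big_ord1 gr0 gc0 !mulr1.
rewrite big_ord_recr /= mulrDr IH.
apply: (@mulfI _ k.+1%:R); first by rewrite pnatr_eq0.
rewrite mulrDr [X in _ + X]mulrCA grS [RHS]mulrCA gcS !natrD !natrM; ring.
Qed.

Lemma gA_eval k x : (1 - x) * (gA k).[x] = gc k * ((P k).[x] - (P k.+1).[x]).
Proof.
have := congr1 (fun p => p.[x]) (gA_CD k).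
by rewrite /= hornerM hornerCM !hornerE.
Qed.

Fixpoint gE_pair k : {poly R} * {poly R} :=
  if k is k'.+1 then
    let: (p, q) := gE_pair k' in (q, p + (gr k'.+2)%:P * P k'.+2)
  else (1, (gr 1)%:P * P 1).
Definition gE k : {poly R} := (gE_pair k).1.

Lemma gE0 : gE 0 = 1. Proof. by []. Qed.
Lemma gE1 : gE 1 = (gr 1)%:P * P 1. Proof. by []. Qed.
Lemma gESS k : gE k.+2 = gE k + (gr k.+2)%:P * P k.+2.
Proof.
suff : gE_pair k.+1 = ((gE_pair k).2, gE k + (gr k.+2)%:P * P k.+2).
  by rewrite /gE /= => ->.
by rewrite /gE /=; case: (gE_pair k).
Qed.

Lemma size_gr_geg k : size ((gr k)%:P * P k) = k.+1.
Proof. by rewrite mul_polyC size_scale ?size_geg// gt_eqF ?gr_gt0. Qed.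

Lemma size_gE k : size (gE k) = k.+1.
Proof.
elim/geg_ind: k => [||k s0 s1]; rewrite ?gE0 ?size_poly1// ?gE1 ?size_gr_geg//.
by rewrite gESS addrC size_polyDl ?size_gr_geg ?s0.
Qed.

Lemma size_gA k : size (gA k) = k.+1.
Proof.
rewrite /gA big_ord_recr /= addrC size_polyDl ?size_gr_geg// ltnS.
apply: leq_trans (size_sum _ _ _) _; apply/bigmax_leqP => i _.
by rewrite size_gr_geg.
Qed.

(** * Orthogonality, reproducing formulas and Gegenbauer coefficients for a functional satisfying
    integration by parts *)

Section Functional.
Variable L : {poly R} -> R.
Hypothesis HL : posfun L.
Hypothesis L_ibp : forall p, L ((1 - 'X ^+ 2) * p^`()) = m.+1%:R * L ('X * p).

Let LD := pfD HL.
Let LB := pfB HL.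
Let LC := pfMC HL.

Lemma LMn i p : L (i%:R * p) = i%:R * L p.
Proof. by rewrite -polyC_natr LC. Qed.

(** Sturm-Liouville argument: by [geg_ode] the symmetric form L((1 - X^2) P_a' P_b') equals a (a +
    m) L(P_a P_b), and the eigenvalues a (a + m) are distinct. *)
Lemma geg_orth i j : i != j -> L (P i * P j) = 0.
Proof.
have dir a b : L ((1 - 'X ^+ 2) * (P a)^`() * (P b)^`()) =
    (a * (a + m))%:R * L (P a * P b).
  have := L_ibp ((P a)^`() * P b); rewrite derivM -LMn => e.
  have : (1 - 'X^2) * ((P a)^`()^`() * P b + (P a)^`() * (P b)^`()) =
     ((1 - 'X^2) * (P a)^`()^`()) * P b + (1 - 'X^2) * (P a)^`() * (P b)^`() by ring.
  move=> e'; move: e; rewrite e' geg_ode -LMn LD => e.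
  apply: (addrI (L ((m.+1%:R * 'X * (P a)^`() - (a * (a + m))%:R * P a) * P b))).
  by rewrite e -LD; congr L; ring.
move=> ij; have e : (i * (i + m))%:R * L (P i * P j) = (j * (j + m))%:R * L (P i * P j).
  rewrite -dir [P i * P j]mulrC -dir; congr L; ring.
apply/eqP; move/eqP: e; rewrite -subr_eq0 -mulrBl mulf_eq0 => /orP[|//].
rewrite subr_eq0 eqr_nat => /eqP e; case/eqP: ij; nia.
Qed.

Lemma geg_norm_gt0 k : 0 < L (P k * P k).
Proof. by rewrite -expr2 pf_sqr_gt0 ?geg_neq0. Qed.

Lemma geg_isop k : isop L k (P k).
Proof.
split; first exact: size_geg.
move=> r /(graded_basis size_geg)[a ->].
rewrite mulr_sumr (pf_sum HL) big1// => i _.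
by rewrite -scalerAr (pfZ HL) geg_orth ?mulr0// gtn_eqF.
Qed.

Lemma pf_mulC (N : {poly R}) : (forall x, -1 < x < 1 -> 0 <= N.[x]) -> N != 0 ->
  posfun (fun p => L (N * p)).
Proof.
move=> N0 Nn0; split.
  by move=> a p q; rewrite mulrDr -scalerAr HL.1.
move=> p pn0 p0; apply: HL.2; first by rewrite mulf_neq0.
by move=> x xI; rewrite hornerM mulr_ge0 ?N0 ?p0.
Qed.

Lemma gA_orth k r : (size r <= k)%N -> L ((1 - 'X) * (gA k * r)) = 0.
Proof.
move=> sr; rewrite mulrA gA_CD -mulrA LC mulrBl LB.
rewrite (geg_isop k).2// (geg_isop k.+1).2; last exact: leqW.
by rewrite subrr mulr0.
Qed.

(** [gA k] is the reproducing kernel at 1: p - p(1) has the factor X - 1, which orthogonality for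
    the weight 1 - t kills, and L sees only the constant term P_0 of [gA k]. *)
Lemma gA_repr k p : (size p <= k.+1)%N -> L (gA k * p) = L 1 * p.[1].
Proof.
move=> sp; have [q pq] : exists q, p - p.[1]%:P = q * ('X - 1%:P).
  by apply/factor_theorem; rewrite rootE !hornerE subrr.
have sq : (size q <= k)%N.
  have [->|q0] := eqVneq q 0; first by rewrite size_poly0.
  have : (size (p - p.[1]%:P)%R <= k.+1)%N.
    apply: leq_trans (size_polyD _ _) _; rewrite geq_max sp size_polyN.
    by apply: leq_trans (size_polyC_leq1 _) _.
  by rewrite pq size_Mmonic ?monicXsubC// size_XsubC addn2.
have -> : gA k * p = p.[1]%:P * gA k - (1 - 'X) * (gA k * q).
  by rewrite -[p in LHS](subrK p.[1]%:P) pq polyC1; ring.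
rewrite LB gA_orth// subr0 LC mulrC; congr (_ * _).
rewrite /gA big_ord_recl gr0 geg0 mulr1 LD (pf_sum HL) big1 ?addr0//.
move=> i _; rewrite LC -[P _]mulr1 (geg_isop _).2 ?mulr0// size_poly1.
by rewrite lift0.
Qed.

Lemma geg_norm k : gr k * L (P k * P k) = L 1.
Proof.
have := @gA_repr k (P k); rewrite size_geg geg_at1 mulr1 => <-//.
rewrite /gA big_ord_recr /= [X in _ = L X]mulrDl LD -mulrA LC mulr_suml (pf_sum HL).
rewrite big1 ?add0r// => i _; rewrite -mulrA LC geg_orth ?mulr0//.
by rewrite ltn_eqF.
Qed.

(** The part of the kernel at 1 that has the parity of k. The formula reaches one degree beyond that
    of [gE k], because both sides vanish on P_{k+1}, which has the other parity. [gE_orth] uses that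
    degree: (1 - X^2) r may have degree k + 1, and it vanishes at both endpoints. *)
Lemma gE_repr k p : (size p <= k.+2)%N ->
  L (gE k * p) = L 1 * ((p.[1] + (-1) ^+ k * p.[-1]) / 2).
Proof.
move=> /(graded_basis size_geg)[a ->].
rewrite mulr_sumr (pf_sum HL) !horner_sum mulr_sumr -big_split /=.
rewrite mulr_suml mulr_sumr; apply: eq_bigr => i _.
rewrite -scalerAr (pfZ HL) !hornerZ geg_at1 geg_atN1 mulr1.
have -> : L (gE k * P i) = L 1 * ((1 + (-1) ^+ (k + i)) / 2); last first.
  by rewrite exprD; field.
case: i => i /=; elim/geg_ind: k => [||k IH _] lt.
- rewrite gE0 mul1r add0n; case: i lt => [|[|//]] _.
    by rewrite geg0 expr0; field.
  rewrite expr1 -[P 1]mulr1 (geg_isop 1).2 ?size_poly1//; by ring.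
- rewrite gE1 -mulrA LC; case: i lt => [|[|[|//]]] _.
  + by rewrite (geg_isop 1).2 ?size_poly1// expr1; ring.
  + by rewrite geg_norm sqrrN expr1n; field.
  + by rewrite geg_orth// !exprS expr0; ring.
rewrite gESS mulrDl LD -mulrA LC.
have -> : ((-1) ^+ (k.+2 + i) : R) = (-1) ^+ (k + i).
  by rewrite !addSn !exprS; ring.
have [lti|gei] := ltnP i k.+2.
  rewrite IH// geg_orth ?mulr0 ?addr0//; last by rewrite gtn_eqF.
rewrite [gE k * _]mulrC (geg_isop i).2 ?size_gE; last by lia.
move: lt gei; rewrite leq_eqVlt ltnS => /predU1P[[->]|].
  move=> _; rewrite geg_orth ?mulr0; last by rewrite ltn_eqF.
  rewrite !addnS !exprS addnn -signr_odd odd_double expr0; ring.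
move=> le1 le2; have -> : i = k.+2 by apply/eqP; rewrite eqn_leq -ltnS le1.
by rewrite geg_norm !addnS !exprS addnn -signr_odd odd_double expr0; field.
Qed.

Lemma gE_orth k r : (size r <= k)%N -> L ((1 - 'X ^+ 2) * (gE k * r)) = 0.
Proof.
move=> sr; rewrite mulrCA gE_repr.
  by rewrite !hornerM !hornerE /= !expr1n sqrrN expr1n !subrr !mul0r; ring.
apply: leq_trans (size_polyMleq _ _) _.
have -> : (1 - 'X^2 : {poly R}) = - ('X^2 - 1%:P) by rewrite polyC1; ring.
by rewrite size_polyN size_XnsubC//= ; lia.
Qed.

(** * Nonnegativity of L(P_i P_j P_k) *)

Section Linearization.
Variable k : nat.
Let u i j := L (P i * P j * P k).

(** A discrete wave equation: X is absorbed into P_i on one side and into P_j on the other. *)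
Let u_wave i j :
  gr j * (gc i * u i.+1 j + gcp i * u i.-1 j) =
  gr i * (gc j * u i j.+1 + gcp j * u i j.-1).
Proof.
transitivity (gr i * gr j * L ('X * P i * P j * P k)).
  rewrite [gr i * _]mulrC -[RHS]mulrA; congr (_ * _).
  rewrite /u -!LC -LD; congr L.
  have -> : (gr i)%:P * ('X * P i * P j * P k) = ((gr i)%:P * 'X * P i) * P j * P k by ring.
  by rewrite geg_rec3; ring.
rewrite -mulrA; congr (_ * _).
rewrite /u -!LC -LD; congr L.
have -> : (gr j)%:P * ('X * P i * P j * P k) = ((gr j)%:P * 'X * P j) * P i * P k by ring.
by rewrite geg_rec3; ring.
Qed.

(** A weighted sum over the first M entries of the antidiagonal i + j = c; by [coef_ge0] the weights
    are nonnegative as long as j <= c - j. *)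
Let S c M := \sum_(j < M) (gr j * gcp (c - j) - gr (c - j) * gcp j) * u (c - j) j.

(* Summing the relation u_wave over a piece of a diagonal telescopes; this is
   the discrete energy argument of Szwarc. *)
Let diagonal_sum c M : (M <= c)%N ->
  gr (c.+1 - M) * gc M * u (c.+1 - M) M.+1 =
  S c.+2 M.+1 - S c M + gr M * gc (c - M) * u (c - M) M.
Proof.
elim: M => [_|M IH lt].
  rewrite /S big_ord1 big_ord0 !subn0 gr0 gc0 /= !mulr0.
  have /= := u_wave c.+1 0; rewrite gr0 gc0 => w.
  by apply: (eq_from_diff (esym w)); ring.
move/(_ (ltnW lt)) : IH.
have -> : S c.+2 M.+2 = S c.+2 M.+1 + (gr M.+1 * gcp (c.+2 - M.+1) - gr (c.+2 - M.+1) * gcp M.+1) * u (c.+2 - M.+1) M.+1.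
  by rewrite /S big_ord_recr.
have -> : S c M.+1 = S c M + (gr M * gcp (c - M) - gr (c - M) * gcp M) * u (c - M) M.
  by rewrite /S big_ord_recr.
have [e ->] : exists e, c = (M.+1 + e)%N by exists (c - M.+1)%N; lia.
have -> : ((M.+1 + e).+1 - M = e.+2)%N by lia.
have -> : (M.+1 + e - M = e.+1)%N by lia.
have -> : ((M.+1 + e).+1 - M.+1 = e.+1)%N by lia.
have -> : (M.+1 + e - M.+1 = e)%N by lia.
have -> : ((M.+1 + e).+2 - M.+1 = e.+2)%N by lia.
have /= := u_wave e.+1 M.+1.
move=> w1 w2; apply: (eq_from_diff (congr2 +%R (esym w1) w2)).
by rewrite /= [gr e.+1]/gr [gr M]/gr /=; ring.
Qed.

Let gcp_gr i : (2 * i + m)%:R * gcp i = i%:R * gr i.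
Proof. by case: i => [|i]; rewrite /= ?mulr0 ?mul0r// grS. Qed.

Let gc_gr i : (2 * i + m)%:R * gc i = (i + m)%:R * gr i.
Proof.
have e := gcp_gr i.
rewrite [gc i](_ : _ = gr i - gcp i); last by rewrite /gr addrK.
by rewrite mulrBr e; ring.
Qed.

(** For positive indices this says that gcp i / gr i = i / (2i + m) is nondecreasing in i. *)
Let coef_ge0 i j : (j <= i)%N -> 0 <= gr j * gcp i - gr i * gcp j.
Proof.
case: j => [|j] ji; first by rewrite /= mulr0 subr0 mulr_ge0 ?gcp_ge0// ltW ?gr_gt0.
have p0 a : (0 < a)%N -> 0 < (2 * a + m)%:R :> R by rewrite ltr0n; lia.
rewrite -(@pmulr_rge0 _ ((2 * i + m)%:R * (2 * j.+1 + m)%:R)); last by rewrite mulr_gt0 ?p0//; lia.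
have -> : (2 * i + m)%:R * (2 * j.+1 + m)%:R * (gr j.+1 * gcp i - gr i * gcp j.+1) =
   (2 * j.+1 + m)%:R * gr j.+1 * ((2 * i + m)%:R * gcp i)
   - (2 * i + m)%:R * gr i * ((2 * j.+1 + m)%:R * gcp j.+1) by ring.
rewrite !gcp_gr [X in 0 <= X](_ : _ = gr i * gr j.+1 * (m%:R * (i%:R - j.+1%:R))).
  have ij : 0 <= i%:R - j.+1%:R :> R by rewrite subr_ge0 ler_nat.
  by rewrite !mulr_ge0 ?ler0n ?(ltW (gr_gt0 _)).
by ring.
Qed.

(** For positive indices, gc i / gr i = (i + m) / (2i + m) is at least 1/2, while gcp j / gr j = j /
    (2j + m) is at most 1/2. *)
Let coef_ge0' i j : 0 <= gr j * gc i - gr i * gcp j.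
Proof.
case: j => [|j]; first by rewrite /= mulr0 subr0 mulr_ge0// ltW ?gr_gt0 ?gc_gt0.
case: i => [|i].
  by rewrite gr0 gc0 mulr1 mul1r /gr /= addrK ltW ?gc_gt0.
have p0 a : 0 < (2 * a.+1 + m)%:R :> R by rewrite ltr0n; lia.
rewrite -(@pmulr_rge0 _ ((2 * i.+1 + m)%:R * (2 * j.+1 + m)%:R)); last by rewrite mulr_gt0 ?p0.
have -> : (2 * i.+1 + m)%:R * (2 * j.+1 + m)%:R * (gr j.+1 * gc i.+1 - gr i.+1 * gcp j.+1) =
   (2 * j.+1 + m)%:R * gr j.+1 * ((2 * i.+1 + m)%:R * gc i.+1)
   - (2 * i.+1 + m)%:R * gr i.+1 * ((2 * j.+1 + m)%:R * gcp j.+1) by ring.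
rewrite gcp_gr gc_gr [X in 0 <= X](_ : _ = gr i.+1 * gr j.+1 * (m%:R * (i.+1%:R + j.+1%:R + m%:R))).
  by rewrite !mulr_ge0 ?addr_ge0 ?ler0n ?(ltW (gr_gt0 _)).
by ring.
Qed.

(** The second inequality is the one that propagates: [diagonal_sum] carries it from (i, M) to (i +
    1, M + 1), and it contains the sign of u at the new point because [S] is nonnegative. *)
Let lin_ge0_le M : forall i, (M <= i)%N ->
  (forall j, (j <= M)%N -> forall i, (j <= i)%N -> 0 <= u i j) /\
  0 <= gr i * gcp M * u i M - S (i + M) M.
Proof.
elim: M => [|M IH] i Mi.
  split; last by rewrite /= mulr0 mul0r /S big_ord0 subr0.
  move=> j; rewrite leqn0 => /eqP-> {Mi} {}i _; rewrite /u geg0 mulr1.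
  have [->|ik] := eqVneq i k; first by rewrite ltW ?geg_norm_gt0.
  by rewrite geg_orth.
have X0 i' : (M <= i')%N -> 0 <= gr i'.+1 * gcp M.+1 * u i'.+1 M.+1 - S (i'.+1 + M.+1) M.+1.
  move=> Mi'; have [u0 Xp] := IH _ Mi'.
  have := @diagonal_sum (i' + M) M; rewrite leq_addl => /(_ isT).
  have -> : ((i' + M).+1 - M = i'.+1)%N by lia.
  (* [gcp M.+1] is [gc M], so the left side of [diagonal_sum] is exactly the new product; the
     surplus is nonnegative by [coef_ge0']. *)
  rewrite addnK addSn addnS /= => ->; rewrite [X in 0 <= X](_ : _ =
    gr i' * gcp M * u i' M - S (i' + M) M + (gr M * gc i' - gr i' * gcp M) * u i' M); last by ring.
  by rewrite addr_ge0// mulr_ge0 ?u0 ?coef_ge0'.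
have u0 j : (j <= M)%N -> forall i, (j <= i)%N -> 0 <= u i j.
  by case: (IH i (ltnW Mi)) => + _; apply.
split; last by case: i Mi => // i; rewrite ltnS => /X0.
move=> j; rewrite leq_eqVlt ltnS => /predU1P[->|/u0//] [//|i']; rewrite ltnS => Mi'.
rewrite -(@pmulr_rge0 _ (gr i'.+1 * gcp M.+1)) ?mulr_gt0 ?gr_gt0 ?gc_gt0//.
rewrite -[X in 0 <= X](subrK (S (i'.+1 + M.+1) M.+1)) addr_ge0 ?X0//.
apply: sumr_ge0 => j' _; have := ltn_ord j'; rewrite ltnS => j'M.
by rewrite mulr_ge0 ?coef_ge0 ?u0//; lia.
Qed.

Lemma lin_ge0 i j : 0 <= L (P i * P j * P k).
Proof.
have [ji|/ltnW ij] := leqP j i; first by have [/(_ j (leqnn j) i ji)] := lin_ge0_le ji.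
by rewrite [P i * P j]mulrC; have [/(_ i (leqnn i) j ij)] := lin_ge0_le ij.
Qed.

End Linearization.

(** By [geg_norm] this is L(p P_k) / L(P_k^2), without the norm in the denominator. *)
Definition gcf p k : R := gr k * L (p * P k) / L 1.

Let L1 : 0 < L 1. Proof. exact: pf1_gt0. Qed.

Lemma gcfD p q k : gcf (p + q) k = gcf p k + gcf q k.
Proof. by rewrite /gcf [(p + q) * _]mulrDl LD; ring. Qed.

Lemma gcfZ a p k : gcf (a *: p) k = a * gcf p k.
Proof. by rewrite /gcf -[(a *: p) * _]scalerAl (pfZ HL); ring. Qed.

Lemma gcf0 k : gcf 0 k = 0.
Proof. by rewrite -(scale0r 0) gcfZ mul0r. Qed.

Lemma gcf_sum (I : Type) (s : seq I) (T : pred I) (F : I -> {poly R}) k :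
  gcf (\sum_(i <- s | T i) F i) k = \sum_(i <- s | T i) gcf (F i) k.
Proof. exact: (big_morph (gcf^~ k) (fun p q => gcfD p q k) (gcf0 k)). Qed.

Lemma gcf_geg i k : gcf (P i) k = (i == k)%:R.
Proof.
rewrite /gcf; have [->|ik] := eqVneq i k.
  by rewrite geg_norm divff ?gt_eqF.
by rewrite geg_orth// mulr0 mul0r.
Qed.

Lemma gcf_expand p l : (size p <= l)%N -> p = \sum_(i < l) gcf p i *: P i.
Proof.
move=> /(graded_basis size_geg)[a pa]; rewrite {1}pa; apply: eq_bigr => i _.
congr (_ *: _); rewrite pa gcf_sum (bigD1 i)//= gcfZ gcf_geg eqxx mulr1.
rewrite big1 ?addr0// => j ji; rewrite gcfZ gcf_geg.
by move: ji; rewrite -val_eqE /= => /negPf->; rewrite mulr0.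
Qed.

Lemma gcf_high p k : (size p <= k)%N -> gcf p k = 0.
Proof.
by move=> sp; rewrite /gcf mulrC mulrCA [p * _]mulrC (geg_isop k).2 ?mulr0 ?mul0r.
Qed.

Lemma gcf_at0 p : gcf p 0 = L p / L 1.
Proof. by rewrite /gcf gr0 mul1r geg0 mulr1. Qed.

Definition gpos p := forall k, 0 <= gcf p k.

Lemma gposD p q : gpos p -> gpos q -> gpos (p + q).
Proof. by move=> p0 q0 k; rewrite gcfD addr_ge0. Qed.

Lemma gposZ a p : 0 <= a -> gpos p -> gpos (a *: p).
Proof. by move=> a0 p0 k; rewrite gcfZ mulr_ge0. Qed.

Lemma gpos_sum (I : Type) (s : seq I) (T : pred I) (F : I -> {poly R}) :
  (forall x, T x -> gpos (F x)) -> gpos (\sum_(x <- s | T x) F x).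
Proof. by move=> F0 k; rewrite gcf_sum sumr_ge0// => x Tx; exact: F0. Qed.

Lemma gpos_geg i : gpos (P i).
Proof. by move=> k; rewrite gcf_geg ler0n. Qed.

Lemma gcfM p q k : gcf (p * q) k =
  \sum_(i < size p) \sum_(j < size q) gcf p i * gcf q j * gcf (P i * P j) k.
Proof.
rewrite [in LHS](gcf_expand (leqnn (size p))) [in LHS](gcf_expand (leqnn (size q))).
rewrite mulr_suml gcf_sum; apply: eq_bigr => i _.
rewrite mulr_sumr gcf_sum; apply: eq_bigr => j _.
by rewrite -scalerAl -scalerAr !gcfZ mulrA.
Qed.

Lemma gpos_gegM i j : gpos (P i * P j).
Proof.
by move=> k; rewrite /gcf divr_ge0 ?(ltW L1)// mulr_ge0 ?lin_ge0// ltW ?gr_gt0.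
Qed.

Lemma gposM p q : gpos p -> gpos q -> gpos (p * q).
Proof.
move=> p0 q0 k; rewrite gcfM; apply: sumr_ge0 => i _; apply: sumr_ge0 => j _.
exact: mulr_ge0 (mulr_ge0 (p0 _) (q0 _)) (gpos_gegM _ _ _).
Qed.

Lemma gcf_size p k : gcf p k != 0 -> (k < size p)%N.
Proof. by apply: contraNT; rewrite -leqNgt => /gcf_high->. Qed.

(** Compare leading coefficients, all of which are positive. *)
Lemma gcf_gegM_top i j : 0 < gcf (P i * P j) (i + j).
Proof.
have sPP : size (P i * P j) = (i + j).+1.
  by rewrite size_mul ?geg_neq0// !size_geg addSn addnS.
have := @gcf_expand (P i * P j) (i + j).+1; rewrite sPP leqnn big_ord_recr /= => /(_ isT) e.
have := congr1 (fun p : {poly R} => p`_(i + j)) e.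
rewrite /= coefD coefZ [X in _ = X + _](_ : _ = 0); last first.
  apply: nth_default; apply: leq_trans (size_sum _ _ _) _; apply/bigmax_leqP => l _.
  by apply: leq_trans (size_scale_leq _ _) _; rewrite size_geg.
have lead q : (size q = (i + j).+1)%N -> q`_(i + j) = lead_coef q.
  by rewrite lead_coefE => ->.
rewrite add0r !lead ?size_geg// lead_coefM => e'.
by rewrite -(@pmulr_lgt0 _ (lead_coef (P (i + j)))) ?lead_geg_gt0// -e' mulr_gt0 ?lead_geg_gt0.
Qed.

(** All summands of [gcfM] are nonnegative, so a single positive one suffices; i and j exhibit
    it. *)
Lemma gcfM_gt0 p q i j k : gpos p -> gpos q -> 0 < gcf p i -> 0 < gcf q j ->
  0 < gcf (P i * P j) k -> 0 < gcf (p * q) k.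
Proof.
move=> p0 q0 pi qj ijk.
have si : (i < size p)%N by rewrite gcf_size ?gt_eqF.
have sj : (j < size q)%N by rewrite gcf_size ?gt_eqF.
have t0 a b : 0 <= gcf p a * gcf q b * gcf (P a * P b) k.
  exact: mulr_ge0 (mulr_ge0 (p0 _) (q0 _)) (gpos_gegM _ _ _).
rewrite gcfM (bigD1 (Ordinal si))//= ltr_pwDl//; last first.
  by apply: sumr_ge0 => a _; apply: sumr_ge0 => b _.
rewrite (bigD1 (Ordinal sj))//= ltr_pwDl//.
  exact: mulr_gt0 (mulr_gt0 pi qj) ijk.
by apply: sumr_ge0 => b _.
Qed.

End Functional.
End Gegenbauer.

(** * Positive definiteness of Gegenbauer polynomials *)

Section Schoenberg.
Import -(notations) mpoly.
Variables (R : rcfType) (m : nat).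
Let n := m.+2.
Local Notation MP := (mpoly n R).
Implicit Types (p q : MP) (x y : 'I_n -> R) (i j : 'I_n) (k : nat).

Let Y i : MP := mpolyX R (mnm1 i).

Let D_Y i j : mderiv i (Y j) = (i == j)%:R.
Proof.
rewrite /Y mderivX mnm1E eq_sym; case: eqVneq => [->|_]; last by rewrite scale0r.
by rewrite scale1r -{1}[mnm1 j]add0m addmK mpolyX0.
Qed.

Let D_1 i : mderiv i (1 : MP) = 0.
Proof. by rewrite -mpolyC1 mderivC. Qed.

Let lin x : MP := \sum_i x i *: Y i.
Let dir x p : MP := \sum_i x i *: mderiv i p.
Let normsq : MP := \sum_i Y i ^+ 2.
Let lap p : MP := \sum_i mderiv i (mderiv i p).
Let eul p : MP := \sum_i Y i * mderiv i p.
Let ev0 p : R := meval (fun=> 0) p.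
Let dotp x y : R := \sum_i x i * y i.

Let dirD x : {morph dir x : p q / p + q}.
Proof. by move=> p q; rewrite /dir -big_split; apply: eq_bigr => i _; rewrite mderivD scalerDr. Qed.

Let dirZ x a p : dir x (a *: p) = a *: dir x p.
Proof.
rewrite /dir scaler_sumr; apply: eq_bigr => i _.
by rewrite mderivZ !scalerA mulrC.
Qed.

Let dirM x p q : dir x (p * q) = dir x p * q + p * dir x q.
Proof.
rewrite /dir mulr_suml mulr_sumr -big_split; apply: eq_bigr => i _ /=.
by rewrite mderivM scalerDr -scalerAl -scalerAr.
Qed.

Let dirB x p q : dir x (p - q) = dir x p - dir x q.
Proof. by rewrite -scaleN1r dirD dirZ scaleN1r. Qed.

Let D_lin i x : mderiv i (lin x) = (x i)%:A.
Proof.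
rewrite /lin raddf_sum (bigD1 i)//= mderivZ D_Y eqxx big1 ?addr0// => j ji.
by rewrite mderivZ D_Y eq_sym (negPf ji) scaler0.
Qed.

Let D_normsq i : mderiv i normsq = 2%:R *: Y i.
Proof.
rewrite /normsq raddf_sum (bigD1 i)//= expr2 mderivM D_Y eqxx mul1r mulr1.
rewrite big1 ?addr0 ?scaler_nat// => j ji.
by rewrite expr2 mderivM D_Y eq_sym (negPf ji) mul0r mulr0 addr0.
Qed.

Let dir_lin x y : dir x (lin y) = (dotp x y)%:A.
Proof.
rewrite /dir /dotp scaler_suml; apply: eq_bigr => i _.
by rewrite D_lin scalerA.
Qed.

Let dir_normsq x : dir x normsq = 2%:R *: lin x.
Proof.
rewrite /dir scaler_sumr; apply: eq_bigr => i _.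
by rewrite D_normsq !scalerA mulrC.
Qed.

Let eulD : {morph eul : p q / p + q}.
Proof. by move=> p q; rewrite /eul -big_split; apply: eq_bigr => i _; rewrite mderivD mulrDr. Qed.

Let eulZ a p : eul (a *: p) = a *: eul p.
Proof. by rewrite /eul scaler_sumr; apply: eq_bigr => i _; rewrite mderivZ scalerAr. Qed.

Let eulB p q : eul (p - q) = eul p - eul q.
Proof. by rewrite -scaleN1r eulD eulZ scaleN1r. Qed.

Let eulM p q : eul (p * q) = eul p * q + p * eul q.
Proof.
rewrite /eul mulr_suml mulr_sumr -big_split; apply: eq_bigr => i _ /=.
by rewrite mderivM; ring.
Qed.

Let eul_lin x : eul (lin x) = lin x.
Proof. by apply: eq_bigr => i _; rewrite D_lin -scalerAr mulr1. Qed.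

Let eul_normsq : eul normsq = 2%:R *: normsq.
Proof.
rewrite /eul scaler_sumr; apply: eq_bigr => i _.
by rewrite D_normsq -scalerAr.
Qed.

Let lapD : {morph lap : p q / p + q}.
Proof. by move=> p q; rewrite /lap -big_split; apply: eq_bigr => i _; rewrite !mderivD. Qed.

Let lapZ a p : lap (a *: p) = a *: lap p.
Proof. by rewrite /lap scaler_sumr; apply: eq_bigr => i _; rewrite !mderivZ. Qed.

Let lapB p q : lap (p - q) = lap p - lap q.
Proof. by rewrite -scaleN1r lapD lapZ scaleN1r. Qed.

Let lap_linM x p : lap (lin x * p) = lin x * lap p + 2%:R *: dir x p.
Proof.
rewrite /lap /dir mulr_sumr scaler_sumr -big_split; apply: eq_bigr => i _ /=.
rewrite mderivM D_lin mderivD mderivM D_lin -scalerAl mul1r mderivZ.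
by rewrite -!scalerAl mul1r scaler_nat mulr2n; ring.
Qed.

Let lap_normsqM p :
  lap (normsq * p) = normsq * lap p + 4%:R *: eul p + (2 * n)%:R *: p.
Proof.
have -> : (2 * n)%:R *: p = \sum_(i < n) 2%:R *: p.
  by rewrite sumr_const card_ord natrM -scalerA !scaler_nat -mulrnA mulnC mulrnA.
rewrite /lap /eul mulr_sumr scaler_sumr -!big_split; apply: eq_bigr => i _ /=.
rewrite mderivM D_normsq mderivD mderivM D_normsq -scalerAl mderivZ mderivM D_Y eqxx.
by rewrite mul1r -!scalerAl !scaler_nat; ring.
Qed.

Section Zonal.
Variable x : 'I_n -> R.

(** The recurrence of [geg] made homogeneous: as a function of y this is |y|^k P_k(x.y/|y|). *)
Fixpoint zonal_pair k : MP * MP :=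
  if k is k'.+1 then
    let: (p, q) := zonal_pair k' in
    (q, (k + m)%:R^-1 *: ((2 * k + m)%:R *: (lin x * q) - k%:R *: (normsq * p)))
  else (1, lin x).
Definition zonal k : MP := (zonal_pair k).1.

Lemma zonalSS k : zonal k.+2 = (k.+1 + m)%:R^-1 *:
  ((2 * k.+1 + m)%:R *: (lin x * zonal k.+1) - k.+1%:R *: (normsq * zonal k)).
Proof. by rewrite /zonal /=; case: (zonal_pair k). Qed.

Lemma zonal_rec k : (k + m)%:R *: zonal k.+1 =
  (2 * k + m)%:R *: (lin x * zonal k) - k%:R *: (normsq * zonal k.-1).
Proof.
case: k => [|k]; first by rewrite scale0r subr0 mulr1.
by rewrite zonalSS scalerA divff ?scale1r// pnatr_eq0.
Qed.

Lemma zonal_eul k : eul (zonal k) = k%:R *: zonal k.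
Proof.
have s0 a : (a.+1 + m)%:R != 0 :> R by rewrite pnatr_eq0.
elim/geg_ind: k => [||k IH0 IH1].
- by rewrite scale0r /eul big1// => i _; rewrite D_1 mulr0.
- by rewrite eul_lin scale1r.
apply: (scalerI (s0 k)); rewrite -eulZ scalerA mulrC -scalerA zonal_rec /=.
rewrite eulB !eulZ !eulM eul_lin eul_normsq IH0 IH1.
by rewrite -!mul_mpolyC ?rmorphM !rmorph_nat; ring.
Qed.

Hypothesis x1 : dotp x x = 1.

Lemma zonal_dir k : dir x (zonal k) = k%:R *: zonal k.-1.
Proof.
have s0 a : (a.+1 + m)%:R != 0 :> R by rewrite pnatr_eq0.
elim/geg_ind: k => [||k IH0 IH1].
- by rewrite scale0r /dir big1// => i _; rewrite D_1 scaler0.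
- by rewrite dir_lin x1.
apply: (scalerI (s0 k)); rewrite -dirZ scalerA mulrC -scalerA /=.
have e := zonal_rec k.+1; rewrite /= in e; rewrite e.
rewrite dirB !dirZ !dirM dir_lin dir_normsq x1 scale1r mul1r IH0 IH1 /=.
have e0 := zonal_rec k.
apply: (eq_from_diff (congr1 (fun p => k.+1%:R *: p) (esym e0))).
by rewrite -!mul_mpolyC ?rmorphM !rmorph_nat; ring.
Qed.

(** Applied to the recurrence, the Laplacian produces a derivative along x from [lin x] and an Euler
    term from [normsq]; [zonal_dir] and [zonal_eul] evaluate them and everything cancels. *)
Lemma zonal_lap k : lap (zonal k) = 0.
Proof.
have s0 a : (a.+1 + m)%:R != 0 :> R by rewrite pnatr_eq0.
elim/geg_ind: k => [||k IH0 IH1].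
- by rewrite /lap big1// => i _; rewrite D_1 mderiv0.
- rewrite /lap big1// => i _.
  by rewrite D_lin mderivZ D_1 scaler0.
apply: (scalerI (s0 k)); rewrite -lapZ zonal_rec scaler0.
rewrite lapB !lapZ lap_linM lap_normsqM IH0 IH1 zonal_dir zonal_eul /=.
by rewrite -!mul_mpolyC ?rmorphM !rmorph_nat /n; ring.
Qed.

End Zonal.

(** Multiples of [normsq] pair to 0 with harmonic forms, so only the power of [lin x] will count.
    [W] is 0 in degrees below 2, where [ip_normsq] does not apply. *)
Lemma zonal_lead k : exists2 a, 0 < a & forall x, exists W : MP,
  ((k < 2)%N -> W = 0) /\ zonal x k = a *: lin x ^+ k + normsq * W.
Proof.
elim/geg_ind: k => [||k [a0 a00 _] [a1 a10 H1]].
- by exists 1 => // x; exists 0; rewrite expr0 scale1r mulr0 addr0.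
- by exists 1 => // x; exists 0; rewrite expr1 scale1r mulr0 addr0.
exists ((k.+1 + m)%:R^-1 * (2 * k.+1 + m)%:R * a1).
  by rewrite !mulr_gt0// ?invr_gt0 ltr0n; lia.
move=> x; have [W1 [_ e1]] := H1 x.
exists ((k.+1 + m)%:R^-1 *: ((2 * k.+1 + m)%:R *: (lin x * W1) - k.+1%:R *: zonal x k)).
split => //.
by rewrite zonalSS e1 !exprS -!mul_mpolyC !mpolyCM; ring.
Qed.

(* The Fischer inner product <p, q> = (p(D) q)(0) on forms of degree k. *)
Fixpoint ip k p q : R :=
  if k is k'.+1 then \sum_i ip k' (mderiv i p) (mderiv i q) else ev0 p * ev0 q.

Let ipDl k p p' q : ip k (p + p') q = ip k p q + ip k p' q.
Proof.
elim: k p p' q => [|k IH] p p' q /=; first by rewrite /ev0 rmorphD mulrDl.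
by rewrite -big_split; apply: eq_bigr => i _; rewrite mderivD IH.
Qed.

Let ipZl k a p q : ip k (a *: p) q = a * ip k p q.
Proof.
elim: k p q => [|k IH] p q /=; first by rewrite /ev0 mevalZ mulrA.
by rewrite mulr_sumr; apply: eq_bigr => i _; rewrite mderivZ IH.
Qed.

Let ipC k p q : ip k p q = ip k q p.
Proof.
elim: k p q => [|k IH] p q /=; first by rewrite mulrC.
by apply: eq_bigr => i _.
Qed.

Let ip0l k q : ip k 0 q = 0.
Proof. by rewrite -(scale0r 0) ipZl mul0r. Qed.

Let ip_suml k (I : finType) (F : I -> MP) q :
  ip k (\sum_i F i) q = \sum_i ip k (F i) q.
Proof. exact: (big_morph (fun p => ip k p q) (fun p p' => ipDl k p p' q) (ip0l k q)). Qed.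

Let ip_ge0 k p : 0 <= ip k p p.
Proof.
elim: k p => [|k IH] p /=; first by rewrite -expr2 sqr_ge0.
by apply: sumr_ge0.
Qed.

(** Multiplication by a variable is adjoint to its derivative. The factor k + 1 appears because
    [ip k] sums over ordered k-tuples of derivatives and so carries a factor k! over the Fischer
    product. *)
Let ip_Y k j p q : ip k.+1 (Y j * p) q = k.+1%:R * ip k p (mderiv j q).
Proof.
elim: k p q => [|k IH] p q.
  rewrite mul1r /= (bigD1 j)//= big1 ?addr0 => [|i ij]; rewrite mderivM D_Y.
    by rewrite eqxx mul1r /ev0 rmorphD rmorphM /Y /= mevalXU mul0r addr0.
  by rewrite (negPf ij) mul0r add0r /ev0 rmorphM /Y /= mevalXU !mul0r.
have -> : ip k.+2 (Y j * p) q =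
    ip k.+1 p (mderiv j q) + \sum_i k.+1%:R * ip k (mderiv i p) (mderiv i (mderiv j q)).
  rewrite [LHS]/= (bigD1 j)//= [X in _ = X + _](_ : _ = ip k.+1 p (mderiv j q))//.
  rewrite -/(ip k.+1 _ _) [X in _ = _ + X](bigD1 j)//= addrA.
  rewrite mderivM D_Y eqxx mul1r -[X in X + _ = _]/(ip k.+1 _ _) ipDl IH; congr (_ + _ + _) => //.
  apply: eq_bigr => i ij; rewrite mderivM D_Y (negPf ij) mul0r add0r.
  by rewrite -[LHS]/(ip k.+1 _ _) IH mderiv_comm.
rewrite -mulr_sumr -[\sum_i _]/(ip k.+1 p (mderiv j q)).
by rewrite -[in RHS]natr1 mulrDl mul1r addrC.
Qed.

Let ip_lin k x p q : ip k.+1 (lin x * p) q = k.+1%:R * ip k p (dir x q).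
Proof.
rewrite /lin mulr_suml ip_suml [ip k p _]ipC /dir ip_suml mulr_sumr.
apply: eq_bigr => i _.
by rewrite -scalerAl !ipZl ip_Y [ip k p _]ipC mulrCA.
Qed.

Let ip_normsq k p q : ip k.+2 (normsq * p) q = (k.+2 * k.+1)%:R * ip k p (lap q).
Proof.
rewrite /normsq mulr_suml ip_suml [ip k p _]ipC /lap ip_suml mulr_sumr.
apply: eq_bigr => i _; rewrite expr2 -mulrA !ip_Y natrM mulrA; congr (_ * _).
exact: ipC.
Qed.

Let ip_linX k x q : ip k (lin x ^+ k) q = k`!%:R * ev0 (iter k (dir x) q).
Proof.
elim: k q => [|k IH] q; first by rewrite /= /ev0 rmorph1.
by rewrite exprS ip_lin IH factS natrM mulrA -iterSr.
Qed.

(* phi x p is the restriction of p to the line spanned by x. *)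
Let phi x : MP -> {poly R} := mmap (@polyC R) (fun i => x i *: 'X).

Let phiD x p q : phi x (p + q) = phi x p + phi x q.
Proof. exact: raddfD. Qed.

Let phiM x p q : phi x (p * q) = phi x p * phi x q.
Proof. exact: rmorphM. Qed.

Let phi1 x : phi x 1 = 1.
Proof. exact: rmorph1. Qed.

Let phiZ x c p : phi x (c *: p) = c *: phi x p.
Proof. by rewrite /phi mmapZ mul_polyC. Qed.

Let phiY x i : phi x (Y i) = x i *: 'X.
Proof. by rewrite /phi mmapX mmap1U. Qed.

Let phi_sum x (F : 'I_n -> MP) : phi x (\sum_i F i) = \sum_i phi x (F i).
Proof. exact: raddf_sum. Qed.

Let phi_lin x y : phi x (lin y) = dotp y x *: 'X.
Proof.
rewrite phi_sum scaler_suml; apply: eq_bigr => i _.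
by rewrite phiZ phiY scalerA.
Qed.

Let phi_normsq x : phi x normsq = dotp x x *: 'X^2.
Proof.
rewrite phi_sum scaler_suml; apply: eq_bigr => i _.
by rewrite expr2 phiM phiY -scalerAl -scalerAr scalerA.
Qed.

Let ev0M p q : ev0 (p * q) = ev0 p * ev0 q.
Proof. exact: rmorphM. Qed.

Let ev01 : ev0 1 = 1.
Proof. exact: rmorph1. Qed.

(** The chain rule along the line through x; the property passes to sums, multiples and products,
    hence only variables have to be checked. *)
Let phi_good x p : (phi x p)^`() = phi x (dir x p) /\ (phi x p).[0] = ev0 p.
Proof.
pose good p := (phi x p)^`() = phi x (dir x p) /\ (phi x p).[0] = ev0 p.
have goodM p' q : good p' -> good q -> good (p' * q).
  move=> [d1 e1] [d2 e2]; split.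
    by rewrite dirM phiD !phiM derivM d1 d2.
  by rewrite phiM hornerM e1 e2 ev0M.
have goodD p' q : good p' -> good q -> good (p' + q).
  move=> [d1 e1] [d2 e2]; split.
    by rewrite dirD !phiD derivD d1 d2.
  by rewrite phiD hornerD e1 e2 /ev0 rmorphD.
have dir1 : dir x 1 = 0.
  by rewrite /dir big1// => i _; rewrite D_1 scaler0.
have phi0 : phi x 0 = 0 by rewrite -(scale0r 0) phiZ scale0r.
have good1 : good 1.
  by split; rewrite phi1 ?dir1 ?phi0 -?polyC1 ?derivC// hornerC ev01.
have goodZ c p' : good p' -> good (c *: p').
  move=> [d e]; split; first by rewrite dirZ !phiZ derivZ d.
  by rewrite phiZ hornerZ e /ev0 mevalZ.
have goodY i : good (Y i).
  split; rewrite phiY; last by rewrite hornerZ hornerX mulr0 /ev0 mevalXU.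
  rewrite derivZ derivX /dir (bigD1 i)//= D_Y eqxx big1 ?addr0 => [|j ji].
    by rewrite phiZ phi1.
  by rewrite D_Y (negPf ji) scaler0.
rewrite -/(good p); elim/mpolyind: p => [|c mm p _ _ IH].
  by rewrite -(scale0r 1); apply: goodZ.
apply: goodD => //; apply: goodZ.
rewrite mpolyXE_id; apply: (big_ind good good1 goodM) => i _.
elim: (mm i) => [|a IHa]; first by rewrite expr0.
by rewrite exprS; apply: goodM => //; exact: goodY.
Qed.

Let ev0_dir x k p : ev0 (iter k (dir x) p) = k`!%:R * (phi x p)`_k.
Proof.
have e : phi x (iter k (dir x) p) = (phi x p)^`(k).
  by elim: k => //= k IH; rewrite -(proj1 (phi_good x _)) IH.
by rewrite -(proj2 (phi_good x _)) e horner_coef0 coef_derivn addn0 ffactnn mulr_natl.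
Qed.

Let phi_zonal x y k : dotp y y = 1 -> phi y (zonal x k) = (geg R m k).[dotp x y] *: 'X^k.
Proof.
move=> y1; elim/geg_ind: k => [||k IH0 IH1].
- by rewrite phi1 geg0 hornerC expr0 scale1r.
- by rewrite phi_lin geg1 hornerX expr1.
have e : phi y (zonal x k.+2) = (k.+1 + m)%:R^-1 *:
    ((2 * k.+1 + m)%:R *: (phi y (lin x) * phi y (zonal x k.+1))
      - k.+1%:R *: (phi y normsq * phi y (zonal x k))).
  by rewrite zonalSS phiZ -scaleN1r phiD !phiZ !phiM scaleN1r.
rewrite e IH0 IH1 phi_lin phi_normsq y1.
rewrite -!scalerAl -!scalerAr -exprS -exprD !scalerA -scalerBl scalerA gegSS.
rewrite hornerZ hornerD hornerN -!polyC_natr -[_%:P * 'X * _]mulrA !hornerCM hornerM hornerX.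
by congr (_ *: _); ring.
Qed.

(** The matrix is, up to the factor d > 0, the Gram matrix of the zonal polynomials for [ip k]. *)
Theorem schoenberg k (I : finType) (c : I -> R) (x : I -> 'I_n -> R) :
  (forall a, \sum_i x a i * x a i = 1) ->
  0 <= \sum_a \sum_b c a * c b * (geg R m k).[\sum_i x a i * x b i].
Proof.
move=> x1; have [a a0 aE] := zonal_lead k.
(* [a] is the coefficient from [zonal_lead], one factorial comes from [ip_linX], the other from the
   Taylor coefficient in [ev0_dir]. *)
pose d := a * k`!%:R * k`!%:R.
have d0 : 0 < d by rewrite !mulr_gt0 ?ltr0n ?fact_gt0.
have ipE e b : ip k (zonal (x e) k) (zonal (x b) k) = d * (geg R m k).[dotp (x e) (x b)].
  have [W [W0 ->]] := aE (x e).
  rewrite ipDl ipZl ip_linX ev0_dir phi_zonal; last exact: x1.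
  have -> : ip k (normsq * W) (zonal (x b) k) = 0.
    case: (k) W0 => [|[|k']] W0; try by rewrite W0// mulr0 ip0l.
    by rewrite ip_normsq zonal_lap; [rewrite ipC ip0l mulr0|exact: x1].
  rewrite coefZ coefXn eqxx mulr1 addr0 /d !mulrA; congr (_ * (geg R m k).[_]).
  by apply: eq_bigr => i _; rewrite mulrC.
rewrite -(@pmulr_rge0 _ d)//.
have -> : d * (\sum_e \sum_b c e * c b * (geg R m k).[\sum_i x e i * x b i]) =
   ip k (\sum_e c e *: zonal (x e) k) (\sum_b c b *: zonal (x b) k).
  rewrite ip_suml mulr_sumr; apply: eq_bigr => e _.
  rewrite ipC ip_suml mulr_sumr; apply: eq_bigr => b _.
  by rewrite ipZl ipC ipZl ipE /dotp; ring.
exact: ip_ge0.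
Qed.
End Schoenberg.

(** * The Levenshtein kernel *)

Section OrthogonalFamily.
Variable R : rcfType.
Implicit Types (p q r K : {poly R}) (s x z : R) (k l : nat).

Lemma noroot_gt0 p x y : x <= y -> {in `[x, y], forall z, ~~ root p z} ->
  0 < p.[y] -> 0 < p.[x].
Proof.
move=> xy nr py; rewrite ltNge; apply/negP => px.
have [|z zI rz] := @polyrcf.poly_ivt _ p x y xy; first by rewrite mulr_le0_ge0// ltW.
by move: (nr z zI); rewrite rz.
Qed.

Lemma root_count p zs : p != 0 -> uniq zs -> {in zs, forall z, root p z} ->
  (size zs < size p)%N.
Proof. by move=> p0 uzs rzs; apply: max_poly_roots => //; exact/allP. Qed.

Section OnePoly.
Variables (M : {poly R} -> R) (HM : posfun M).
Variables (k : nat) (Q : {poly R}) (HQ : isop M k Q).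

(** Degree at most 2k - 1 makes the quadrature exact, so only the signs at the roots of [Q] matter;
    as the weights are positive, the value 0 forces vanishing at every node. *)
Lemma gauss_ge0 p : (size p <= k + k)%N ->
  (forall z, -1 < z < 1 -> root Q z -> 0 <= p.[z]) ->
  0 <= M p /\ (M p = 0 -> forall z, root Q z -> p.[z] = 0).
Proof.
move=> sp p0; have [zs [uzs szs zI Qzs]] := isop_roots HM HQ.
have [w [w0 quad]] := gauss_quadrature HM HQ uzs szs Qzs.
have rQ z : root Q z = (z \in zs).
  by rewrite Qzs rootZ ?root_nodal// lead_coef_eq0 (isop_neq0 HQ).
have t0 z : z \in zs -> 0 <= w z * p.[z].
  move=> zin; apply: mulr_ge0; first exact/ltW/w0.
  by apply: p0; rewrite ?rQ//; exact: zI.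
rewrite (quad _ sp); split; first by rewrite big_seq sumr_ge0.
rewrite big_seq => /eqP; rewrite psumr_eq0// => /allP e z; rewrite rQ => zin.
have := e z zin; rewrite zin /= mulf_eq0 => /orP[|/eqP//].
by rewrite gt_eqF ?w0.
Qed.

Lemma isop_root_itv z : root Q z -> -1 < z < 1.
Proof.
have [zs [uzs szs zI Qzs]] := isop_roots HM HQ.
rewrite Qzs rootZ ?root_nodal ?lead_coef_eq0 ?(isop_neq0 HQ)//; exact: zI.
Qed.

Lemma isop_uniq_roots : exists zs, [/\ uniq zs, size zs = k & {in zs, forall z, root Q z}].
Proof.
have [zs [uzs szs zI Qzs]] := isop_roots HM HQ.
exists zs; split => // z zin.
by rewrite Qzs rootZ ?root_nodal ?lead_coef_eq0 ?(isop_neq0 HQ).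
Qed.

Lemma isop_lead_gt0 : 0 < Q.[1] -> 0 < lead_coef Q.
Proof.
have [zs [uzs szs zI Qzs]] := isop_roots HM HQ.
by rewrite {1}Qzs hornerZ pmulr_lgt0// nodal_gt0// => z /zI/andP[].
Qed.

End OnePoly.

Variables (M : {poly R} -> R) (HM : posfun M).
Variables (Q : nat -> {poly R}) (HQ : forall k, isop M k (Q k)).
Hypothesis Q1 : forall k, 0 < (Q k).[1].

Let sQ k : size (Q k) = k.+1. Proof. by case: (HQ k). Qed.
Let h k := M (Q k * Q k).
Let h0 k : 0 < h k.
Proof. by rewrite /h -expr2 pf_sqr_gt0// (isop_neq0 (HQ k)). Qed.

Lemma isop_orth i j : i != j -> M (Q i * Q j) = 0.
Proof.
case: (ltngtP i j) => // ij _; last by rewrite (HQ i).2// sQ.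
by rewrite mulrC (HQ j).2// sQ.
Qed.

Lemma isop_expand p k : (size p <= k)%N ->
  p = \sum_(i < k) (M (p * Q i) / h i) *: Q i.
Proof.
move=> /(graded_basis sQ)[a pa]; rewrite {1}pa; apply: eq_bigr => i _.
congr (_ *: _); rewrite pa mulr_suml (pf_sum HM) (bigD1 i)//= -scalerAl (pfZ HM).
rewrite [X in _ + X]big1 ?addr0; first by rewrite mulfK// gt_eqF// h0.
by move=> j ji; rewrite -scalerAl (pfZ HM) isop_orth ?mulr0.
Qed.

Variables (s : R) (l : nat).
Hypothesis l0 : (0 < l)%N.
Hypothesis s1 : s < 1.
Hypothesis noroot : forall i x, (i < l)%N -> s <= x -> ~~ root (Q i) x.
Variable t : R.
Hypothesis root_t : root (Q l) t.
Hypothesis st : s <= t.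

Lemma Q_gt0 i x : (i < l)%N -> s <= x -> 0 < (Q i).[x].
Proof.
move=> il sx; have [x1|/ltW x1] := leP x 1.
  apply: (noroot_gt0 x1) => // z; rewrite in_itv => /andP[xz _].
  by apply: noroot => //; exact: le_trans xz.
have := noroot il sx; rewrite rootE; case: ltgtP => // neg _.
have [z zI rz] := @polyrcf.poly_ivt _ (Q i) 1 x x1 (mulr_ge0_le0 (ltW (Q1 i)) (ltW neg)).
have /(noroot il) : s <= z; last by rewrite rz.
by move: zI; rewrite in_itv /= => /andP[z1 _]; rewrite (le_trans (ltW s1) z1).
Qed.

(* For a root t of Q_l, the quotient Q_l / (X - t) is a multiple of the
   reproducing kernel at t, so it has no zero beyond s. *)
Lemma Ql_le0 : (Q l).[s] <= 0.
Proof.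
have [p Qp] := factor_theorem _ _ root_t.
have p0 : p != 0 by apply: contraTneq isT => p0; have := sQ l; rewrite Qp p0 mul0r size_poly0.
have sp : size p = l.
  by have := sQ l; rewrite Qp size_Mmonic ?monicXsubC// size_XsubC addn2 => -[].
have t1 : t < 1 by have /andP[] := isop_root_itv HM (HQ l) root_t.
have Mp r : (size r <= l)%N -> M (p * r) = r.[t] * M p.
  move=> sr; have [q rq] : exists q, r - r.[t]%:P = q * ('X - t%:P).
    by apply/factor_theorem; rewrite rootE !hornerE subrr.
  have -> : p * r = Q l * q + r.[t]%:P * p.
    by rewrite -[r in LHS](subrK r.[t]%:P) rq Qp; ring.
  rewrite (pfD HM) (pfMC HM) (HQ l).2 ?add0r//.
  have [->|q0] := eqVneq q 0; first by rewrite size_poly0.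
  have : (size (r - r.[t]%:P)%R <= l)%N.
    apply: leq_trans (size_polyD _ _) _; rewrite geq_max sr size_polyN.
    by apply: leq_trans (size_polyC_leq1 _) _.
  by rewrite rq size_Mmonic ?monicXsubC// size_XsubC addn2 /= => /ltnW.
have pexp : p = M p *: \sum_(i < l) ((Q i).[t] / h i) *: Q i.
  rewrite [LHS](@isop_expand p l) ?sp// scaler_sumr; apply: eq_bigr => i _.
  by rewrite Mp ?sQ// scalerA mulrAC mulrC.
have px x : s <= x -> 0 < p.[x].
  move=> sx; have K0 y : s <= y -> 0 < (\sum_(i < l) ((Q i).[t] / h i) *: Q i).[y].
    move=> sy; rewrite horner_sum (bigD1 (Ordinal l0))//= ltr_pwDl//.
      by rewrite hornerZ mulr_gt0 ?divr_gt0 ?Q_gt0.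
    apply: sumr_ge0 => i _; rewrite hornerZ ltW// mulr_gt0 ?divr_gt0 ?Q_gt0//.
  have p1 : 0 < p.[1].
    have := Q1 l; rewrite Qp hornerM hornerXsubC pmulr_lgt0 ?subr_gt0//.
  move: p1; rewrite pexp !hornerZ !pmulr_lgt0 ?K0// ltW//.
rewrite Qp hornerM hornerXsubC mulr_ge0_le0 ?subr_le0// ltW ?px//.
Qed.

Variables (g : R) (g0 : 0 < g).

(** The reproducing kernel at s for the functional g M; [g] will be the normalising constant of the
    measure, which [M] omits. *)
Definition kernel_sum : {poly R} := \sum_(i < l) ((Q i).[s] / (g * h i)) *: Q i.

Lemma size_kernel_sum : (size kernel_sum <= l)%N.
Proof.
apply: leq_trans (size_sum _ _ _) _; apply/bigmax_leqP => i _.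
by apply: leq_trans (size_scale_leq _ _) _; rewrite sQ.
Qed.

Lemma kernel_sum_repr p : (size p <= l)%N -> g * M (p * kernel_sum) = p.[s].
Proof.
move=> sp; rewrite {2}(isop_expand sp) horner_sum /kernel_sum mulr_sumr (pf_sum HM).
rewrite mulr_sumr; apply: eq_bigr => i _.
rewrite -scalerAr (pfZ HM) hornerZ; field; rewrite ?gt_eqF ?h0//.
Qed.

Lemma kernel_uniq K : (size K <= l)%N ->
  (forall p, (size p <= l)%N -> g * M (p * K) = p.[s]) -> K = kernel_sum.
Proof.
move=> sK repr; rewrite (isop_expand sK); apply: eq_bigr => i _; congr (_ *: _).
have := repr (Q i); rewrite sQ => /(_ (ltn_ord i)) <-; rewrite [K * _]mulrC.
by field; rewrite ?gt_eqF ?h0.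
Qed.

Local Notation K := kernel_sum.

Lemma kernel_gt0 x : s <= x -> 0 < K.[x].
Proof.
move=> sx; rewrite horner_sum (bigD1 (Ordinal l0))//= ltr_pwDl//.
  by rewrite hornerZ mulr_gt0 ?divr_gt0 ?mulr_gt0 ?Q_gt0.
by apply: sumr_ge0 => i _; rewrite hornerZ ltW// mulr_gt0 ?divr_gt0 ?mulr_gt0 ?Q_gt0.
Qed.

Lemma size_lead_kernel : size K = l /\ 0 < lead_coef K.
Proof.
move: Q_gt0; rewrite /K; case: (l) l0 => // l' _ Qg; rewrite big_ord_recr /=.
set c := _ / _; have c0 : 0 < c by rewrite /c divr_gt0 ?mulr_gt0 ?Qg.
have sz : (size (\sum_(i < l') ((Q i).[s] / (g * h i)) *: Q i)%R < size (c *: Q l')%R)%N.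
  rewrite size_scale ?gt_eqF// sQ ltnS.
  apply: leq_trans (size_sum _ _ _) _; apply/bigmax_leqP => i _.
  by apply: leq_trans (size_scale_leq _ _) _; rewrite sQ.
rewrite addrC size_polyDl// lead_coefDl// size_scale ?gt_eqF// sQ lead_coefZ.
by split => //; rewrite mulr_gt0// (isop_lead_gt0 HM (HQ l')).
Qed.

Definition psi : {poly R} := ('X - s%:P) * K.

Lemma psi_orth r : (size r < l)%N -> M (psi * r) = 0.
Proof.
move=> sr; apply: (mulfI (lt0r_neq0 g0)); rewrite mulr0.
have -> : psi * r = ('X - s%:P) * r * K by rewrite /psi; ring.
rewrite kernel_sum_repr ?hornerM ?hornerXsubC ?subrr ?mul0r//.
have [->|r0] := eqVneq r 0; first by rewrite mulr0 size_poly0.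
by rewrite size_monicM ?monicXsubC// size_XsubC.
Qed.

(** By [psi_orth] nothing below Q_{l-1} occurs. Evaluating at s, where psi vanishes, gives a Q_l(s)
    + b Q_{l-1}(s) = 0, and the sign of b follows from [Ql_le0]. *)
Lemma psi_decomp : exists a b, [/\ 0 < a, 0 <= b & psi = a *: Q l + b *: Q l.-1].
Proof.
have [sK lK] := size_lead_kernel.
have K0 : K != 0 by rewrite -lead_coef_eq0 gt_eqF.
have spsi : size psi = l.+1 by rewrite size_monicM ?monicXsubC// size_XsubC sK.
have lQ := isop_lead_gt0 HM (HQ l) (Q1 l).
pose a := lead_coef K / lead_coef (Q l).
have a0 : 0 < a by rewrite divr_gt0.
have sd : (size (psi - a *: Q l)%R <= l)%N.
  apply/leq_sizeP => j; rewrite leq_eqVlt => /predU1P[<-|lj]; last first.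
    by rewrite coefB coefZ !nth_default ?mulr0 ?subrr ?sQ ?spsi.
  have e p : size p = l.+1 -> p`_l = lead_coef p by rewrite lead_coefE => ->.
  rewrite coefB coefZ !e// lead_coef_monicM// ?monicXsubC//.
  by rewrite divfK ?subrr// gt_eqF.
have -> : psi = a *: Q l + (psi - a *: Q l) by rewrite addrC subrK.
pose b := M ((psi - a *: Q l) * Q l.-1) / h l.-1.
have db : psi - a *: Q l = b *: Q l.-1.
  have e : l = l.-1.+1 by rewrite prednK.
  have /isop_expand : (size (psi - a *: Q l)%R <= l.-1.+1)%N by rewrite -e.
  rewrite big_ord_recr /= big1 ?add0r => // i _.
  rewrite mulrBl (pfB HM) psi_orth; last by rewrite sQ; have := ltn_ord i; lia.
  rewrite -scalerAl (pfZ HM) isop_orth ?mulr0 ?subrr ?mul0r ?scale0r//.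
  by have := ltn_ord i; lia.
exists a, b; split => //; last by rewrite db.
have := congr1 (fun p => p.[s]) db.
rewrite /= hornerD hornerN !hornerZ hornerM hornerXsubC subrr mul0r sub0r => e.
have Qs : 0 < (Q l.-1).[s] by rewrite Q_gt0// prednK.
by rewrite -(@pmulr_lge0 _ (Q l.-1).[s])// -e oppr_ge0 mulr_ge0_le0 ?Ql_le0// ltW.
Qed.

Hypothesis sN1 : -1 <= s.

(** K has degree l - 1 and at least l - 2 sign changes in ]-1, 1[, so at most one root z is
    unaccounted for; it is real, and it is either a further simple root in the interval or at most
    -1. *)
Lemma kernel_roots :
  (exists zs, [/\ uniq zs, (size zs).+1 = l, {in zs, forall z, -1 < z < s} &
     K = lead_coef K *: nodal zs]) \/
  (exists zs z, [/\ uniq zs, (size zs).+2 = l, {in zs, forall z, -1 < z < s}, z <= -1 &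
     K = lead_coef K *: nodal (z :: zs)]).
Proof.
have [sK lK] := size_lead_kernel.
have K0 : K != 0 by rewrite -lead_coef_eq0 gt_eqF.
have rs z : root K z -> z < s.
  by move=> rz; rewrite ltNge; apply: contraL rz => /kernel_gt0; rewrite rootE; case: ltgtP.
have [|zs [uzs rzs sgn]] := @sign_changes R K (-1) 1 K0; first by lra.
have zsI : {in zs, forall z, -1 < z < s}.
  by move=> z /rzs/andP[/andP[-> _] /rs ->].
have rzs' : {in zs, forall z, root K z} by move=> z /rzs/andP[].
(* With too few points in [ys], the nonnegative polynomial (X - s)^2 K [nodal ys] would be psi times
   something of degree at most l - 2, on which [M] vanishes. *)
have pos ys : (forall x, -1 < x < 1 -> 0 <= (K * nodal ys).[x]) -> (l <= (size ys).+2)%N.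
  move=> ge0; rewrite leqNgt; apply/negP => lt.
  have : 0 < M (psi * (('X - s%:P) * nodal ys)).
    have -> : psi * (('X - s%:P) * nodal ys) = ('X - s%:P) ^+ 2 * (K * nodal ys).
      by rewrite /psi; ring.
    apply: HM.2; first by rewrite !mulf_neq0 ?nodal_neq0 ?polyXsubC_eq0.
    by move=> x xI; rewrite hornerM horner_exp mulr_ge0 ?sqr_ge0 ?ge0.
  rewrite psi_orth ?ltxx// size_monicM ?monicXsubC ?nodal_neq0// size_XsubC.
  by rewrite size_nodal.
(* The midpoint of [s, 1] decides the sign: K and the nodal polynomial are both positive there. *)
have {}sgn : forall x, -1 < x < 1 -> 0 <= (K * nodal zs).[x].
  case: sgn => // neg; have := neg ((s + 1) / 2).
  have zI : -1 < (s + 1) / 2 < 1 by move: s1 sN1; lra.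
  have zs' : s < (s + 1) / 2 by move: s1 sN1; lra.
  move=> /(_ zI); rewrite leNgt hornerM mulr_gt0 ?kernel_gt0 ?(ltW zs')//.
  by apply: nodal_gt0 => z /zsI/andP[_ /lt_trans]; apply.
have le2 := pos _ sgn; have lt1 := root_count K0 uzs rzs'; rewrite sK in lt1.
have [e1|ne1] := eqVneq (size zs).+1 l.
  by left; exists zs; split => //; apply: nodal_eq => //; rewrite sK e1.
have e2 : (size zs).+2 = l by move: le2 lt1 ne1; move: (size zs) => a; lia.
have [q Kq] := nodal_dvd uzs rzs'.
have q0 : q != 0 by apply: contraNneq K0 => q0; rewrite Kq q0 mul0r.
have sq : size q = 2.
  by have := sK; rewrite Kq size_Mmonic ?nodal_monic// size_nodal -e2; lia.
have [z rz] : exists z, root q z.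
  exists (- q`_0 / q`_1); rewrite rootE horner_coef sq big_ord_recr big_ord1 /= expr0 expr1.
  have q1 : q`_1 != 0 by have := lead_coef_eq0 q; rewrite lead_coefE sq (negPf q0) => /negbT.
  by apply/eqP; field.
have rKz : root K z by rewrite Kq rootM rz.
have lq : lead_coef q = lead_coef K by rewrite [in RHS]Kq lead_coef_Mmonic ?nodal_monic.
have qz : q = lead_coef q *: ('X - z%:P).
  by have := @nodal_eq _ q [:: z]; rewrite /nodal big_seq1; apply => // y; rewrite inE => /eqP->.
have Kz : K = lead_coef K *: nodal (z :: zs).
  by rewrite nodal_cons {1}Kq qz lq scalerAl.
have [zN1|zN1] := leP z (-1).
  by right; exists zs, z.
(* A double root could be dropped from [zs] without changing the sign, contradicting the count in
   [pos]. *)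
have zzs : z \notin zs.
  apply/negP => zin.
  have := pos (rem z zs); rewrite size_rem// => bad.
  suff : (l <= (size zs).-1.+2)%N by case: (zs) zin e2 => //= ? ? _ <-; rewrite ltnn.
  apply: bad => x xI; rewrite Kz nodal_cons (nodal_rem zin).
  rewrite -scalerAl hornerZ !hornerM hornerXsubC [X in _ * X](_ : _ =
    ((x - z) * (nodal (rem z zs)).[x]) ^+ 2); last by ring.
  by rewrite mulr_ge0 ?sqr_ge0// ltW.
left; exists (z :: zs); split => //=; first by rewrite zzs.
by move=> y; rewrite inE => /predU1P[->|/zsI//]; rewrite zN1 rs.
Qed.

End OrthogonalFamily.

(** * Zeros, Gegenbauer coefficients and value at 1 of the Levenshtein polynomial *)

Section Levenshtein.
Variables (R : rcfType) (m : nat) (L : {poly R} -> R).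
Hypotheses (HL : posfun L)
  (L_ibp : forall p, L ((1 - 'X ^+ 2) * p^`()) = m.+1%:R * L ('X * p)).
Implicit Types (p q r K : {poly R}) (x z : R) (k : nat) (eps : bool).

Local Notation P := (geg R m).
Local Notation A := (gA R m).
Local Notation E := (gE R m).

Lemma horner1DX x : (1 + 'X).[x] = 1 + x. Proof. by rewrite !hornerE. Qed.

Lemma hornerCsubX (c : R) x : (c%:P - 'X).[x] = c - x.
Proof. by rewrite !hornerE. Qed.

Definition adj_weight eps : {poly R} := (1 - 'X) * (1 + 'X) ^+ eps.
Definition adj_fun eps p : R := L (adj_weight eps * p).
Definition adj_poly eps k : {poly R} := if eps then E k else A k.

Local Notation M := adj_fun.
Local Notation Q := adj_poly.

Lemma adj_posfun eps : posfun (M eps).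
Proof.
apply: (pf_mulC HL).
  move=> x xI; rewrite hornerM horner_exp ?(horner1DX, hornerCsubX, hornerXsubC).
  by apply: mulr_ge0; [lra|apply: exprn_ge0; lra].
rewrite mulf_neq0//.
  apply/eqP => /(congr1 (fun p => p.[0])); rewrite !hornerE => /eqP.
  by rewrite subr0 oner_eq0.
rewrite expf_neq0//; apply/eqP => /(congr1 (fun p => p.[0])); rewrite !hornerE => /eqP.
by rewrite ?addr0 oner_eq0.
Qed.

Lemma adj_weightT : adj_weight true = 1 - 'X ^+ 2.
Proof. by rewrite /adj_weight expr1; ring. Qed.

Lemma adj_isop eps k : isop (M eps) k (Q eps k).
Proof.
case: eps; split; rewrite ?size_gE ?size_gA// => r sr.
  by rewrite /M adj_weightT gE_orth.
by rewrite /M /adj_weight expr0 mulr1 gA_orth.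
Qed.

Lemma gA1_gt0 k : 0 < (A k).[1].
Proof.
rewrite -(@pmulr_rgt0 _ m.+1%:R) ?ltr0n// gA_at1 mulr_gt0 ?gc_gt0// ltr0n; lia.
Qed.

Lemma gE1_gt0 k : 0 < (E k).[1].
Proof.
elim/geg_ind: k => [||k IH _]; rewrite ?gE0 ?gE1 ?gESS ?hornerD ?hornerCM ?geg_at1.
- by rewrite hornerC.
- by rewrite mulr1 gr_gt0.
- by rewrite mulr1 addr_gt0// gr_gt0.
Qed.

Lemma adj1_gt0 eps k : 0 < (Q eps k).[1].
Proof. by case: eps; rewrite ?gE1_gt0 ?gA1_gt0. Qed.

Variables (s : R) (l : nat) (eps : bool).
Hypothesis l0 : (0 < l)%N.
(* s is at least the largest zero of the polynomial orthogonal for the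
   neighbouring weight, i.e. s >= t_{l-1+eps}^{1,1-eps}. *)
Hypothesis low : if eps then forall x, root (A l) x -> x <= s
  else -1 <= s /\ forall x, root (E l.-1) x -> x <= s.
Variable t : R.
Hypothesis root_t : root (Q eps l) t.
Hypothesis st : s <= t.

Lemma lev_s_lt1 : s < 1.
Proof.
have /andP[_] := isop_root_itv (adj_posfun eps) (adj_isop eps l) root_t.
exact: le_lt_trans.
Qed.

Lemma lev_s_gtN1 : eps -> -1 < s.
Proof.
move=> e; move: low; rewrite e => lowA.
have [zs [_ szs rzs]] := isop_uniq_roots (adj_posfun false) (adj_isop false l).
case: zs szs rzs => [e0|z zs _ rzs]; first by move: l0; rewrite -e0.
have rz := rzs z (mem_head _ _).
have /andP[zN1 _] := isop_root_itv (adj_posfun false) (adj_isop false l) rz.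
exact: lt_le_trans zN1 (lowA z rz).
Qed.

Lemma lev_s_geN1 : -1 <= s.
Proof. by case: (boolP eps) low => [/lev_s_gtN1/ltW//|_ []]. Qed.

Lemma adj_funE p : M true p = M false ((1 + 'X) * p).
Proof. by rewrite /M /adj_weight expr1 expr0; congr L; ring. Qed.

(* If x >= s is a root of Q_i, then Q_i^2 / (x - X) is nonnegative on the nodes
   of the quadrature formula of the neighbouring weight, whose largest node is at
   most s. *)
Lemma lev_noroot i x : (i < l)%N -> s <= x -> ~~ root (Q eps i) x.
Proof.
move=> il sx; apply/negP => rx.
have [p Qp] := factor_theorem _ _ rx.
have p0 : p != 0.
  by apply: contraTneq isT => p0; have := (adj_isop eps i).1; rewrite Qp p0 mul0r size_poly0.
have sp : size p = i.
  by have := (adj_isop eps i).1; rewrite Qp size_Mmonic ?monicXsubC// size_XsubC addn2 => -[].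
have orth : M eps (('X - x%:P) * p ^+ 2) = 0.
  have -> : ('X - x%:P) * p ^+ 2 = Q eps i * p by rewrite Qp; ring.
  by rewrite (adj_isop eps i).2// sp.
have sp2 : (size (p ^+ 2) <= (i + i).-1)%N.
  by apply: leq_trans (size_polyMleq _ _) _; rewrite sp.
have i0 : (0 < i)%N by rewrite -sp size_poly_gt0.
have sXp : (size ((x%:P - 'X) * p ^+ 2)%R <= i + i)%N.
  apply: leq_trans (size_polyMleq _ _) _.
  by rewrite -opprB size_polyN size_XsubC /=; move: sp2; case: (i) i0.
case: eps low orth => [lowA|[_ lowE]] orth; last first.
  have := (gauss_ge0 (adj_posfun true) (adj_isop true l.-1) (p := (x%:P - 'X) * p ^+ 2)).
  have sz : (size ((x%:P - 'X) * p ^+ 2)%R <= l.-1 + l.-1)%N.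
    by apply: leq_trans sXp _; lia.
  case=> //.
    move=> z zI /lowE zs; rewrite hornerM horner_exp ?(horner1DX, hornerCsubX, hornerXsubC).
    by apply: mulr_ge0 (sqr_ge0 _); rewrite subr_ge0 (le_trans zs).
  move=> ge0 _.
  have := pf_sqr_gt0 (adj_posfun false) (p := ('X - x%:P) * p).
  rewrite mulf_neq0 ?polyXsubC_eq0// => /(_ isT); apply/negP; rewrite -leNgt.
  rewrite -oppr_ge0; apply: le_trans ge0 _.
  rewrite adj_funE le_eqVlt; apply/orP; left; apply/eqP.
  (* From 1 + X = (X - x) + (1 + x); the second part vanishes by [orth], leaving minus a square. *)
  have -> : (1 + 'X) * ((x%:P - 'X) * p ^+ 2) =
     - (('X - x%:P) * p) ^+ 2 - (1 + x)%:P * (('X - x%:P) * p ^+ 2).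
    by rewrite polyCD; ring.
  rewrite (pfB (adj_posfun false)) (pfN (adj_posfun false)) (pfMC (adj_posfun false)).
  by rewrite orth mulr0 subr0.
have [] := (gauss_ge0 (adj_posfun false) (adj_isop false l) (p := (1 + 'X) * ((x%:P - 'X) * p ^+ 2))).
- apply: leq_trans (size_polyMleq _ _) _; rewrite addrC -polyC1 size_XaddC /=.
  by apply: leq_ltn_trans sXp _; lia.
- move=> z zI /lowA zs; rewrite 2!hornerM horner_exp ?(horner1DX, hornerCsubX, hornerXsubC).
  apply: mulr_ge0; first by lra.
  by apply: mulr_ge0 (sqr_ge0 _); rewrite subr_ge0 (le_trans zs).
(* By [orth] the quadrature sum is 0, so p vanishes at every root of [A l] other than x: at least l
   - 1 roots for degree i - 1. *)
move=> _ zero.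
have zero0 : M false ((1 + 'X) * ((x%:P - 'X) * p ^+ 2)) = 0.
  rewrite -adj_funE -opprB mulNr (pfN (adj_posfun true)) orth oppr0//.
have [zs [uzs szs rzs]] := isop_uniq_roots (adj_posfun false) (adj_isop false l).
have rp z : z \in [seq z <- zs | z != x] -> root p z.
  rewrite mem_filter => /andP[zx zin].
  have /eqP := zero zero0 z (rzs z zin).
  have /andP[zN1 _] := isop_root_itv (adj_posfun false) (adj_isop false l) (rzs z zin).
  have z1 : 1 + z != 0 by rewrite gt_eqF//; lra.
  have xz : x - z != 0 by rewrite subr_eq0 eq_sym.
  rewrite 2!hornerM horner_exp ?(horner1DX, hornerCsubX, hornerXsubC).
  by rewrite !mulf_eq0 ?orbb rootE (negPf z1) (negPf xz).
have := root_count p0 (filter_uniq _ uzs) rp.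
rewrite sp size_filter.
have := count_predC (pred1 x) zs; rewrite (count_uniq_mem _ uzs) szs.
have -> : count (predC (pred1 x)) zs = count (fun z => z != x) zs by [].
by move: (count _ _) il => c; case: (x \in zs) => /=; lia.
Qed.

Variables (g : R) (g0 : 0 < g).

Local Notation K := (kernel_sum (M eps) (Q eps) s l g).
Local Notation psi := (psi (M eps) (Q eps) s l g).

Let HM := adj_posfun eps.
Let HQ := adj_isop eps.
Let Q1 := adj1_gt0 eps.

Let lev_psi_decomp :=
  psi_decomp HM HQ Q1 l0 lev_s_lt1 lev_noroot root_t st g0.
Let lev_kernel_gt0 := kernel_gt0 HM HQ Q1 l0 lev_s_lt1 lev_noroot g0.
Let lev_psi_orth := @psi_orth _ _ HM _ HQ s l _ g0.

Lemma lev_size_lead : size K = l /\ 0 < lead_coef K.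
Proof. exact (size_lead_kernel HM HQ Q1 l0 lev_s_lt1 lev_noroot g0). Qed.

Lemma kernel_neq0 : K != 0.
Proof. by rewrite -lead_coef_eq0 gt_eqF// (proj2 lev_size_lead). Qed.

Lemma psi_monicM : psi = ('X - s%:P) * K. Proof. by []. Qed.

(* A root z <= -1 (< -1 if eps = 0) of K is excluded by evaluating the
   orthogonality of psi to K / (X - z) by quadrature for the neighbouring weight. *)
Lemma lev_kernel_roots : exists zs, [/\ uniq zs, (size zs).+1 = l,
  {in zs, forall z, (if eps then -1 < z else -1 <= z) && (z < s)} &
  K = lead_coef K *: nodal zs].
Proof.
have [[zs [uzs szs zI Kzs]]|[zs [z [uzs szs zI zN1 Kz]]]] :=
    kernel_roots HM HQ Q1 l0 lev_s_lt1 lev_noroot root_t st g0 lev_s_geN1.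
  exists zs; split => // z /zI/andP[z1 ->]; rewrite andbT.
  by case: ifP => // _; exact: ltW.
have Kn0 := kernel_neq0.
have zzs : z \notin zs by apply/negP => /zI/andP[]; rewrite ltNge zN1.
pose N := nodal zs; have N0 : N != 0 := nodal_neq0 _.
have sN : size N = l.-1 by rewrite size_nodal -szs.
have cK : lead_coef K != 0 by rewrite lead_coef_eq0.
have sN2 : (size (N ^+ 2) <= l.-1 + l.-2)%N.
  by apply: leq_trans (size_polyMleq _ _) _; rewrite sN -szs /=; move: (size zs); clear; lia.
have orth : M eps (('X - s%:P) * (('X - z%:P) * N ^+ 2)) = 0.
  have := @lev_psi_orth N; rewrite sN => /(_ _)/= H.
  apply: (mulfI cK); rewrite mulr0 -(pfZ HM) -H; last by rewrite -szs.
  congr (M eps _); rewrite psi_monicM {2}Kz nodal_cons -/N -mul_polyC -[in RHS]mul_polyC; ring.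
have SsX (c : R) p d : (size p <= d)%N -> (size (('X - c%:P) * p)%R <= d.+1)%N.
  move=> sp; apply: leq_trans (size_polyMleq _ _) _; rewrite size_XsubC /=.
  by rewrite ltnS.
case Eeps : eps orth low lev_s_gtN1 => orth lowE sN1.
- have [] := gauss_ge0 (adj_posfun false) (adj_isop false l)
    (p := (1 + 'X) * ((s%:P - 'X) * (('X - z%:P) * N ^+ 2))).
  + have -> : (1 + 'X) * ((s%:P - 'X) * (('X - z%:P) * N ^+ 2)) =
       - (('X - (-1)%:P) * (('X - s%:P) * (('X - z%:P) * N ^+ 2))) by rewrite polyCN polyC1; ring.
    rewrite size_polyN; apply: leq_trans (SsX _ _ _ (SsX _ _ _ (SsX _ _ _ sN2))) _.
    by rewrite -szs /=; move: (size zs); clear; lia.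
  + move=> y yI /lowE ys; rewrite 3!hornerM horner_exp ?(horner1DX, hornerCsubX, hornerXsubC).
    have yz : 0 <= y - z by move: yI zN1; lra.
    have sy : 0 <= s - y by lra.
    have y1 : 0 <= 1 + y by lra.
    by rewrite mulr_ge0// mulr_ge0// mulr_ge0// sqr_ge0.
  (* N would vanish at all roots of [A l] except possibly s, at least l - 1 of them, but its degree
     is l - 2. *)
  move=> _ zero.
  have zero0 : M false ((1 + 'X) * ((s%:P - 'X) * (('X - z%:P) * N ^+ 2))) = 0.
    by rewrite -adj_funE -opprB mulNr (pfN (adj_posfun true)) orth oppr0.
  have [ys [uys sys rys]] := isop_uniq_roots (adj_posfun false) (adj_isop false l).
  have rp y : y \in [seq y <- ys | y != s] -> root N y.
    rewrite mem_filter => /andP[yx yin].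
    have /eqP := zero zero0 y (rys y yin).
    have /andP[yN1 _] := isop_root_itv (adj_posfun false) (adj_isop false l) (rys y yin).
    have yz : y - z != 0 by rewrite gt_eqF// subr_gt0 (le_lt_trans zN1).
    have y1 : 1 + y != 0 by rewrite gt_eqF//; lra.
    have sy : s - y != 0 by rewrite subr_eq0 eq_sym.
    rewrite 3!hornerM horner_exp ?(horner1DX, hornerCsubX, hornerXsubC).
    by rewrite !mulf_eq0 ?orbb rootE (negPf y1) (negPf yz) (negPf sy).
  have := root_count N0 (filter_uniq _ uys) rp.
  rewrite sN size_filter.
  have := count_predC (pred1 s) ys; rewrite (count_uniq_mem _ uys) sys.
  have -> : count (predC (pred1 s)) ys = count (fun z => z != s) ys by [].
  by move: (count _ _) szs => c; case: (s \in ys) => /=; move: (size zs) l0; clear; lia.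
case: lowE => _ lowE.
have ge1 : M false ((1 + 'X) * (('X - s%:P) * N ^+ 2)) <= 0.
  rewrite -adj_funE -oppr_ge0 -(pfN (adj_posfun true)).
  apply: (proj1 (gauss_ge0 (adj_posfun true) (adj_isop true l.-1) _ _)).
    rewrite size_polyN; apply: leq_trans (SsX _ _ _ sN2) _; rewrite -szs /=; move: (size zs); clear; lia.
  move=> y yI /lowE ys; rewrite hornerN oppr_ge0 hornerM hornerXsubC horner_exp.
  by rewrite mulr_le0_ge0 ?sqr_ge0// subr_le0.
have gt1 : M false (('X - s%:P) * N ^+ 2) < 0.
  rewrite -oppr_gt0 -(pfN (adj_posfun false)) lt_neqAle.
  have nr : forall y, root (A l.-1) y -> y < s.
    move=> y ry; rewrite ltNge; apply/negP => sy; have := @lev_noroot l.-1 y.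
    by rewrite prednK// leqnn sy Eeps /= ry => /(_ isT isT).
  have [||ge0 eq0] := gauss_ge0 (adj_posfun false) (adj_isop false l.-1)
    (p := - (('X - s%:P) * N ^+ 2)).
  - rewrite size_polyN; apply: leq_trans (SsX _ _ _ sN2) _; rewrite -szs /=; move: (size zs); clear; lia.
  - move=> y yI /nr ys; rewrite hornerN oppr_ge0 hornerM hornerXsubC horner_exp.
    by rewrite mulr_le0_ge0 ?sqr_ge0// subr_le0 ltW.
  rewrite ge0 andbT; apply/negP => /eqP/esym/eq0 zero.
  have [ys [uys sys rys]] := isop_uniq_roots (adj_posfun false) (adj_isop false l.-1).
  have rp : {in ys, forall y, root N y}.
    move=> y yin; have ry := rys y yin; have /eqP := zero y ry.
    rewrite hornerN oppr_eq0 hornerM hornerXsubC horner_exp mulf_eq0 expf_eq0 /=.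
    by rewrite lt_eqF ?subr_lt0 ?nr.
  by have := root_count N0 uys rp; rewrite sN sys ltnn.
(* Writing 1 + X = (X - z) + (1 + z) and using [orth], [ge1] becomes (1 + z) M((X - s) N^2) <= 0,
   and [gt1] makes the second factor negative. So -1 itself remains possible as a root here. *)
have z1 : z = -1.
  apply/eqP; rewrite eq_le zN1 /= -subr_ge0 opprK addrC.
  rewrite -(@nmulr_lle0 _ (M false (('X - s%:P) * N ^+ 2)))//.
  apply: le_trans ge1; rewrite le_eqVlt; apply/orP; left; apply/eqP.
  rewrite -(pfMC (adj_posfun false)) -[LHS]addr0 -orth -(pfD (adj_posfun false)).
  by congr (M false _); rewrite polyCD; ring.
exists (z :: zs); split; rewrite /= ?zzs ?szs//; last by move: Kz; rewrite Eeps.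
move=> y; rewrite inE => /predU1P[->|/zI/andP[/ltW -> ->]//].
apply/andP; split; first by rewrite z1.
rewrite ltNge; apply/negP => sz; have := lev_kernel_gt0 sz.
by rewrite Kz nodal_cons hornerZ hornerM hornerXsubC subrr mul0r mulr0 ltxx.
Qed.

Local Notation gcf := (gcf m L).
Local Notation gpos := (gpos m L).

Let L1 : 0 < L 1. Proof. exact: pf1_gt0. Qed.

Lemma gcf_gA i k : (k <= i)%N -> gcf (A i) k = gr R m k.
Proof.
move=> ki; rewrite /gcf gA_repr ?size_geg// geg_at1 mulr1.
by rewrite mulfK// gt_eqF.
Qed.

Lemma gcf_gE i k : (k <= i)%N ->
  gcf (E i) k = gr R m k * ((1 + (-1) ^+ (i + k)) / 2).
Proof.
move=> ki; rewrite /gcf gE_repr ?size_geg//; last by rewrite ltnS ltnW.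
rewrite geg_at1 geg_atN1 -exprD; field; rewrite ?gt_eqF//.
Qed.

Lemma gpos_adj e i : gpos (Q e i).
Proof.
move=> k; have [ki|ik] := leqP k i; last first.
  by rewrite gcf_high// (adj_isop e i).1.
case: e; rewrite ?gcf_gA ?gcf_gE//; last exact/ltW/gr_gt0.
apply: mulr_ge0; first exact/ltW/gr_gt0.
rewrite -signr_odd; case: odd; rewrite ?expr0 ?expr1; lra.
Qed.

Lemma gcf_adj_diag e i : 0 < gcf (Q e i) i.
Proof.
case: e; rewrite ?gcf_gA ?gcf_gE ?gr_gt0//.
by rewrite addnn -signr_odd odd_double expr0 mulr_gt0 ?gr_gt0//; lra.
Qed.

Let h0 k : 0 < M eps (Q eps k * Q eps k).
Proof. by rewrite -expr2 pf_sqr_gt0// (isop_neq0 (HQ k)). Qed.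

Let kc i : (i < l)%N -> 0 < (Q eps i).[s] / (g * M eps (Q eps i * Q eps i)).
Proof.
by move=> il; rewrite divr_gt0 ?mulr_gt0// (Q_gt0 Q1 lev_s_lt1 lev_noroot il).
Qed.

Lemma gpos_kernel : gpos K.
Proof.
apply: (gpos_sum HL) => i _; apply: (gposZ HL); last exact: gpos_adj.
exact/ltW/kc.
Qed.

Lemma gcf_kernel_gt0 k : (k < l)%N -> 0 < gcf K k.
Proof.
move=> kl; rewrite (gcf_sum m HL) (bigD1 (Ordinal kl))//= (gcfZ m HL) ltr_pwDl//.
  by rewrite mulr_gt0 ?kc ?gcf_adj_diag.
apply: sumr_ge0 => i _; rewrite (gcfZ m HL); apply: mulr_ge0; first exact/ltW/kc.
exact: gpos_adj.
Qed.

Definition phi : {poly R} := (1 + 'X) ^+ eps * psi.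

Let gpos_1DX : gpos (1 + 'X).
Proof. by apply: (gposD HL); [exact: (gpos_geg HL L_ibp 0)|exact: (gpos_geg HL L_ibp 1)]. Qed.

(** Since b may be 0, only Q_l is relied upon; for eps = 1 this is [E l], whose coefficients live on
    indices of the parity of l. *)
Lemma gcf_psi_gt0 k : (if eps then [&& k <= l & ~~ odd (l + k)] else k <= l)%N ->
  0 < gcf psi k.
Proof.
have [a [b [a0 b0 ->]]] := lev_psi_decomp => H.
rewrite (gcfD m HL) !(gcfZ m HL) ltr_pwDl//; last by apply: mulr_ge0 => //; exact: gpos_adj.
apply: mulr_gt0 => //; move: H; case: eps => [/andP[kl od]|kl] /=.
  by rewrite gcf_gE// -signr_odd (negPf od) expr0 mulr_gt0 ?gr_gt0//; lra.
by rewrite gcf_gA ?gr_gt0.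
Qed.

Lemma gpos_psi : gpos psi.
Proof.
have [a [b [a0 b0 ->]]] := lev_psi_decomp.
by apply: (gposD HL); apply: (gposZ HL) => //; [exact: ltW|exact: gpos_adj|exact: gpos_adj].
Qed.

Lemma gpos_phi : gpos phi.
Proof.
rewrite /phi; case: eps gpos_psi => /= H; last by rewrite expr0 mul1r.
by rewrite expr1; apply: (gposM HL L_ibp).
Qed.

(** The factor 1 + X fills the parity gaps of psi: the term 1 keeps the indices of the parity of l,
    and the term X reaches k from k - 1. *)
Lemma gcf_phi_gt0 k : (k <= l + eps)%N -> 0 < gcf phi k.
Proof.
have psi0 := gpos_psi; have psik := gcf_psi_gt0.
rewrite /phi; case: eps psi0 psik => /= psi0 psik; last first.
  by rewrite expr0 mul1r addn0; exact: psik.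
rewrite expr1 addn1 => kl.
have c1 : 0 < gcf (1 + 'X) 1.
  by rewrite (gcfD m HL) (gcf_geg HL L_ibp 0) (gcf_geg HL L_ibp 1) add0r ltr01.
have c0 : 0 < gcf (1 + 'X) 0.
  by rewrite (gcfD m HL) (gcf_geg HL L_ibp 0) (gcf_geg HL L_ibp 1) addr0 ltr01.
have [od|ev] := boolP (odd (l + k)).
  case: k kl od => [_|k kl]; last first.
    rewrite addnS /= => ev.
    apply: (gcfM_gt0 HL L_ibp gpos_1DX psi0 c1 (j := k)); first by apply: psik; rewrite -ltnS kl.
    exact: (gcf_gegM_top HL L_ibp 1).
  (* For k = 0 and l odd there is no smaller index; X P_1 contributes through the norm of P_1. *)
  rewrite addn0 => ol; apply: (gcfM_gt0 HL L_ibp gpos_1DX psi0 c1 (j := 1)).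
    by apply: psik; rewrite l0 addn1 /= ol.
  by rewrite gcf_at0 divr_gt0 ?geg_norm_gt0.
have {}kl : (k <= l)%N.
  move: kl; rewrite leq_eqVlt => /predU1P[e|//]; move: ev.
  by rewrite e addnS addnn /= odd_double.
apply: (gcfM_gt0 HL L_ibp gpos_1DX psi0 c0 (j := k)); first by apply: psik; rewrite kl ev.
exact: (gcf_gegM_top HL L_ibp 0).
Qed.

(** Every k up to the full degree splits as i + j with positive coefficients of phi at i and of K at
    j, and P_i P_j contains P_{i+j}. *)
Lemma gcf_phiK_gt0 k : (k <= l + eps + l.-1)%N -> 0 < gcf (phi * K) k.
Proof.
move=> kl; have [i [j [ik jl kE]]] : exists i j, [/\ (i <= l + eps)%N, (j < l)%N & k = (i + j)%N].
  have [kl'|lk] := leqP k (l + eps); first by exists k, 0%N; rewrite addn0.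
  by exists (l + eps)%N, (k - (l + eps))%N; split => //; lia.
have := gcfM_gt0 HL L_ibp gpos_phi gpos_kernel (gcf_phi_gt0 ik) (gcf_kernel_gt0 jl).
by rewrite kE; apply; exact: gcf_gegM_top.
Qed.

(* As psi is orthogonal to polynomials of degree at most l - 2, only the value of K
   at 1 contributes. *)
Lemma gcf_phiK0 : gcf (phi * K) 0 = K.[1] * gcf phi 0.
Proof.
rewrite !gcf_at0 mulrA; congr (_ / _).
have [q Kq] : exists q, K - K.[1]%:P = q * ('X - 1%:P).
  by apply/factor_theorem; rewrite rootE !hornerE subrr.
have sq : (size q < l)%N.
  have [->|q0] := eqVneq q 0; first by rewrite size_poly0.
  have : (size (K - K.[1]%:P)%R <= l)%N.
    apply: leq_trans (size_polyD _ _) _; rewrite geq_max size_polyN.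
    rewrite (proj1 lev_size_lead) leqnn /=.
    by apply: leq_trans (size_polyC_leq1 _) _.
  by rewrite Kq size_Mmonic ?monicXsubC// size_XsubC addn2.
have -> : phi * K = K.[1]%:P * phi - adj_weight eps * (psi * q).
  by rewrite -[K in LHS](subrK K.[1]%:P) Kq /phi /adj_weight polyC1; ring.
by rewrite (pfB HL) (pfMC HL) -/(M eps (psi * q)) lev_psi_orth// subr0.
Qed.

Definition lev_value : R :=
  gc R m (l.-1 + eps) *
  ((2 * l%:R + m%:R - 1 + 2 * eps%:R) / m.+1%:R -
   ((1 + s) ^+ eps * ((P (l.-1 + eps)).[s] - (P (l + eps)).[s])) /
   ((1 - s) * (eps%:R * (P l).[s] + (P (l + eps)).[s]))).

Let gA_rec i : A i.+1 = A i + gr R m i.+1 *: P i.+1.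
Proof. by rewrite /gA big_ord_recr /= mul_polyC. Qed.

(** In this form one unknown is left, which phi(s) = 0 will determine; each [A i] has constant
    coefficient 1. *)
Lemma phi_expand_false : ~~ eps ->
  exists d, phi = gcf phi 0 *: A l.-1 + d *: P l.
Proof.
move=> /negPf e; have en : nat_of_bool eps = 0%N by rewrite e.
have [a [b [a0 b0 pE]]] := lev_psi_decomp.
have Qe i : Q eps i = A i by rewrite e.
rewrite !Qe in pE; have phiE : phi = psi by rewrite /phi en expr0 mul1r.
exists (a * gr R m l); rewrite phiE pE (gcfD m HL) !(gcfZ m HL) !gcf_gA// gr0 !mulr1.
have AE : A l = A l.-1 + gr R m l *: P l by have := gA_rec l.-1; rewrite prednK.
by rewrite AE; move: (gr R m l) => r; rewrite -!mul_polyC !polyCD !polyCM; ring.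
Qed.

(** For the weight 1 - t, phi is orthogonal to degrees up to l - 2, so it combines [A l.-1], [A l]
    and [A l.+1]; consecutive [A] differ by a multiple of one Gegenbauer polynomial. *)
Lemma phi_expand_true : eps ->
  exists d1 d2, phi = gcf phi 0 *: A l + d1 *: P l.+1 + d2 *: P l.
Proof.
move=> e; have en : nat_of_bool eps = 1%N by rewrite e.
have phiE : phi = (1 + 'X) * psi by rewrite /phi en expr1.
have ME p : M eps p = M false ((1 + 'X) * p) by rewrite e adj_funE.
have sphi : (size phi <= l.-1.+3)%N.
  rewrite phiE; apply: leq_trans (size_polyMleq _ _) _; rewrite addrC -polyC1 size_XaddC /=.
  have [a [b [a0 b0 ->]]] := lev_psi_decomp.
  apply: leq_trans (size_polyD _ _) _; rewrite geq_max.
  apply/andP; split; apply: leq_trans (size_scale_leq _ _) _;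
    by rewrite (adj_isop eps _).1; move: l0; lia.
have := isop_expand (adj_posfun false) (adj_isop false) sphi.
rewrite !big_ord_recr /= big1 ?add0r; last first.
  move=> i _; have il := ltn_ord i; rewrite phiE -mulrA -ME.
  rewrite lev_psi_orth ?mul0r ?scale0r// size_gA; lia.
set d0 := _ / _; set d1 := _ / _; set d2 := _ / _ => phiA.
clearbody d0 d1 d2.
exists (d2 * gr R m l.+1), (- d0 * gr R m l).
have -> : gcf phi 0 = d0 + d1 + d2.
  by rewrite phiA !(gcfD m HL) !(gcfZ m HL) !gcf_gA// gr0 !mulr1.
have eE : l = l.-1.+1 by rewrite prednK.
have AE : A l = A l.-1 + gr R m l *: P l by have := gA_rec l.-1; rewrite -eE.
rewrite phiA -eE gA_rec AE; move: (gr R m l) (gr R m l.+1) => r r'.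
by rewrite -!mul_polyC !polyCD !polyCM polyCN; ring.
Qed.

(** The unknown coefficients are solved from phi(s) = 0 and, if eps = 1, phi(-1) = 0; substituting
    them at 1 produces the Levenshtein function. *)
Lemma phi_at1 : phi.[1] = lev_value * gcf phi 0.
Proof.
have B0 : 0 < gcf phi 0 by apply: gcf_phi_gt0.
have s1 := lev_s_lt1; have s1' : 1 - s != 0 by rewrite gt_eqF// subr_gt0.
have m0 : m.+1%:R != 0 :> R by rewrite pnatr_eq0.
have A1 k : (A k).[1] = (2 * k + m.+1)%:R * gc R m k / m.+1%:R.
  by rewrite -gA_at1 mulrC mulKf.
have Aeval k x : 1 - x != 0 -> (A k).[x] = gc R m k * ((P k).[x] - (P k.+1).[x]) / (1 - x).
  by move=> x1; rewrite -gA_eval mulrC mulKf.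
have eE : l = l.-1.+1 by rewrite prednK.
have phis : phi.[s] = 0.
  by rewrite /phi hornerM psi_monicM hornerM hornerXsubC subrr mul0r mulr0.
have [e|e] : eps \/ ~~ eps by case: (eps); [left|right].
  have [d1 [d2]] := phi_expand_true e.
  set B := gcf phi 0 in B0 *; clearbody B => phiE.
  have en : nat_of_bool eps = 1%N by rewrite e.
  have sN1 := lev_s_gtN1 e.
  rewrite /lev_value en !addn1 -eE expr1 mulr1n !mul1r !mulr1.
  have := phis; rewrite phiE !hornerD !hornerZ => es.
  have phiN1 : phi.[-1] = 0 by rewrite /phi en expr1 hornerM horner1DX subrr mul0r.
  have n2 : 1 - (-1) != 0 :> R by rewrite opprK gt_eqF ?addr_gt0.
  move: phiN1; rewrite phiE !hornerD !hornerZ Aeval// !geg_atN1 => eN1.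
  set c := gc R m l in es eN1 *; have c0 : c != 0 by rewrite gt_eqF ?gc_gt0.
  have d2E : d2 = d1 - B * c.
    apply: (mulfI (x := (-1) ^+ l)); first by rewrite signr_eq0.
    move: eN1; rewrite exprS => eN1.
    by apply: (eq_from_diff eN1); field.
  move: es; rewrite Aeval// -/c => es.
  (* If the denominator vanished, phi(s) = 0 would force P_l(s) = 0, giving two consecutive
     polynomials a common root. *)
  have den0 : (P l).[s] + (P l.+1).[s] != 0.
    apply/eqP => den0; have PS : (P l.+1).[s] = - (P l).[s].
      by apply/eqP; rewrite -addr_eq0 addrC den0.
    have : B * c * (1 + s) * (P l).[s] = 0.
      apply: (mulIf (x := (1 - s)^-1)); first by rewrite invr_eq0.
      rewrite mul0r -es PS d2E; field.
      exact: s1'.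
    move/eqP; rewrite !mulf_eq0 (gt_eqF B0) (negPf c0) /= => /orP[|/eqP Pl].
      by rewrite gt_eqF//; lra.
    by apply: (geg_no_common_root Pl); rewrite PS Pl oppr0.
  have d1E : d1 = B * c * ((P l.+1).[s] - s * (P l).[s]) / ((1 - s) * ((P l).[s] + (P l.+1).[s])).
    rewrite -[d1](mulfK den0); rewrite invfM mulrA; congr (_ / _).
    by apply: (eq_from_diff es); rewrite d2E; field.
  rewrite ?hornerD ?hornerZ !geg_at1 A1 -/c d2E d1E.
  by field; rewrite den0 s1' nat1r m0.
have [d] := phi_expand_false e.
set B := gcf phi 0 in B0 *; clearbody B => phiE.
have en : nat_of_bool eps = 0%N by rewrite (negPf e).
rewrite /lev_value en !addn0 expr0 mulr0n !mul0r !mulr0 !addr0 !add0r mul1r.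
have := phis; rewrite phiE hornerD !hornerZ => es.
have A0 : 0 < (A l.-1).[s].
  have := Q_gt0 Q1 lev_s_lt1 lev_noroot (i := l.-1) (x := s).
  by rewrite {1}/adj_poly (negPf e); apply; rewrite ?prednK.
have Pl0 : (P l).[s] != 0.
  apply/eqP => Pl0; move/eqP: es; rewrite Pl0 mulr0 addr0 mulf_eq0.
  by rewrite !gt_eqF.
have -> : d = - (B * (A l.-1).[s]) / (P l).[s].
  rewrite -[d](mulfK Pl0); congr (_ / _); apply: (addrI (B * (A l.-1).[s])).
  by rewrite es subrr.
rewrite ?hornerD ?hornerZ geg_at1 A1 Aeval// -eE.
have -> : (2 * l.-1 + m.+1)%:R = 2 * l%:R + m%:R - 1 :> R.
  by rewrite [in RHS]eE; ring.
by field; rewrite Pl0 s1' nat1r m0.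
Qed.

End Levenshtein.

(** * Hermite interpolation *)

Local Open Scope classical_set_scope.
Local Open Scope ring_scope.
Section HalfOpenDerivative.
Context {R : realType}.
Implicit Types (f g : R -> R) (l t s : R) (p : {poly R}).

Let A : set R := `[-1, 1[.

Definition is_hderiv f l t : Prop := diff_quotient f t @ within A t^' --> l.

Lemma hdP f l t : is_hderiv f l t <-> forall e, 0 < e -> exists2 d, 0 < d &
  forall u, A u -> u != t -> `|u - t| < d -> `|l - diff_quotient f t u| < e.
Proof.
split.
  move=> /cvgrPdist_lt H e e0; have := H e e0.
  rewrite !near_withinE => /nbhs_ballP[d /= d0 dP]; exists d => // u Au ut ud.
  by apply: dP => //; rewrite /ball /= distrC.
move=> H; apply/cvgrPdist_lt => e e0; have [d d0 dP] := H e e0.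
rewrite !near_withinE; apply/nbhs_ballP; exists d => //= u; rewrite /ball /= distrC => ud ut Au.
exact: dP.
Qed.

Lemma hd_cvg f t : cvg (diff_quotient f t @ within A t^') -> is_hderiv f (hderiv f t) t.
Proof. by []. Qed.

Lemma hd_continuous f l t : is_hderiv f l t -> f @ within A (nbhs t) --> f t.
Proof.
move=> /hdP H; apply/cvgrPdist_lt => e e0.
have [d d0 dP] := H 1 ltr01.
have l0 : 0 < `|l| + 1 by rewrite ltr_wpDl.
rewrite near_withinE; apply/nbhs_ballP.
exists (Num.min d (e / (`|l| + 1))); first by rewrite /= lt_min d0 divr_gt0.
move=> u; rewrite /ball /= lt_min distrC => /andP[ud ue] Au.
have [->|ut] := eqVneq u t; first by rewrite subrr normr0.
have := dP u Au ut ud; rewrite /diff_quotient => q1.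
have ut0 : u - t != 0 by rewrite subr_eq0.
rewrite distrC -[f u - f t](divfK ut0) normrM.
have : `|(f u - f t) / (u - t)| <= `|l| + 1.
  rewrite -lerBlDl; apply: le_trans (ltW q1); rewrite [leRHS]distrC.
  exact: lerB_dist.
move=> q2; apply: le_lt_trans (ler_wpM2r (normr_ge0 _) q2) _.
by rewrite mulrC -ltr_pdivlMr.
Qed.

Lemma hd_is_derive f l t : -1 < t < 1 -> is_hderiv f l t -> is_derive t 1 f l.
Proof.
move=> /andP[tN1 t1] /hdP H.
have key : (fun h : R => h^-1 *: ((f \o shift t) (h *: (1:R)) - f t)) @ 0^' --> l.
  apply/cvgrPdist_lt => e e0; have [d d0 dP] := H e e0.
  rewrite near_withinE; apply/nbhs_ballP.
  exists (Num.min d (Num.min (1 - t) (t + 1))).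
    by rewrite /= !lt_min d0 subr_gt0 t1 /=; lra.
  move=> u; rewrite /ball /= !lt_min sub0r normrN => /and3P[ud u1 u2] u0.
  have -> : u^-1 *: (f (u *: 1 + t) - f t) = diff_quotient f t (u + t).
    by rewrite /diff_quotient addrK /GRing.scale /= mulr1 mulrC.
  apply: dP; rewrite ?addrK//.
    move: u1 u2; rewrite /A /= in_itv /= !ltr_norml => u1 u2; lra.
  by rewrite -subr_eq0 addrK.
by apply: DeriveDef; [apply/cvg_ex; exists l | exact: cvg_lim key].
Qed.

Lemma hdB f g l l' t : is_hderiv f l t -> is_hderiv g l' t -> is_hderiv (f \- g) (l - l') t.
Proof.
move=> Hf Hg; rewrite /is_hderiv.
have -> : diff_quotient (f \- g) t = diff_quotient f t \- diff_quotient g t.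
  by apply/funext => u; rewrite /diff_quotient /=; ring.
exact: cvgB.
Qed.

Lemma hd_horner p t : is_hderiv (horner p) p^`().[t] t.
Proof.
have [q pq] : exists q, p - p.[t]%:P = q * ('X - t%:P).
  by apply/factor_theorem; rewrite rootE !hornerE subrr.
have qt : q.[t] = p^`().[t].
  have : (p - p.[t]%:P)^`().[t] = (q * ('X - t%:P))^`().[t] by rewrite pq.
  by rewrite derivB derivC subr0 derivM derivXsubC !hornerE subrr mulr0 add0r => ->.
have qe u : u != t -> diff_quotient (horner p) t u = q.[u].
  move=> ut; have : (p - p.[t]%:P).[u] = (q * ('X - t%:P)).[u] by rewrite pq.
  rewrite hornerM hornerXsubC hornerD hornerN hornerC => e.
  by rewrite /diff_quotient e mulfK// subr_eq0.
apply/hdP => e e0.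
have /cvgrPdist_lt/(_ e e0)/nbhs_ballP[d /= d0 dP] := @continuous_horner R q t.
exists d => // u _ ut ud; rewrite qe// -qt; apply: dP.
by rewrite /ball /= distrC.
Qed.

Section Rolle.
Variable s : R.
Hypothesis s1 : s < 1.

(** Inside the interval the derivative is the usual one, and the one-sided derivative at -1 still
    gives continuity there. *)
Lemma hd_rolle f f' a b : -1 <= a -> b <= s -> a < b ->
  (forall t, -1 <= t <= s -> is_hderiv f (f' t) t) -> f a = f b ->
  exists2 c, a < c < b & f' c = 0.
Proof.
have s1' := s1; move=> aN1 bs ab Hf fab.
have [||c cI dc] := @Rolle R f a b ab _ _ fab.
- move=> x; rewrite in_itv /= => /andP[ax xb].
  have [||//] := @hd_is_derive f (f' x) x; first by lra.
  by apply: Hf; lra.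
- apply/subspace_continuousP => x; rewrite /= in_itv /= => /andP[ax xb].
  have Hx : is_hderiv f (f' x) x by apply: Hf; lra.
  apply: cvg_trans (hd_continuous Hx); apply: cvg_app.
  apply: within_subset => y; rewrite /A /= !in_itv /= => /andP[ay yb].
  by apply/andP; split; lra.
exists c; first by rewrite in_itv in cI.
move: cI; rewrite in_itv /= => cI.
have d2 := @hd_is_derive f (f' c) c.
have [||_ e2] := d2; first by lra.
  by apply: Hf; lra.
by case: dc => _ e1; rewrite -e1 -e2.
Qed.

Let dom t := -1 <= t <= s.

(** The new zeros lie strictly between old ones, hence differ from all of them; this allows double
    nodes to be counted in addition. *)
Lemma hd_rolle_path f f' x xs : (forall t, dom t -> is_hderiv f (f' t) t) ->
  path <%R x xs -> {in x :: xs, forall z, dom z && (f z == 0)} ->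
  exists ys, [/\ uniq ys, size ys = size xs,
    {in ys, forall y, dom y && (f' y == 0)},
    {in ys, forall y, x < y} & {in ys, forall y, y \notin x :: xs}].
Proof.
move=> Hf; elim: xs x => [|x2 xs IH] x /=.
  by move=> _ _; exists [::]; split.
move=> /andP[xx2 pth] zs.
have [||ys [uys sys zys gys nys]] := IH x2 => //.
  by move=> z zin; apply: zs; rewrite inE zin orbT.
have /andP[/andP[d1 d1'] /eqP z1] := zs x (mem_head _ _).
have /andP[/andP[d2 d2'] /eqP z2] : dom x2 && (f x2 == 0).
  by apply: zs; rewrite !inE eqxx orbT.
have [|c /andP[xc cx2] fc] := hd_rolle d1 d2' xx2 Hf.
  by rewrite z1 z2.
have allgt : {in xs, forall z, x2 < z}.
  by move=> z zin; move: pth; rewrite (path_sortedE lt_trans) => /andP[/allP/(_ z zin)].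
exists (c :: ys); split => /=.
- rewrite uys andbT; apply/negP => /gys; rewrite ltNge => /negP; apply; exact: ltW.
- by rewrite sys.
- move=> y; rewrite inE => /predU1P[->|/zys//].
  by rewrite fc eqxx andbT /dom; lra.
- by move=> y; rewrite inE => /predU1P[->|/gys]//; apply: lt_trans.
- move=> y; rewrite inE => /predU1P[->|yin].
    rewrite !inE !negb_or (gt_eqF xc) (lt_eqF cx2) /=.
    by apply/negP => /allgt; rewrite ltNge (ltW cx2).
  rewrite inE negb_or nys// andbT gt_eqF//.
  by apply: lt_trans xx2 _; apply: gys.
Qed.

Lemma hd_rolle_uniq f f' xs : (forall t, dom t -> is_hderiv f (f' t) t) ->
  uniq xs -> {in xs, forall z, dom z && (f z == 0)} ->
  exists ys, [/\ uniq ys, size ys = (size xs).-1,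
    {in ys, forall y, dom y && (f' y == 0)} & {in ys, forall y, y \notin xs}].
Proof.
move=> Hf uxs zxs; have srt := sort_lt_sorted xs; rewrite uxs in srt.
have mem := mem_sort <=%R xs.
case E : (sort <=%R xs) => [|x xs'] in srt mem.
  by exists [::]; split => //; rewrite -(size_sort <=%R xs) E.
have [|ys [uys sys zys _ nys]] := hd_rolle_path Hf srt.
  by move=> z; rewrite mem; exact: zxs.
exists ys; split => //; first by rewrite -(size_sort <=%R xs) E.
by move=> y /nys; rewrite mem.
Qed.

Lemma hd_rolle_iter k (D : nat -> R -> R) xs :
  (forall i t, (i < k)%N -> dom t -> is_hderiv (D i) (D i.+1 t) t) ->
  uniq xs -> size xs = k.+1 -> {in xs, forall z, dom z && (D 0%N z == 0)} ->
  exists2 c, dom c & D k c = 0.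
Proof.
elim: k D xs => [|k IH] D xs HD uxs sxs zxs.
  case: xs uxs sxs zxs => [//|x xs] _ _ /(_ x (mem_head _ _))/andP[dx /eqP Dx].
  by exists x.
have [|ys [uys sys zys _]] := hd_rolle_uniq (f := D 0%N) (f' := D 1%N) _ uxs zxs.
  by move=> t; apply: HD.
rewrite sxs /= in sys.
by apply: (IH (fun i => D i.+1) ys) => // i t ik; apply: HD.
Qed.

End Rolle.
End HalfOpenDerivative.

Section HermiteInterpolation.
Context {R : realType}.
Implicit Types (f : R -> R) (zs ys : seq R) (g p : {poly R}) (s t : R).

(* The nodes zs are double and the nodes ys simple. *)
Definition interpolates (v d : R -> R) zs ys g : Prop :=
  [/\ (size g <= 2 * size zs + size ys)%N,
      {in zs ++ ys, forall z, g.[z] = v z} & {in zs, forall z, g^`().[z] = d z}].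

Definition nodal2 zs ys : {poly R} := nodal zs ^+ 2 * nodal ys.

Lemma size_nodal2 zs ys : size (nodal2 zs ys) = (2 * size zs + size ys).+1.
Proof.
rewrite size_Mmonic ?nodal_monic ?expf_neq0 ?nodal_neq0// expr2.
rewrite size_Mmonic ?nodal_monic ?nodal_neq0// !size_nodal; move: (size zs) (size ys); lia.
Qed.

Lemma nodal2_eval0 zs ys z : z \in zs ++ ys -> (nodal2 zs ys).[z] = 0.
Proof.
rewrite mem_cat => /orP[zin|zin]; rewrite hornerM horner_exp.
  by rewrite nodal_eval0// expr0n mul0r.
by rewrite (nodal_eval0 zin) mulr0.
Qed.

Lemma nodal2_neq0 zs ys z : z \notin zs ++ ys -> (nodal2 zs ys).[z] != 0.
Proof.
rewrite mem_cat negb_or => /andP[zz zy].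
by rewrite hornerM horner_exp mulf_neq0 ?expf_neq0 ?nodal_eval_neq0.
Qed.

Lemma nodal2_deriv0 zs ys z : z \in zs -> (nodal2 zs ys)^`().[z] = 0.
Proof.
move=> zin; rewrite /nodal2 derivM expr2 derivM.
by rewrite !(hornerD, hornerM) (nodal_eval0 zin); ring.
Qed.

Lemma interpolates_exists v d zs ys : uniq (zs ++ ys) ->
  exists g, interpolates v d zs ys g.
Proof.
elim: zs => [|z zs IH] /=.
  elim: ys => [|y ys IH] /=.
    by move=> _; exists 0; split; rewrite ?size_poly0// => z.
  move=> /andP[yys /IH[g [sg vg _]]].
  have Py : (nodal2 [::] ys).[y] != 0 by rewrite nodal2_neq0.
  exists (g + ((v y - g.[y]) / (nodal2 [::] ys).[y]) *: nodal2 [::] ys); split => //.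
    apply: leq_trans (size_polyD _ _) _; rewrite geq_max; apply/andP; split.
      by apply: leq_trans sg _; rewrite /= addnS leqnSn.
    by apply: leq_trans (size_scale_leq _ _) _; rewrite size_nodal2 /= addnS.
  move=> z /=; rewrite inE => /predU1P[->|zin].
    by rewrite hornerD hornerZ divfK// addrC subrK.
  by rewrite hornerD hornerZ [X in _ * X]nodal2_eval0// mulr0 addr0 vg.
move=> /andP[zzs /IH[g [sg vg dg]]].
set P := nodal2 zs ys; have Pz : P.[z] != 0 by rewrite nodal2_neq0.
(* Adding [P] times a linear polynomial keeps all earlier conditions; [c] adjusts the value at z and
   [e] the derivative. *)
pose c := (v z - g.[z]) / P.[z].
pose e := (d z - g^`().[z] - c * P^`().[z]) / P.[z].
have sP : size P = (2 * size zs + size ys).+1 by exact: size_nodal2.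
pose l := c%:P + e *: ('X - z%:P).
have sl : (size l <= 2)%N.
  apply: leq_trans (size_polyD _ _) _; rewrite geq_max.
  apply/andP; split; first by apply: leq_trans (size_polyC_leq1 _) _.
  by apply: leq_trans (size_scale_leq _ _) _; rewrite size_XsubC.
have ev x : (g + P * l).[x] = g.[x] + P.[x] * (c + e * (x - z)).
  by rewrite hornerD hornerM hornerD hornerC hornerZ hornerXsubC.
have dv x : (g + P * l)^`().[x] = g^`().[x] + (P^`().[x] * (c + e * (x - z)) + P.[x] * e).
  have dl : l^`() = e%:P by rewrite derivD derivC add0r derivZ derivXsubC alg_polyC.
  rewrite derivD derivM dl !hornerD [(_ * l).[x]]hornerM [(P * _).[x]]hornerM hornerC.
  by rewrite /l hornerD hornerC hornerZ hornerXsubC.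
exists (g + P * l); split.
- apply: leq_trans (size_polyD _ _) _; rewrite geq_max; apply/andP; split.
    by apply: leq_trans sg _; rewrite /=; move: (size zs) (size ys); lia.
  by apply: leq_trans (size_polyMleq _ _) _; move: sl; rewrite sP /=; move: (size zs) (size ys) (size l); lia.
- move=> x /=; rewrite inE => /predU1P[->|xin].
    by rewrite ev [z - z]subrr [e * 0]mulr0 addr0 mulrC /c divfK// addrC subrK.
  by rewrite ev nodal2_eval0// mul0r addr0 vg.
- move=> x; rewrite inE => /predU1P[->|xin].
    by rewrite dv [z - z]subrr [e * 0]mulr0 addr0 /e [P.[z] * _]mulrC divfK//; ring.
  rewrite dv nodal2_deriv0// nodal2_eval0; last by rewrite mem_cat xin.
  by rewrite !mul0r !addr0 dg.
Qed.

Lemma hderivable_le f k t : t \in `[-1, 1[ -> hderivable k.+1 f t -> hderivable k f t.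
Proof.
move=> tI [near _]; move: near; rewrite near_withinE => /nbhs_singleton; apply.
by rewrite /=.
Qed.

Lemma hderivable_hd f k t i : t \in `[-1, 1[ -> (i < k)%N -> hderivable k f t ->
  is_hderiv (hderivn i f) (hderivn i.+1 f t) t.
Proof.
move=> tI; elim: k => // k IH; rewrite ltnS leq_eqVlt => /predU1P[->|ik].
  by move=> [_ c]; exact: hd_cvg.
by move=> /(hderivable_le tI); apply: IH.
Qed.

Lemma derivn_monic_eq p n : size p = n.+1 -> p \is monic -> forall x, p^`(n).[x] = n`!%:R.
Proof.
move=> sp mp x; have s1 : (size p^`(n) <= 1)%N.
  by apply/leq_sizeP => j j1; rewrite coef_derivn nth_default ?mul0rn// sp; lia.
rewrite (size1_polyC s1) hornerC coef_derivn addn0 ffactnn.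
by move: mp; rewrite monicE lead_coefE sp => /eqP->.
Qed.

(** The factor c equals the q-th derivative at some point divided by q!; only its sign is kept. *)
Lemma hermite_error f s zs ys g :
  s < 1 -> uniq (zs ++ ys) -> {in zs ++ ys, forall z, -1 <= z <= s} ->
  let q := (2 * size zs + size ys)%N in (0 < q)%N ->
  interpolates f (hderiv f) zs ys g ->
  (forall t, -1 <= t <= s -> hderivable q f t /\ 0 <= hderivn q f t) ->
  forall t, -1 <= t <= s ->
    exists2 c, 0 <= c & f t - g.[t] = c * (nodal2 zs ys).[t].
Proof.
move=> s1 uz zI q q0 [sg vg dg] Hf t tI.
have [tin|tnin] := boolP (t \in zs ++ ys).
  by exists 0; rewrite // vg// subrr mul0r.
set P := nodal2 zs ys; have Pt : P.[t] != 0 by rewrite nodal2_neq0.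
(* This choice makes t an additional zero of f - p, beyond the nodes. *)
pose c := (f t - g.[t]) / P.[t]; exists c; last by rewrite /c divfK.
pose p := g + c *: P.
pose D i (u : R) := hderivn i f u - p^`(i).[u].
have AI u : -1 <= u <= s -> u \in `[-1, 1[.
  by rewrite in_itv /= => /andP[-> us]; apply: le_lt_trans us s1.
have HD i u : (i < q)%N -> -1 <= u <= s -> is_hderiv (D i) (D i.+1 u) u.
  move=> iq uI; have [dr _] := Hf u uI.
  have := hdB (hderivable_hd (AI _ uI) iq dr) (@hd_horner R p^`(i) u).
  by rewrite /D derivnS.
have uX : uniq (t :: zs ++ ys) by rewrite /= tnin.
have zX : {in t :: zs ++ ys, forall z, (-1 <= z <= s) && (D 0%N z == 0)}.
  move=> z; rewrite inE => /predU1P[->|zin].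
    by rewrite tI /D /= /p hornerD hornerZ /c divfK// [g.[t] + _]addrC subrK subrr eqxx.
  by rewrite zI// /D /= /p hornerD hornerZ nodal2_eval0// mulr0 addr0 vg// subrr eqxx.
have [|xs [uxs sxs zxs nxs]] := hd_rolle_uniq s1 (f := D 0%N) (f' := D 1%N) _ uX zX.
  by move=> u; apply: HD.
(* The zeros from Rolle together with the double nodes give q distinct zeros of the first
   derivative; q - 1 further applications of Rolle reach order q. *)
have uY : uniq (xs ++ zs).
  move: uz; rewrite !cat_uniq uxs => /and3P[-> _ _] /=; rewrite andbT.
  apply/hasPn => z zin; apply/negP => /nxs; rewrite inE mem_cat zin orbT //.
have zY : {in xs ++ zs, forall z, (-1 <= z <= s) && (D 1%N z == 0)}.
  move=> z; rewrite mem_cat => /orP[/zxs//|zin].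
  rewrite zI ?mem_cat ?zin// /D derivn1 /p derivD derivZ hornerD hornerZ.
  by rewrite nodal2_deriv0// mulr0 addr0 dg// subrr eqxx.
have [||x xI Dx] := hd_rolle_iter s1 (k := q.-1) (D := fun i => D i.+1) _ uY _ zY.
- by move=> i u iq; apply: HD; lia.
- by rewrite size_cat sxs /= size_cat; rewrite /q; lia.
have [_ hx] := Hf x xI.
move: Dx; rewrite prednK// /D /p => /eqP; rewrite subr_eq0 => /eqP e.
have mP : P \is monic by rewrite rpredM ?rpredX ?nodal_monic.
have gq : g^`(q) = 0.
  by apply/polyP => j; rewrite coef_derivn nth_default ?mul0rn ?coef0// (leq_trans sg)// leq_addr.
move: e; rewrite derivnD derivnZ gq add0r hornerZ (derivn_monic_eq _ mP) ?size_nodal2// => e.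
by move: hx; rewrite e pmulr_lge0// ltr0n fact_gt0.
Qed.

Lemma count_double zs z : count_mem z (flatten [seq nseq 2 y | y <- zs]) = (2 * count_mem z zs)%N.
Proof. by elim: zs => //= y zs ->; case: (y == z) => /=; lia. Qed.

Lemma mem_double zs z : (z \in flatten [seq nseq 2 y | y <- zs]) = (z \in zs).
Proof. by rewrite -!has_pred1 !has_count count_double muln_gt0. Qed.

Lemma size_double zs : size (flatten [seq nseq 2 y | y <- zs]) = (2 * size zs)%N.
Proof. by elim: zs => //= y zs ->; rewrite mulnS. Qed.

Lemma is_hermiteP (h : R -> \bar R) zs ys ys' g : uniq (zs ++ ys ++ ys') ->
  is_hermite h (ys ++ flatten [seq nseq 2 z | z <- zs] ++ ys') g <->
  interpolates (fine \o h) (hderiv (fine \o h)) zs (ys ++ ys') g.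
Proof.
move=> uz; set T := ys ++ _.
have sT : size T = (2 * size zs + size (ys ++ ys'))%N.
  by rewrite /T !size_cat size_double; move: (size zs) (size ys) (size ys'); lia.
have mT t : (t \in T) = (t \in zs ++ ys ++ ys').
  by rewrite /T !mem_cat mem_double orbCA.
have cT t : count_mem t T = (2 * (t \in zs) + (t \in ys ++ ys'))%N.
  move: uz; rewrite cat_uniq => /and3P[uzs _ uys].
  rewrite -(count_uniq_mem t uzs) -(count_uniq_mem t uys) /T !count_cat count_double.
  by rewrite addnCA.
split=> [[sg H]|[sg vg dg]].
  split; rewrite -?sT//.
    by move=> t; rewrite -mT => /H[->].
  move=> z zin; have /H[_] : z \in T by rewrite mT mem_cat zin.
  apply; rewrite cT zin; case E : (z \in ys ++ ys') => //.
  by move: uz; rewrite cat_uniq => /and3P[_ /hasPn/(_ z E)/=]; rewrite zin.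
split; rewrite ?sT// => t; rewrite mT => tin; split; first exact: vg.
rewrite cT => c2; apply: dg; move: c2.
by case: (t \in zs) => //; case: (t \in ys ++ ys').
Qed.

End HermiteInterpolation.

(** * The ultraspherical weight *)

Section Integration.
Context {R : realType}.
Notation mu := (@lebesgue_measure R).
Implicit Types (f F : R -> R) (a b c C : R).

Lemma oo_continuous_measurable f a b : {in `]a, b[, continuous f} ->
  measurable_fun `]a, b[ f.
Proof.
move=> cf; apply: open_continuous_measurable_fun => //.
by move=> x; rewrite inE /=; apply: cf.
Qed.

(** On compact subintervals the integral is a difference of values of the bounded primitive [F], so
    monotone convergence bounds the whole integral by 2C. *)
Lemma ge0_oo_integrable f F C a b : a < b ->
  {in `]a, b[, continuous f} -> {in `]a, b[, forall x, 0 <= f x} ->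
  (forall x, x \in `]a, b[ -> is_derive x 1 F (f x)) ->
  {in `]a, b[, forall x, `|F x| <= C} ->
  mu.-integrable `]a, b[ (EFin \o f).
Proof.
move=> ab cf f0 dF FC; apply/integrableP; split.
  by apply/measurable_EFinP; exact: oo_continuous_measurable cf.
pose d := (b - a) / 2.
have d0 : 0 < d by rewrite /d; lra.
pose u (k : nat) := d / k.+1%:R.
pose S k : set R := `[a + u k, b - u k]%classic.
have dk k : 0 < u k <= d.
  by rewrite divr_gt0 //= ler_pdivrMr// ler_peMr ?ler1n// ltW.
have SU : \bigcup_k S k = `]a, b[%classic.
  apply/seteqP; split => [x [k _]|x] /=; rewrite !in_itv /=.
    by rewrite /S /= in_itv /= => xS; have ? := dk k; lra.
  move=> /andP[ax xb]; pose e := Num.min (x - a) (b - x).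
  have e0 : 0 < e by rewrite lt_min !subr_gt0 ax.
  pose k := Num.truncn (d / e); exists k => //.
  have kd : u k <= e.
    rewrite ler_pdivrMr// mulrC -ler_pdivrMr// ltW//.
    exact: truncnS_gt.
  by rewrite /S /= in_itv /=; move: kd; rewrite /e le_min => /andP[? ?]; lra.
have nd : nondecreasing_seq S.
  apply/nondecreasing_seqP => k; rewrite subsetEset => x; rewrite /S /= !in_itv /=.
  have : u k.+1 <= u k.
    by rewrite ler_wpM2l ?(ltW d0)// lef_pV2 ?posrE// ler_nat.
  by move=> ?; lra.
have Sab k : S k `<=` `]a, b[%classic.
  by rewrite -SU; exact: bigcup_sup.
have -> : (\int[mu]_(x in `]a, b[) `|(EFin \o f) x| = \int[mu]_(x in `]a, b[) (EFin \o f) x)%E.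
  by apply: eq_integral => x; rewrite inE => xab /=; rewrite ger0_norm// f0.
rewrite -SU; have mf k : measurable_fun (S k) (EFin \o f).
  apply/measurable_EFinP; apply: measurable_funS (oo_continuous_measurable cf) => //.
have ge0 k x : S k x -> (0 <= (EFin \o f) x)%E.
  by move=> /Sab xab; rewrite lee_fin f0.
have := ge0_nondecreasing_set_cvg_integral (mu := mu) nd (fun k => measurable_itv _) mf ge0.
move=> cv; rewrite -(cvg_lim _ cv)//.
apply: (@le_lt_trans _ _ (2 * C)%:E); last exact: ltry.
apply: lime_le; first by apply/cvg_ex; eexists; exact: cv.
apply: nearW => k; have := dk k => dkk.
(* For k = 0 the subinterval is the midpoint alone, where the fundamental theorem does not apply. *)
have [e|lt] := eqVneq (a + u k) (b - u k).
  rewrite /S e set_itv1 integral_set1 lee_fin.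
  have mab : a + d \in `]a, b[ by rewrite in_itv /= /d; lra.
  by have := FC _ mab; have := normr_ge0 (F (a + d)); lra.
have {}lt : a + u k < b - u k.
  have e : a + d = b - d by rewrite /d; lra.
  by rewrite lt_neqAle lt /=; move: dkk e; lra.
have sub x : a + u k <= x <= b - u k -> x \in `]a, b[.
  by rewrite in_itv /= => ?; lra.
have dF' x : a + u k <= x <= b - u k -> derivable F x 1.
  by move=> /sub /dF [].
have cF x : a + u k <= x <= b - u k -> {for x, continuous F}.
  by move=> /dF'; move/derivable1_diffP/differentiable_continuous.
rewrite (continuous_FTC2 lt (F := F)).
- rewrite -EFinB lee_fin.
  have := FC (a + u k); have := FC (b - u k).
  rewrite !sub ?lexx ?(ltW lt)//= => /(_ isT) H1 /(_ isT) H2.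
  apply: le_trans (ler_norm _) _; apply: le_trans (ler_normB _ _) _; lra.
- apply: continuous_in_subspaceT => x; rewrite inE /= in_itv /= => xI.
  by apply: cf; apply: sub.
- split.
  + by move=> x; rewrite in_itv /= => /andP[? ?]; apply: dF'; rewrite !ltW.
  + by apply: cvg_at_right_filter; apply: cF; rewrite lexx ltW.
  + by apply: cvg_at_left_filter; apply: cF; rewrite lexx ltW.
- move=> x; rewrite in_itv /= => /andP[? ?]; rewrite derive1E.
  have xI : x \in `]a, b[ by apply: sub; rewrite !ltW.
  by case: (dF x xI) => _ ->.
Qed.

(** Here f may blow up at the endpoints: the integral function and [F] are continuous on the closed
    interval with equal derivatives inside. *)
Lemma oo_FTC f F a b : a < b -> mu.-integrable `[a, b] (EFin \o f) ->
  {in `]a, b[, continuous f} -> continuous F ->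
  (forall x, x \in `]a, b[ -> is_derive x 1 F (f x)) ->
  \int[mu]_(x in `[a, b]) f x = F b - F a.
Proof.
move=> ab intf cf cF dF.
pose G x := \int[mu]_(t in `[a, x]) f t.
have cG : {within `[a, b], continuous G}.
  exact: parameterized_integral_continuous (ltW ab) intf.
have dG x : x \in `]a, b[ -> is_derive x 1 G (f x).
  move=> xI; move: (xI); rewrite in_itv /= => /andP[ax xb].
  have [d e] := continuous_FTC1_closed xb intf ax (cf x xI).
  by apply: DeriveDef => //; rewrite -derive1E.
have [||c cI e] := @MVT R (G \- F) (fun=> 0) a b ab.
- by move=> x xI; rewrite -(subrr (f x)); apply: is_deriveB; [exact: dG|exact: dF].
- by move=> x; apply: cvgB; [exact: cG|exact: continuous_subspaceT].
move: e; rewrite mul0r /= {2}/G set_itv1 Rintegral_set1 sub0r => /eqP.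
by rewrite opprK -addrA addr_eq0 opprD opprK => /eqP.
Qed.

Lemma Rintegral_gt0 (D : set R) f a b c : measurable D ->
  mu.-integrable D (EFin \o f) -> (forall x, D x -> 0 <= f x) ->
  a < b -> `[a, b]%classic `<=` D -> 0 < c -> (forall x, a <= x <= b -> c <= f x) ->
  0 < \int[mu]_(x in D) f x.
Proof.
move=> mD intf f0 ab abD c0 cf.
have intab : mu.-integrable `[a, b] (EFin \o f) by apply: integrableS intf.
have le1 : ((c * (b - a))%:E <= \int[mu]_(x in `[a, b]) (f x)%:E)%E.
  rewrite [leLHS](_ : _ = \int[mu]_(x in `[a, b]) (cst c%:E x))%E; last first.
    by rewrite integral_cst//= lebesgue_measure_itv/= lte_fin ab EFinM EFinB.
  apply: ge0_le_integral => //.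
  - by move=> x _; rewrite lee_fin ltW.
  - exact: (measurable_int mu).
have le2 : (\int[mu]_(x in `[a, b]) (f x)%:E <= \int[mu]_(x in D) (f x)%:E)%E.
  apply: ge0_subset_integral => //; first exact: (measurable_int mu).
have := le_trans le1 le2; rewrite /Rintegral -(fineK (integrable_fin_num _ intf))//.
rewrite lee_fin; apply: lt_le_trans; rewrite mulr_gt0 ?subr_gt0//.
Qed.

End Integration.

Section UltrasphericalWeight.
Context {R : realType}.
Notation mu := (@lebesgue_measure R).
Implicit Types (t x : R) (p q : {poly R}) (f : R -> R).

Let S t : R := Num.sqrt (1 - t ^+ 2).

Let S_gt0 t : -1 < t < 1 -> 0 < S t.
Proof. by move=> tI; rewrite sqrtr_gt0; nra. Qed.

Let S_sqr t : -1 < t < 1 -> S t ^+ 2 = 1 - t ^+ 2.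
Proof. by move=> tI; rewrite sqr_sqrtr//; nra. Qed.

Let S_continuous : continuous S.
Proof.
move=> t; apply: continuous_comp; last exact: sqrt_continuous.
by apply: continuousB; [exact: cst_continuous|exact: exprn_continuous].
Qed.

Let SX_continuous k : continuous (fun t => S t ^+ k).
Proof.
move=> t; apply: (@continuous_comp _ _ _ S (fun x : R => x ^+ k)); first exact: S_continuous.
exact: exprn_continuous.
Qed.

Let S_derive t : -1 < t < 1 -> is_derive t 1 S (- t / S t).
Proof.
move=> tI; have s0 : 0 < 1 - t ^+ 2 by nra.
have d1 : is_derive t 1 (fun x : R => 1 - x ^+ 2) (- (2 * t)).
  apply: is_derive_eq; rewrite /GRing.scale /=; ring.
have := @is_derive1_comp R Num.sqrt (fun x : R => 1 - x ^+ 2) t _ _ (is_derive1_sqrt s0) d1.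
move=> /is_derive_eq; apply; rewrite -/(S t).
by have := S_gt0 tI; move=> /lt0r_neq0 S0; field.
Qed.

(* On ]-1, 1[ this is (1 - t^2)^((n - 3)/2) with n = m + 2. *)
Definition ultra_weight (m : nat) t : R := S t ^+ m / S t.

Let in01 t : t \in `]-1, 1[ -> -1 < t < 1.
Proof. by rewrite in_itv. Qed.

Let iS_continuous : {in `]-1, 1[, continuous (fun t => (S t)^-1)}.
Proof.
move=> t /in01/S_gt0/lt0r_neq0 S0; apply: continuousV => //; exact: S_continuous.
Qed.

Let iS_integrable : mu.-integrable `]-1, 1[ (EFin \o (fun t => (S t)^-1)).
Proof.
apply: (@ge0_oo_integrable _ _ asin pi); [lra|exact: iS_continuous|..].
- by move=> t _; rewrite invr_ge0 sqrtr_ge0.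
- move=> t /in01/andP[t1 t2]; have tI : -1 <= t <= 1 by rewrite !ltW.
  have := asin_geNpi2 tI; have := asin_lepi2 tI; have := pi_gt0 R.
  by rewrite ler_norml; lra.
Qed.

Let iSM_integrable f : continuous f ->
  mu.-integrable `]-1, 1[ (EFin \o (fun t => (S t)^-1 * f t)).
Proof.
move=> cf; rewrite (_ : EFin \o _ = (EFin \o (fun t => (S t)^-1)%R) \* (EFin \o f))%E; last first.
  by apply/funext => t; rewrite /= EFinM.
apply: integrableMl => //.
  by apply: measurable_funTS; apply: continuous_measurable_fun.
have cs : {within `[(-1 : R), 1], continuous f} by exact: continuous_subspaceT.
have /compact_bounded[M [_ fM]] := continuous_compact cs (@segment_compact R (-1) 1).
exists M; split; rewrite ?num_real// => y My t tI; apply: fM => //.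
by exists t => //; apply: subset_itv_oo_cc.
Qed.

Lemma weight_integrable m p :
  mu.-integrable `]-1, 1[ (EFin \o (fun t => ultra_weight m t * p.[t])).
Proof.
rewrite (_ : (fun t => _) = (fun t => (S t)^-1 * (S t ^+ m * p.[t]))).
  apply: iSM_integrable => t; apply: cvgM; last exact: continuous_horner.
  exact: SX_continuous.
by apply/funext => t; rewrite /ultra_weight mulrAC [_ / _]mulrC mulrA.
Qed.

Lemma weight_continuous m p :
  {in `]-1, 1[, continuous (fun t => ultra_weight m t * p.[t])}.
Proof.
move=> t tI; apply: cvgM; last exact: continuous_horner.
apply: cvgM; last exact: iS_continuous.
exact: SX_continuous.
Qed.

Lemma weight_gt0 m t : -1 < t < 1 -> 0 < ultra_weight m t.
Proof. by move=> tI; rewrite divr_gt0 ?exprn_gt0 ?S_gt0. Qed.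

Definition ultra_fun m p : R :=
  \int[mu]_(t in `]-1, 1[) (ultra_weight m t * p.[t]).

Lemma ultra_posfun m : posfun (ultra_fun m).
Proof.
split.
  move=> a p q; rewrite /ultra_fun -RintegralZl//; last exact: weight_integrable.
  rewrite -RintegralD//; last 2 first.
  - have := @integrableZl _ _ _ mu _ _ a _ (weight_integrable m p).
    by apply.
  - exact: weight_integrable.
  by apply: eq_Rintegral => t _; rewrite /= hornerD hornerZ; ring.
move=> p p0 pge0.
have [x0 [x0I px0]] : exists x0, -1 < x0 < 1 /\ p.[x0] != 0.
  (* The points 1/(k + 2) provide more candidates in ]0, 1[ than p can have roots. *)
  pose xs := [seq (k.+2%:R : R)^-1 | k <- iota 0 (size p)].
  have uxs : uniq xs.
    rewrite map_inj_uniq ?iota_uniq// => i j /invr_inj/eqP.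
    by rewrite eqr_nat => /eqP[].
  have /allPn[x /mapP[k _ xk] nr] : ~~ all (root p) xs.
    apply/negP => rxs; have := max_poly_roots p0 rxs uxs.
    by rewrite size_map size_iota ltnn.
  exists x; split => //; rewrite xk.
  have i0 : 0 < (k.+2%:R : R)^-1 by rewrite invr_gt0.
  have i1 : (k.+2%:R : R)^-1 < 1 by rewrite invf_lt1// ltr1n.
  by rewrite i1 andbT (lt_trans _ i0)// ltrN10.
have {}px0 : 0 < p.[x0] by rewrite lt_neqAle eq_sym px0 pge0.
pose f t := ultra_weight m t * p.[t].
have fx0 : 0 < f x0 by rewrite mulr_gt0 ?weight_gt0.
have x0I' : x0 \in `]-1, 1[ by rewrite in_itv.
have /cvgrPdist_lt/(_ (f x0 / 2)) := @weight_continuous m p x0 x0I'.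
rewrite divr_gt0// => /(_ isT)/nbhs_ballP[d /= d0 dP].
pose e := Num.min (d / 2) ((1 - x0) / 2).
have e0 : 0 < e by rewrite lt_min !divr_gt0 ?subr_gt0//; case/andP: x0I.
have [ed e1] : e <= d / 2 /\ e <= (1 - x0) / 2 by rewrite /e !ge_min !lexx orbT.
have sub t : x0 <= t <= x0 + e -> -1 < t < 1 by lra.
apply: (@Rintegral_gt0 _ _ _ x0 (x0 + e) (f x0 / 2)) => //.
- exact: weight_integrable.
- move=> t; rewrite /= in_itv /= => tI.
  by apply: mulr_ge0; [exact/ltW/weight_gt0|exact: pge0].
- by rewrite ltrDl.
- by rewrite divr_gt0.
- move=> t tI; have : ball x0 d t.
    by rewrite /ball /= ltr_norml; lra.
  by move=> /dP; rewrite -/(f x0) -/(f t) ltr_norml; lra.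
Qed.

Lemma Rintegral_cc_oo f a b : mu.-integrable `]a, b[ (EFin \o f) ->
  \int[mu]_(t in `[a, b]) f t = \int[mu]_(t in `]a, b[) f t.
Proof.
move=> intf; rewrite /Rintegral integral_itv_bndoo//.
exact: (measurable_int mu).
Qed.

Lemma integrable_cc_oo f a b : mu.-integrable `]a, b[ (EFin \o f) ->
  mu.-integrable `[a, b] (EFin \o f).
Proof.
move=> intf; have mf := measurable_int mu intf.
apply/integrableP; split.
  apply/measurable_EFinP/measurable_fun_itv_bndo_bndcP.
  by apply/measurable_fun_itv_obnd_cbndP/measurable_EFinP.
rewrite integral_itv_bndoo.
  by move/integrableP : intf => [].
exact: measurableT_comp.
Qed.

(** The difference of the two integrands, times the weight, is the derivative of (1 - t^2)^((m +
    1)/2) p, which vanishes at both endpoints. *)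
Lemma ultra_ibp m p :
  ultra_fun m ((1 - 'X ^+ 2) * p^`()) = m.+1%:R * ultra_fun m ('X * p).
Proof.
pose q := (1 - 'X ^+ 2) * p^`() - m.+1%:R *: ('X * p).
have q0 : ultra_fun m q = 0.
  rewrite /ultra_fun -Rintegral_cc_oo; last exact: weight_integrable.
  pose F t := S t ^+ m.+1 * p.[t].
  have -> : \int[mu]_(t in `[-1, 1]) (ultra_weight m t * q.[t]) = F 1 - F (-1).
    apply: oo_FTC.
    - lra.
    - exact/integrable_cc_oo/weight_integrable.
    - exact: weight_continuous.
    - move=> t; apply: cvgM; last exact: continuous_horner.
      exact: SX_continuous.
    - move=> t /in01 tI; have dS := S_derive tI.
      have S0 : S t != 0 by rewrite gt_eqF ?S_gt0.
      have dp : is_derive t 1 (horner p) p^`().[t] by exact: is_derive_poly.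
      have -> : F = S ^+ m.+1 * horner p.
        by apply/funext => x; rewrite /F !fctE.
      have D := is_deriveM (is_deriveX m dS) dp.
      apply: is_derive_eq.
      have X2 : (1 - 'X^2).[t] = S t ^+ 2.
        by rewrite S_sqr// hornerD hornerN hornerXn -polyC1 hornerC.
      rewrite /ultra_weight /q exprfctE hornerD hornerN hornerZ !hornerM X2 hornerX.
      by rewrite /GRing.scale /= !exprS; field.
  by rewrite /F /S sqrrN expr1n subrr sqrtr0 expr0n !mul0r subrr.
have [lin _] := ultra_posfun m.
have := lin (- m.+1%:R) ('X * p) ((1 - 'X ^+ 2) * p^`()).
by rewrite scaleNr addrC -/q q0 => /eqP; rewrite eq_sym mulNr addrC subr_eq0 => /eqP.
Qed.

End UltrasphericalWeight.

(** * Positivity of the normalising constant of the measure *)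

Section GammaPositive.
Context {R : realType}.
Notation mu := (@lebesgue_measure R).

Lemma isqrt_integrable : mu.-integrable `]0, 1[ (EFin \o (fun t : R => (Num.sqrt t)^-1)).
Proof.
have s0 (t : R) : t \in `]0, 1[ -> 0 < Num.sqrt t.
  by rewrite in_itv /= sqrtr_gt0 => /andP[].
apply: (@ge0_oo_integrable _ _ (fun t : R => 2 * Num.sqrt t) 2); [lra|..].
- move=> t /s0/lt0r_neq0 S0; apply: continuousV => //; exact: sqrt_continuous.
- by move=> t _; rewrite invr_ge0 sqrtr_ge0.
- move=> t tI; have t0 : 0 < t by move: tI; rewrite in_itv => /andP[].
  have d := is_derive1_sqrt t0; apply: is_derive_eq.
  rewrite /GRing.scale /= invfM mulrA; field; rewrite gt_eqF//; exact: s0.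
- move=> t tI; rewrite ger0_norm ?mulr_ge0 ?sqrtr_ge0//.
  rewrite ler_piMr// -[leRHS]sqrtr1 ler_wsqrtr//.
  by move: tI; rewrite in_itv => /andP[_ /ltW].
Qed.

Variable k : nat.
Let a : R := k.+1%:R / 2.
Let f (t : R) := t `^ (a - 1) * expR (- t).

Let a_bounds : - 2^-1 <= a - 1 /\ a - 1 <= k.+1%:R.
Proof.
have k1 : 1 <= k.+1%:R :> R by rewrite ler1n.
by rewrite /a; move: k1; set z := k.+1%:R; lra.
Qed.

Let f_ge0 t : 0 <= f t.
Proof. by rewrite mulr_ge0 ?powR_ge0 ?expR_ge0. Qed.

Let f_measurable : measurable_fun setT f.
Proof.
apply: measurable_funM; first exact: measurable_powR.
apply: continuous_measurable_fun => t; apply: continuous_comp; last exact: continuous_expR.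
exact: opp_continuous.
Qed.

(** For t >= 1, t^(k+1) <= (k+1)! 2^(k+1) exp(t/2) leaves exp(-t/2) in the integrand; the leading 2
    cancels the 1/2 of the exponential density. *)
Let C : R := 2 * (k.+1`!%:R * 2 ^+ k.+1).
Let g0 : R -> R := (fun t : R => (Num.sqrt t)^-1) \_ `]0, 1[.
Let g (t : R) : R := g0 t + C * exponential_pdf 2^-1 t.

Let g_integrable : mu.-integrable setT (EFin \o g).
Proof.
rewrite (_ : EFin \o g = (EFin \o g0) \+
  (fun t : R => C%:E * (exponential_pdf 2^-1 t)%:E))%E; last first.
  by apply/funext => t; rewrite /g /= EFinD EFinM.
apply: integrableD => //.
  rewrite /g0 -restrict_EFin; apply: (iffLR (integrable_mkcond _ _)) => //; exact: isqrt_integrable.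
by apply: integrableZl => //; exact: integrable_exponential_pdf.
Qed.

Let C_ge2 : 2 <= C.
Proof.
rewrite /C ler_peMr// -[leLHS]mulr1 ler_pM// ?exprn_ege1 ?ler1n// fact_gt0 //.
Qed.

Let f_le_g t : 0 <= t -> f t <= g t.
Proof.
move=> t0; have pdf0 : 0 <= C * exponential_pdf 2^-1 t.
  by rewrite mulr_ge0 ?exponential_pdf_ge0// (le_trans _ C_ge2).
have pdfE x : 0 <= x -> exponential_pdf 2^-1 x = 2^-1 * expR (- 2^-1 * x) :> R.
  by move=> x0; rewrite exponential_pdfE.
have [a1 a2] := a_bounds.
have [->|tn0] := eqVneq t 0.
  (* At 0 the real power is 0 or 1 by convention, so the value 1 covered by [C_ge2] suffices. *)
  rewrite /f oppr0 expR0 mulr1 /g /g0 patchE memNset/=; last by rewrite in_itv /= ltxx.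
  rewrite add0r (@le_trans _ _ 1)//.
    by have [->|ne] := eqVneq (a - 1) 0; rewrite ?powRr0 ?powR0.
  by rewrite pdfE// mulr0 expR0; have := C_ge2; lra.
have tgt0 : 0 < t by rewrite lt_neqAle eq_sym tn0.
have [t1|t1] := ltP t 1.
  apply: (@le_trans _ _ (Num.sqrt t)^-1).
    rewrite -powR12_sqrt// -powRN -[leRHS]mulr1 ler_pM ?powR_ge0 ?expR_ge0//.
      by apply: ger_powR => //; rewrite tgt0 ltW.
    by rewrite -[leRHS]expR0 ler_expR oppr_le0.
  rewrite /g /g0 patchE mem_set /= ?lerDl//.
  by rewrite in_itv /= tgt0.
rewrite /g /g0 patchE memNset/=; last by rewrite in_itv /= => /andP[_]; rewrite ltNge t1.
rewrite add0r pdfE//.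
have p1 : t `^ (a - 1) <= t ^+ k.+1.
  by rewrite -powR_mulrn// ler_powR.
have p2 : t ^+ k.+1 <= k.+1`!%:R * 2 ^+ k.+1 * expR (2^-1 * t).
  have th : 0 <= 2^-1 * t by rewrite mulr_ge0.
  have := le_trans (ler_wpDl ler01 (lexx _)) (expR_ge1Dxn k th).
  rewrite ler_pdivrMr ?ltr0n ?fact_gt0// exprMn exprVn mulrC ler_pdivrMr ?exprn_gt0//.
  by move=> /le_trans; apply; rewrite le_eqVlt; apply/orP; left; apply/eqP; ring.
rewrite /f; apply: le_trans (ler_wpM2r (expR_ge0 _) (le_trans p1 p2)) _.
rewrite /C le_eqVlt; apply/orP; left; apply/eqP.
have e1 : expR (- t) = expR (- 2^-1 * t) * expR (- 2^-1 * t).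
  by rewrite -expRD; congr expR; field.
have e2 : expR (2^-1 * t) * expR (- 2^-1 * t) = 1.
  by rewrite -expRD mulNr subrr expR0.
rewrite e1; set E := expR (- 2^-1 * t) in e2 *.
by rewrite -!mulrA [expR _ * _]mulrA e2; field.
Qed.

Lemma Gamma_half_gt0 : 0 < Gamma a.
Proof.
have fint : mu.-integrable `[0, +oo[ (EFin \o f).
  apply: (@le_integrable _ _ _ mu _ _ _ (EFin \o g)) => //.
  - exact/measurable_EFinP/measurable_funTS.
  - move=> t; rewrite /= in_itv /= andbT => t0; rewrite lee_fin !ger0_norm//.
      exact: f_le_g.
    exact: le_trans (f_le_g t0).
  - exact: integrableS g_integrable.
apply: (@Rintegral_gt0 _ _ _ 1 2 (2^-1 * expR (-2))) => //.
- by move=> t _; exact: f_ge0.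
- by rewrite ltr1n.
- by move=> t; rewrite /= !in_itv /= andbT => /andP[t1 _]; exact: le_trans t1.
move=> t /andP[t1 t2]; apply: ler_pM; rewrite ?invr_ge0 ?expR_ge0 ?ler_expR ?lerN2//.
apply: (@le_trans _ _ (t `^ (-1))).
  by rewrite powRN powRr1 ?(le_trans _ t1)// lef_pV2 ?posrE// (lt_le_trans _ t1).
by apply: ler_powR => //; have [] := a_bounds; lra.
Qed.

End GammaPositive.

Lemma gamma_const_gt0 (R : realType) m : 0 < gamma_const m.+2 :> R.
Proof.
rewrite /gamma_const divr_gt0//; first exact: Gamma_half_gt0.
rewrite mulr_gt0 ?sqrtr_gt0 ?pi_gt0//.
by rewrite (_ : (m.+2%:R - 1 = m.+1%:R :> R)%R) ?Gamma_half_gt0// -natr1 addrK.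
Qed.

Section Weights.
Context {R : realType}.
Notation mu := (@lebesgue_measure R).
Variable m : nat.
Implicit Types (p r : {poly R}) (f : R -> R) (t : R).

(** Agreement on the open interval is enough, so conventions for real powers of 0 at the endpoints
    do not matter. *)
Lemma Rintegral_ultra f p :
  (forall t, -1 < t < 1 -> f t = ultra_weight m t * p.[t]) ->
  \int[mu]_(t in `[-1, 1]) f t = ultra_fun m p.
Proof.
move=> fE; have intf : mu.-integrable `]-1, 1[ (EFin \o f).
  apply: eq_integrable (weight_integrable m p) => // t.
  by rewrite inE /= in_itv /= => /fE->.
rewrite Rintegral_cc_oo//; apply: eq_Rintegral => t; rewrite inE /= in_itv /=.
exact: fE.
Qed.

Lemma ultra_weightE t : -1 < t < 1 ->
  (1 - t ^+ 2) `^ ((m.+2%:R - 3) / 2) = ultra_weight m t.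
Proof.
move=> tI; have x0 : 0 < 1 - t ^+ 2 by nra.
rewrite (_ : (m.+2%:R - 3) / 2 = 2^-1 * m%:R + - 2^-1); last first.
  by rewrite -[m.+2]addn2 natrD; field.
rewrite powRD; last by rewrite (gt_eqF x0) implybT.
by rewrite powRrM powRN powR12_sqrt ?(ltW x0)// powR_mulrn ?sqrtr_ge0.
Qed.

Lemma ipw_mu_density p r :
  ipw (mu_density m.+2) p r = gamma_const m.+2 * ultra_fun m (p * r).
Proof.
have [lin _] := ultra_posfun m (R := R).
have -> : gamma_const m.+2 * ultra_fun m (p * r) = ultra_fun m (gamma_const m.+2 *: (p * r)).
  by rewrite (pfZ (ultra_posfun m)).
apply: Rintegral_ultra => t tI.
by rewrite /mu_density ultra_weightE// hornerZ hornerM; ring.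
Qed.

Lemma horner_adj_weight (e : bool) t :
  (adj_weight R e).[t] = (1 - t) * (1 + t) ^+ e.
Proof. by rewrite /adj_weight hornerM horner_exp !hornerE. Qed.

Lemma ipw_lev_weight (e : bool) p r :
  ipw (lev_weight m.+2 e) p r = gamma_const m.+2 * adj_fun (ultra_fun m) e (p * r).
Proof.
rewrite /adj_fun -(pfZ (ultra_posfun m)).
apply: Rintegral_ultra => t tI.
rewrite /lev_weight /mu_density ultra_weightE// hornerZ (hornerM (adj_weight R e)) horner_adj_weight (hornerM p); ring.
Qed.

Lemma ipw_jacobi (b : bool) p r :
  ipw (fun t => (1 - t) `^ (true%:R + (m.+2%:R - 3) / 2) *
                (1 + t) `^ (b%:R + (m.+2%:R - 3) / 2)) p r =
  adj_fun (ultra_fun m) b (p * r).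
Proof.
apply: Rintegral_ultra => t tI.
have t1 : 0 < 1 - t by lra.
have t2 : 0 < 1 + t by lra.
rewrite (hornerM (adj_weight R b)) horner_adj_weight (hornerM p) -ultra_weightE//.
rewrite !powRD ?(gt_eqF t1) ?(gt_eqF t2) ?implybT// powRr1 ?(ltW t1)// powR_mulrn ?(ltW t2)//.
have -> : 1 - t ^+ 2 = (1 - t) * (1 + t) by ring.
by rewrite powRM ?(ltW t1) ?(ltW t2)//; ring.
Qed.

End Weights.

(** * Identification of the definitions *)

(** Rules out the default value 0 of [xget] once a witness is known. *)
Lemma orthopolyP (R : realType) (w : R -> R) k c :
  (exists p, is_orthopoly w k c p) -> is_orthopoly w k c (orthopoly w k c).
Proof. by rewrite /orthopoly; case: xgetP => [x -> H _|H [p /H]]. Qed.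

Lemma gegenbauer_coefsP (R : realType) n (p : {poly R}) :
  (exists c : {poly R}, p = \sum_(i < size c) c`_i *: gegenbauer n i) ->
  let c := gegenbauer_coefs n p in p = \sum_(i < size c) c`_i *: gegenbauer n i.
Proof. by rewrite /gegenbauer_coefs; case: xgetP => [x -> H _|H [c /H]]. Qed.

Lemma lev_kernelP (R : realType) n l eps (s : R) :
  let P (K : {poly R}) := (size K <= l)%N /\
    forall p : {poly R}, (size p <= l)%N -> ipw (lev_weight n eps) p K = p.[s] in
  (exists K, P K) -> P (lev_kernel n l eps s).
Proof. by rewrite /lev_kernel; case: xgetP => [x -> H _|H [c /H]]. Qed.

Lemma rcons_sorted (R : realType) (zs : seq R) s : sorted <%R zs ->
  {in zs, forall z, z < s} -> sorted <%R (rcons zs s).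
Proof.
case: zs => //= z zs pz zI; rewrite rcons_path pz /=; apply: zI.
exact: mem_last.
Qed.

Section Identification.
Context {R : realType}.
Variable m : nat.
Let n := m.+2.
Let L : {poly R} -> R := ultra_fun m.
Let HL : posfun L := ultra_posfun m.
Let L_ibp := @ultra_ibp R m.
Let g : R := gamma_const n.
Let g0 : 0 < g. Proof. exact: gamma_const_gt0. Qed.
Implicit Types (p q r : {poly R}) (k l : nat) (s : R) (eps : bool).

Lemma isop_uniq (M : {poly R} -> R) k p q : posfun M -> isop M k p -> isop M k q ->
  exists c, q = c *: p.
Proof.
move=> HM [sp op] [sq oq]; exists (lead_coef q / lead_coef p).
have p0 : lead_coef p != 0 by rewrite lead_coef_eq0 -size_poly_gt0 sp.
set c := _ / _; pose d := q - c *: p.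
have sd : (size d <= k)%N.
  apply/leq_sizeP => j; rewrite leq_eqVlt => /predU1P[<-|kj].
    rewrite coefB coefZ; have e (u : {poly R}) : size u = k.+1 -> u`_k = lead_coef u by rewrite lead_coefE => ->.
    by rewrite !e// divfK ?subrr.
  by rewrite coefB coefZ !nth_default ?mulr0 ?subrr ?sp ?sq.
apply/eqP; rewrite -subr_eq0 -/d; apply/negPn/negP => d0.
have := pf_sqr_gt0 HM d0; rewrite expr2 {1}/d mulrBl (pfB HM) oq// -scalerAl (pfZ HM) op//.
by rewrite mulr0 subrr ltxx.
Qed.

Lemma gegenbauerE k : gegenbauer n k = geg R m k.
Proof.
have ex : exists p, is_orthopoly (mu_density n) k 1 p.
  exists (geg R m k); split; rewrite ?size_geg ?geg_at1//.
  by move=> r sr; rewrite ipw_mu_density -/L (proj2 (geg_isop HL L_ibp k) _ sr) mulr0.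
have [] := orthopolyP ex; rewrite -[orthopoly _ _ _]/(gegenbauer n k) => s1 v1 o1.
have iso : isop L k (gegenbauer n k).
  split => // r /o1; rewrite ipw_mu_density => /eqP.
  by rewrite mulf_eq0 gt_eqF//= => /eqP.
have [c e] := isop_uniq HL (geg_isop HL L_ibp k) iso.
move: v1; rewrite e hornerZ geg_at1 mulr1 => ->.
by rewrite scale1r.
Qed.

Lemma gcoefE p k : gcoef n p k = gcf m L p k.
Proof.
pose c : {poly R} := \poly_(i < size p) gcf m L p i.
have ex : exists c : {poly R}, p = \sum_(i < size c) c`_i *: gegenbauer n i.
  exists c; rewrite {1}(gcf_expand HL L_ibp (leqnn (size p))).
  have sc : (size c <= size p)%N by exact: size_poly.
  transitivity (\sum_(i < size p) c`_i *: gegenbauer n i).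
    by apply: eq_bigr => i _; rewrite coef_poly ltn_ord gegenbauerE.
  rewrite (big_ord_widen_cond _ xpredT (fun i => c`_i *: gegenbauer n i) sc).
  rewrite [RHS]big_mkcond; apply: eq_bigr => i _ /=; case: ltnP => // ge.
  by rewrite nth_default// scale0r.
have : p = \sum_(i < size (gegenbauer_coefs n p)) (gegenbauer_coefs n p)`_i *: gegenbauer n i.
  exact: (gegenbauer_coefsP ex).
rewrite /gcoef; move: (gegenbauer_coefs n p) => d pE.
rewrite [in RHS]pE (gcf_sum m HL).
under eq_bigr do rewrite gegenbauerE (gcfZ m HL) (gcf_geg HL L_ibp).
have [kd|dk] := ltnP k (size d).
  rewrite (bigD1 (Ordinal kd))//= eqxx mulr1 big1 ?addr0// => i.
  by rewrite -val_eqE /= => /negPf->; rewrite mulr0.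
rewrite nth_default// big1// => i _; rewrite ltn_eqF ?mulr0//.
exact: leq_trans dk.
Qed.

(** The scalar is nonzero because the prescribed value at 1 is positive, so both polynomials have
    the same zeros. *)
Lemma jacobi_scale (b : bool) k : exists2 c, c != 0 &
  jacobi (true%:R + (n%:R - 3) / 2) (b%:R + (n%:R - 3) / 2) k = c *: adj_poly R m b k.
Proof.
set J := jacobi _ _ _; pose v : R := \prod_(1 <= i < k.+1) ((true%:R + (n%:R - 3) / 2 + i%:R) / i%:R).
have v0 : 0 < v.
  rewrite /v big_nat_cond prodr_gt0// => i /andP[/andP[i1 _] _].
  rewrite divr_gt0 ?ltr0n//; have : 1 <= i%:R :> R by rewrite ler1n.
  have : 2 <= n%:R :> R by rewrite ler_nat.
  rewrite (_ : true%:R = 1 :> R)//; move: (i%:R : R) (n%:R : R) => x y x1 y2; lra.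
have HM := adj_posfun HL b; have HQ := adj_isop HL L_ibp b k.
have Q1 := adj1_gt0 R m b k.
have ex : exists p, is_orthopoly (fun t => (1 - t) `^ (true%:R + (n%:R - 3) / 2) *
                (1 + t) `^ (b%:R + (n%:R - 3) / 2)) k v p.
  exists ((v / (adj_poly R m b k).[1]) *: adj_poly R m b k).
  have c0 : v / (adj_poly R m b k).[1] != 0 by rewrite gt_eqF// divr_gt0.
  split; first by rewrite size_scale// (proj1 HQ).
    by rewrite hornerZ divfK// gt_eqF.
  move=> r sr; rewrite ipw_jacobi -scalerAl (pfZ HM).
  by rewrite (proj2 HQ)// mulr0.
have [s1 v1 o1] := orthopolyP ex.
have iso : isop (adj_fun L b) k J.
  by split => // r /o1; rewrite ipw_jacobi.
have [c e] := isop_uniq HM HQ iso; exists c => //.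
apply: contraTneq v0 => c0; move: v1; rewrite -/(jacobi _ _ _) -/J e c0 scale0r horner0 => <-.
by rewrite ltxx.
Qed.

Lemma jacobi_max_zeroP (b : bool) k : (0 < k)%N ->
  root (adj_poly R m b k) (jacobi_max_zero n true b k) /\
  forall x, root (adj_poly R m b k) x -> x <= jacobi_max_zero n true b k.
Proof.
case: k => // k _; rewrite /jacobi_max_zero.
have [c c0 ->] := jacobi_scale b k.+1.
have HQ := adj_isop HL L_ibp b k.+1; have Q0 := isop_neq0 HQ.
have cQ0 : c *: adj_poly R m b k.+1 != 0 by rewrite scaler_eq0 negb_or c0.
have rE x : root (adj_poly R m b k.+1) x = (x \in rootsR (c *: adj_poly R m b k.+1)).
  by rewrite -(roots_on_rootsR cQ0) rootZ// in_itv.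
have srt : sorted <%R (rootsR (c *: adj_poly R m b k.+1)) by exact: sorted_roots.
move: (rootsR _) srt rE => rs srt rE.
have rs0 : rs != [::].
  have [zs [_ szs rzs]] := isop_uniq_roots (adj_posfun HL b) HQ.
  case: zs szs rzs => // z zs _ /(_ z (mem_head _ _)); rewrite rE.
  by apply: contraTneq => ->.
case: rs rs0 srt rE => // r0 rs _ /= pth rE; split.
  by rewrite rE mem_last.
move=> x; rewrite rE; elim: rs r0 pth x {rE} => [|r1 rs IH] r0 /=.
  by move=> _ x; rewrite inE => /eqP->.
move=> /andP[r01 pth] x; rewrite inE => /predU1P[->|]; last exact: IH.
by apply: le_trans (ltW r01) _; apply: IH => //; rewrite mem_head.
Qed.

Section Interval.
Variables (s : R) (l : nat) (eps : bool).
Hypothesis l0 : (0 < l)%N.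
Hypothesis sI : lev_interval n l eps s.

Let t : R := jacobi_max_zero n true eps l.

Let root_t : root (adj_poly R m eps l) t.
Proof. by have [] := jacobi_max_zeroP eps l0. Qed.

Let st : s <= t.
Proof. by move: sI; rewrite /lev_interval /= in_itv /= => /andP[]. Qed.

Let low : if eps then forall x, root (gA R m l) x -> x <= s
  else -1 <= s /\ forall x, root (gE R m l.-1) x -> x <= s.
Proof.
move: sI; rewrite /lev_interval /= in_itv /= => /andP[+ _].
case: (eps) => /= ls.
  move: ls; rewrite subnK// => ls x rx.
  by have [_ /(_ x rx)/le_trans] := jacobi_max_zeroP false l0; apply.
(* For l = 1 the left endpoint is the convention -1, and [gE 0 = 1] has no root. *)
move: ls; rewrite addn0 subn1; case: (posnP l.-1) => [->|l1].
  by rewrite gE0 /= => s1; split => // x; rewrite -polyC1 rootC oner_eq0.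
move=> ls; have [rt max] := jacobi_max_zeroP true l1; split; last first.
  by move=> x /max/le_trans; apply.
have /andP[/ltW tN1 _] := isop_root_itv (adj_posfun HL true) (adj_isop HL L_ibp true l.-1) rt.
exact: le_trans ls.
Qed.

Let K := kernel_sum (adj_fun L eps) (adj_poly R m eps) s l g.
Let HM := adj_posfun HL eps.
Let HQ := adj_isop HL L_ibp eps.

Let lev_kernelE : lev_kernel n l eps s = K.
Proof.
have ex : exists K0 : {poly R}, (size K0 <= l)%N /\
    forall p, (size p <= l)%N -> ipw (lev_weight n eps) p K0 = p.[s].
  exists K; split; first exact: (size_kernel_sum HQ).
  by move=> p sp; rewrite ipw_lev_weight; exact: kernel_sum_repr.
have [s1 r1] := lev_kernelP ex.
apply: (kernel_uniq HM HQ g0) => // p sp.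
by rewrite -(r1 p sp) ipw_lev_weight.
Qed.

Let F := phi m L s l eps g * K.

Lemma lev_s_bounds : [/\ -1 <= s, s < 1 & eps -> -1 < s].
Proof.
split; [exact: (lev_s_geN1 HL L_ibp l0 low)|exact: (lev_s_lt1 HL L_ibp root_t st)|].
exact: (lev_s_gtN1 HL L_ibp l0 low).
Qed.

Let FE : ('X + 1) ^+ eps * ('X - s%:P) * K ^+ 2 = F.
Proof. by rewrite /F /phi /psi -/K addrC; ring. Qed.

(** Two descriptions are kept: the product over nodes gives signs and the multiset T, the multiple
    of [F] gives the coefficients and the value at 1. *)
Lemma lev_poly_factor : exists zs, [/\ sorted <%R zs, (size zs).+1 = l,
  {in zs, forall z, (if eps then -1 < z else -1 <= z) && (z < s)} &
  lev_poly n l eps s = ('X + 1) ^+ eps * ('X - s%:P) * nodal zs ^+ 2 /\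
  exists2 c, 0 < c & lev_poly n l eps s = c *: F].
Proof.
have [zs [uzs szs zI Kzs]] := lev_kernel_roots HL L_ibp l0 low root_t st g0.
have [_ lK] := lev_size_lead HL L_ibp l0 low root_t st g0.
exists (sort <=%R zs); split.
- by rewrite sort_lt_sorted.
- by rewrite size_sort.
- by move=> z; rewrite mem_sort; exact: zI.
rewrite /lev_poly lev_kernelE FE.
have nz : nodal (sort <=%R zs) = nodal zs by apply: nodal_perm; rewrite perm_sort.
pose N := ('X + 1) ^+ eps * ('X - s%:P) * nodal zs ^+ 2.
have Nm : N \is monic.
  rewrite rpredM ?rpredX ?nodal_monic// rpredM ?monicXsubC// rpredX//.
  by rewrite -polyC1 monicXaddC.
have FN : F = lead_coef K ^+ 2 *: N.
  by rewrite -FE {1}/K Kzs -/K exprZn -scalerAr.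
have c0 : 0 < lead_coef K ^+ 2 by rewrite exprn_gt0.
have lF : lead_coef F = lead_coef K ^+ 2.
  by rewrite FN lead_coefZ; move: Nm; rewrite monicE => /eqP->; rewrite mulr1.
split; last by exists (lead_coef F)^-1; rewrite ?invr_gt0 lF.
by rewrite nz {2}FN scalerA lF mulVf ?scale1r// gt_eqF.
Qed.

Lemma size_lev_poly : (size (lev_poly n l eps s) <= (lev_deg l eps).+1)%N.
Proof.
have [zs [_ szs _ [-> _]]] := lev_poly_factor.
have e1 : size (('X + 1 : {poly R}) ^+ eps) = eps.+1.
  by case: (eps); rewrite ?expr0 ?size_poly1// expr1 -polyC1 size_XaddC.
have e2 : (size (nodal zs ^+ 2) <= (2 * (size zs)).+1)%N.
  by apply: leq_trans (size_poly_exp_leq _ _) _; rewrite size_nodal mulnC.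
apply: leq_trans (size_polyMleq _ _) _.
have := size_polyMleq (('X + 1 : {poly R}) ^+ eps) ('X - s%:P).
rewrite e1 size_XsubC /lev_deg; move: szs e2; move: (size _) (size _) (size _).
clear; lia.
Qed.

Lemma gcf_lev_poly_gt0 k : (k <= lev_deg l eps)%N -> 0 < gcf m L (lev_poly n l eps s) k.
Proof.
move=> kq; have [zs [_ _ _ [_ [c c0 ->]]]] := lev_poly_factor.
rewrite (gcfZ m HL) mulr_gt0//; apply: (gcf_phiK_gt0 HL L_ibp l0 low root_t st g0).
by move: kq; rewrite /lev_deg; lia.
Qed.

Lemma lev_funE : lev_fun n l eps s = lev_value m s l eps.
Proof.
rewrite /lev_fun /lev_value !gegenbauerE subn1; congr (_ * (_ - _)).
  by rewrite /gc /n; congr ('C(_, _)%:R); lia.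
rewrite /n -[m.+2]addn2 natrD -addn1 natrD; congr (_ / _); ring.
Qed.

Lemma lev_poly_at1 :
  (lev_poly n l eps s).[1] = lev_fun n l eps s * gcf m L (lev_poly n l eps s) 0.
Proof.
have [zs [_ _ _ [_ [c c0 ->]]]] := lev_poly_factor.
rewrite lev_funE (gcfZ m HL) hornerZ /F hornerM.
rewrite (gcf_phiK0 HL L_ibp l0 low root_t st g0) (phi_at1 HL L_ibp l0 low root_t st g0).
rewrite -/K; ring.
Qed.

Lemma multiset_TE : exists zs, [/\ uniq (zs ++ nseq eps (-1) ++ [:: s]),
  (size zs).+1 = l, {in zs, forall z, -1 <= z <= s},
  multiset_T n l eps s =
    nseq eps (-1) ++ flatten [seq nseq 2 z | z <- zs] ++ [:: s] &
  forall t, -1 <= t <= s -> (lev_poly n l eps s).[t] <= 0].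
Proof.
have [zs [srt szs zI [fE _]]] := lev_poly_factor.
have [sN1 s1 sN1'] := lev_s_bounds.
have uz : uniq zs by apply: sorted_uniq srt; [exact: lt_trans|exact: ltxx].
have uT : uniq (zs ++ nseq eps (-1) ++ [:: s]).
  have zs_s : s \notin zs by apply/negP => /zI; rewrite ltxx andbF.
  rewrite cat_uniq uz; move: zI sN1'; case: (eps) => /= zI sN1'; last first.
    by rewrite orbF andbT.
  rewrite orbF negb_or zs_s andbT inE lt_eqF ?sN1'// !andbT.
  by apply/negP => /zI; rewrite ltxx.
exists zs; split => //.
- by move=> z /zI/andP[+ /ltW->]; case: (eps) => [/ltW ->|->].
- have f0 : lev_poly n l eps s != 0.
    have := gcf_lev_poly_gt0 (leq0n _).
    by apply: contraTneq => ->; rewrite gcf0// ltxx.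
  have rsE : rootsR (lev_poly n l eps s) = nseq eps (-1) ++ zs ++ [:: s].
    apply: lt_sorted_eq; first exact: sorted_roots.
      have srt' : sorted <%R (zs ++ [:: s]).
        by rewrite cats1; apply: (rcons_sorted srt) => z /zI/andP[].
      move: zI sN1'; case: (eps) => // zI /(_ isT) sN1'.
      change (path <%R (-1) (zs ++ [:: s])); rewrite path_sortedE; last exact: lt_trans.
      by rewrite srt' all_cat /= sN1' !andbT; apply/allP => z /zI/andP[].
    move=> x; rewrite -(roots_on_rootsR f0) in_itv /= fE !rootM orbb.
    rewrite root_nodal root_XsubC !mem_cat inE -orbA (orbC (_ == s)); congr (_ || _).
    case: (eps); first by rewrite expr1 -polyC1 -[1]opprK polyCN root_XsubC mem_nseq !opprK.
    by rewrite expr0 /root hornerC oner_eq0.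
  rewrite /multiset_T /lev_node rsE; congr (_ ++ _); first by case: (eps).
  have e1 : (l - 1)%N = size zs by rewrite -szs subn1.
  rewrite e1 nth_cat size_nseq ltnNge leq_addl addnK/= nth_cat ltnn subnn /=.
  congr (flatten _ ++ _).
  transitivity [seq nseq 2 z | z <- [seq (nseq eps (-1) ++ zs ++ [:: s])`_i | i <- iota eps (size zs)]].
    by rewrite -map_comp.
  congr map; rewrite map_nth_iota; last first.
    by rewrite !size_cat size_nseq /= addKn leq_addr.
  by rewrite drop_size_cat ?size_nseq// take_size_cat.
- move=> x /andP[x1 xs]; rewrite fE [_.[x]]hornerM.
  apply: mulr_le0_ge0; last by rewrite horner_exp sqr_ge0.
  rewrite hornerM; apply: mulr_ge0_le0; last by rewrite hornerXsubC subr_le0.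
  by rewrite horner_exp exprn_ge0// hornerD hornerX hornerC -lerBlDr sub0r.
Qed.

End Interval.
End Identification.

(** * The energy bound *)

Lemma hermiteP (R : realType) h (T : seq R) :
  (exists g, is_hermite h T g) -> is_hermite h T (hermite h T).
Proof. by rewrite /hermite; case: xgetP => [x -> H _|H [c /H]]. Qed.

Lemma hermite_ge (R : realType) (h : R -> \bar R) (s : R) (zs ys : seq R) :
  s < 1 -> uniq (zs ++ ys ++ [:: s]) ->
  {in zs ++ ys ++ [:: s], forall z, -1 <= z <= s} ->
  deriv_ge0 (2 * size zs + size ys).+1 h s ->
  let g := hermite h (ys ++ flatten [seq nseq 2 z | z <- zs] ++ [:: s]) in
  (size g <= (2 * size zs + size ys).+1)%N /\
  forall t, -1 <= t <= s -> exists2 c, 0 <= c &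
    fine (h t) - g.[t] = c * (nodal2 zs (ys ++ [:: s])).[t].
Proof.
move=> s1 uT TI dh g.
have ig : interpolates (fine \o h) (hderiv (fine \o h)) zs (ys ++ [:: s]) g.
  have [g0 /(is_hermiteP h g0 uT) ig0] :=
    interpolates_exists (fine \o h) (hderiv (fine \o h)) uT.
  by apply/(is_hermiteP h g uT)/hermiteP; exists g0.
have sy : (2 * size zs + size (ys ++ [:: s]))%N = (2 * size zs + size ys).+1.
  by rewrite size_cat addn1 addnS.
split; first by case: ig; rewrite sy.
apply: (hermite_error s1 uT TI _ ig); rewrite sy//.
Qed.

Section Bound.
Context {R : realType}.
Variable m : nat.
Let n := m.+2.
Let L : {poly R} -> R := ultra_fun m.
Let HL : posfun L := ultra_posfun m.
Let L_ibp := @ultra_ibp R m.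
Implicit Types (p q G : {poly R}) (k l N : nat) (s : R) (eps : bool).

(** Adding the diagonal costs G(1) / N_W. In the full double sum, degree 0 contributes G_0 because
    the weights sum to 1, and by [schoenberg] higher degrees contribute nonpositive amounts. *)
Lemma energy_le (h : R -> \bar R) N (W : 'I_N -> R) (C : 'I_N -> 'rV[R]_n) G :
  weight_vector W -> spherical_code C ->
  (forall i j, i != j -> (h (dot (C i) (C j)) <= (G.[dot (C i) (C j)])%:E)%E) ->
  (forall k, (0 < k)%N -> gcf m L G k <= 0) ->
  (energy h W C <= (gcf m L G 0 - G.[1] / NW W)%:E)%E.
Proof.
move=> [W0 W1] [C1 _] hG Gk.
pose a i j := W i * W j * G.[dot (C i) (C j)].
have eS : (energy h W C <= (\sum_i \sum_(j | i != j) a i j)%:E)%E.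
  rewrite -sumEFin; apply: lee_sum => i _; rewrite -sumEFin; apply: lee_sum => j ij.
  rewrite /a [leRHS]EFinM; apply: lee_wpmul2l; last exact: hG.
  by rewrite lee_fin ltW// mulr_gt0.
apply: le_trans eS _; rewrite lee_fin.
have -> : \sum_i \sum_(j | i != j) a i j = \sum_i \sum_j a i j - G.[1] / NW W.
  apply/eqP; rewrite eq_sym subr_eq; apply/eqP.
  rewrite /NW div1r invrK mulr_sumr -big_split /=; apply: eq_bigr => i _.
  rewrite (bigD1 i)//= addrC /a C1; congr (_ + _); last by ring.
  by apply: eq_bigl => j; rewrite eq_sym.
rewrite lerD2r.
have -> : \sum_i \sum_j a i j = \sum_(k < size G) gcf m L G k *
    \sum_i \sum_j W i * W j * (geg R m k).[dot (C i) (C j)].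
  transitivity (\sum_i \sum_j \sum_(k < size G)
      gcf m L G k * (W i * W j * (geg R m k).[dot (C i) (C j)])).
    apply: eq_bigr => i _; apply: eq_bigr => j _.
    rewrite /a {1}(gcf_expand HL L_ibp (leqnn (size G))) horner_sum mulr_sumr.
    by apply: eq_bigr => k _; rewrite hornerZ; ring.
  under eq_bigr do rewrite exchange_big /=.
  rewrite exchange_big /=; apply: eq_bigr => k _.
  by rewrite mulr_sumr; apply: eq_bigr => i _; rewrite mulr_sumr.
have S0 k : 0 <= \sum_i \sum_j W i * W j * (geg R m k).[dot (C i) (C j)].
  by apply: schoenberg => i; exact: C1.
case sG : (size G) => [|d].
  by rewrite big_ord0 (gcf_high HL L_ibp) ?sG.
rewrite big_ord_recl /= -[leRHS]addr0 lerD//.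
  under eq_bigr => i _ do under eq_bigr => j _ do rewrite [geg _ _ 0]/= hornerC mulr1.
  under eq_bigr => i _ do rewrite -mulr_sumr W1 mulr1.
  by rewrite W1 mulr1.
by apply: sumr_le0 => k _; rewrite mulr_le0_ge0// Gk.
Qed.

Lemma max_dotP N (C : 'I_N -> 'rV[R]_n) s : max_dot C = s%:E ->
  forall i j, i != j -> dot (C i) (C j) <= s.
Proof.
move=> sE i j ij; rewrite -lee_fin -sE /max_dot.
apply: le_trans (le_bigmax _ _ i).
exact: (le_bigmax_cond _ (fun j => (dot (C i) (C j))%:E)).
Qed.

Lemma dot_geN1 (x y : 'rV[R]_n) : dot x x = 1 -> dot y y = 1 -> -1 <= dot x y.
Proof.
move=> x1 y1.
have : 0 <= \sum_(i < n) (x 0 i + y 0 i) ^+ 2 by apply: sumr_ge0 => i _; exact: sqr_ge0.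
under eq_bigr do rewrite sqrrD -mulr_natr.
rewrite !big_split /= -mulr_suml.
have -> : \sum_(i < n) x 0 i ^+ 2 = 1 by [].
have -> : \sum_(i < n) y 0 i ^+ 2 = 1 by [].
rewrite /dot; lra.
Qed.

(** All ratios in the list are positive and the fold starts at its head, or at 0 if it is empty; so
    lam >= 0, which settles the nonpositive coefficients of g. *)
Lemma lambda_starP (q : nat) (g f : {poly R}) (lam := lambda_star n q g f) :
  (forall k, (k < q)%N -> 0 < gcf m L f k) ->
  0 <= lam /\ forall k, (0 < k < q)%N -> gcf m L g k <= lam * gcf m L f k.
Proof.
move=> f0; rewrite /lam /lambda_star; set r := [seq _ | _ <- _ & _].
have r0 x : x \in r -> 0 < x.
  move=> /mapP[i]; rewrite mem_filter mem_iota => /andP[g0 iq] ->.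
  rewrite divr_gt0//; rewrite gcoefE; apply: f0; lia.
have l0 : 0 <= \big[Num.max/head 0 r]_(x <- r) x.
  case: r r0 => [|x r] r0; first by rewrite big_nil.
  apply: le_trans (bigmax_ge_id _ _ _ _).
  by rewrite /= ltW// r0// mem_head.
split => // k kq; have fk : 0 < gcf m L f k by apply: f0; case/andP: kq.
have [gk|gk] := leP (gcf m L g k) 0.
  by apply: le_trans gk _; rewrite mulr_ge0// ltW.
rewrite -ler_pdivrMr//.
apply: (@le_trans _ _ (gcoef n g k / gcoef n f k)); first by rewrite !gcoefE.
apply: (le_bigmax_seq _ _ _ (fun x => x)) => //.
apply/mapP; exists k => //; rewrite mem_filter mem_iota !gcoefE gk /=; lia.
Qed.

End Bound.

Theorem theorem4p2 (R : realType) (n N : nat) (W : 'I_N -> R)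
    (l : nat) (eps : bool) (s : R) (h : R -> \bar R) :
  (2 <= n)%N -> weight_vector W -> (1 <= l)%N ->
  lev_interval n l eps s ->
  N%:R <= lev_fun n l eps s ->
  potential h ->
  deriv_ge0 (lev_deg l eps) h s ->
  let f := lev_poly n l eps s in
  let gT := hermite h (multiset_T n l eps s) in
  let lambda := lambda_star n (lev_deg l eps) gT f in
  (sup_energy h n W s <=
   (- lambda * gcoef n f 0 * (1 - lev_fun n l eps s / NW W)
    + gcoef n gT 0 - gT.[1] / NW W)%:E)%E.
Proof.
case: n => [|[|m]]// n2 HW l0 sI _ [_ _ hfin] dh.
cbv zeta; set f := lev_poly _ _ _ _; set gT := hermite _ _.
set lambda := lambda_star _ _ _ _.
have [sN1 s1 _] := lev_s_bounds l0 sI.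
have [zs [uT szs zI TE f_le0]] := multiset_TE l0 sI.
set ys := nseq eps (-1) in uT TE.
have qE : lev_deg l eps = (2 * size zs + size ys).+1.
  rewrite /lev_deg size_nseq; move: szs; move: (size zs); case: (eps) => /=; lia.
have TI : {in zs ++ ys ++ [:: s], forall z, -1 <= z <= s}.
  move=> z; rewrite !mem_cat mem_nseq inE => /or3P[/zI//|/andP[_ /eqP->]|/eqP->].
    by rewrite lexx.
  by rewrite sN1 lexx.
rewrite qE in dh; have := hermite_ge s1 uT TI dh.
rewrite -TE -/gT => -[sg hg].
have fk k : (k <= lev_deg l eps)%N -> 0 < gcf m (ultra_fun m) f k.
  exact: gcf_lev_poly_gt0.
have [lam0 lamk] := @lambda_starP R m (lev_deg l eps) gT f (fun k kq => fk k (ltnW kq)).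
rewrite -/lambda in lam0 lamk.
have HL := @ultra_posfun R m; have ibp := @ultra_ibp R m.
pose G := gT + (- lambda) *: f.
have Gk k : gcf m (ultra_fun m) G k =
    gcf m (ultra_fun m) gT k - lambda * gcf m (ultra_fun m) f k.
  by rewrite (gcfD m HL) (gcfZ m HL) mulNr.
have Gk0 k : (0 < k)%N -> gcf m (ultra_fun m) G k <= 0.
  move=> k0; rewrite Gk subr_le0; have [kq|qk] := ltnP k (lev_deg l eps).
    by apply: lamk; rewrite k0.
  (* [gT] has degree below q, so at k = q only - lambda f_q remains, and above q both coefficients
     vanish. *)
  rewrite (gcf_high HL ibp (leq_trans sg _)) -?qE//.
  have [kq|kq] := leqP k (lev_deg l eps); first by rewrite mulr_ge0// ltW// fk.
  by rewrite (gcf_high HL ibp (leq_trans (size_lev_poly l0 sI) kq)) mulr0.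
apply: ge_ereal_sup => _ [C [[C1 Cinj] Cs] <-].
have hG i j : i != j -> (h (dot (C i) (C j)) <= (G.[dot (C i) (C j)])%:E)%E.
  move=> ij; have ds := max_dotP Cs ij; have dN1 := dot_geN1 (C1 i) (C1 j).
  move: (dot _ _) ds dN1 => t ts tN1.
  have /fineK <- : h t \is a fin_num by apply: hfin; rewrite in_itv /= tN1 (le_lt_trans ts).
  rewrite lee_fin hornerD hornerZ.
  have tI : -1 <= t <= s by rewrite tN1.
  have [c c0 ht] := hg t tI.
  (* Double nodes contribute squares, the simple node -1 a factor t + 1 >= 0, and only t - s is
     nonpositive. *)
  suff nod : (nodal2 zs (ys ++ [:: s])).[t] <= 0.
    have := mulr_ge0_le0 c0 nod; have := mulr_ge0_le0 lam0 (f_le0 t tI).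
    by rewrite -ht -/f; lra.
  rewrite hornerM; apply: mulr_ge0_le0; first by rewrite horner_exp sqr_ge0.
  rewrite nodal_cat hornerM; apply: mulr_ge0_le0.
    rewrite /nodal horner_prod big_seq prodr_ge0// => z.
    by rewrite mem_nseq => /andP[_ /eqP->]; rewrite hornerXsubC opprK -lerBlDr sub0r.
  by rewrite /nodal big_seq1 hornerXsubC subr_le0.
have := energy_le HW (conj C1 Cinj) hG Gk0.
move=> /le_trans; apply; rewrite lee_fin Gk !gcoefE hornerD hornerZ.
rewrite (lev_poly_at1 l0 sI) -/f le_eqVlt; apply/orP; left; apply/eqP; ring.
Qed.
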